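(* Let a compact connected Lie group $G$ act effectively and isometrically on the round unit sphere $\mathbb{S}^{n}$, and let $\mathcal{F}$ be the singular Riemannian foliation of $\mathbb{S}^n$ given by the orbits of $G$. If the quotient $X=\mathbb{S}^{n}/G$ is a Riemannian orbifold (equivalently, the action of $G$ is infinitesimally polar), then the horizontal diameter of $\mathbb{S}^{n}$ with respect to $\mathcal{F}$ equals $\pi$, i.e. $\mathrm{diam}_{\mathcal{H}}\mathbb{S}^{n}=\pi$.
   Context: A Riemannian orbifold is a metric space locally isometric to quotients of Riemannian manifolds by finite groups of isometries; $X=\mathbb{S}^n/G$ carries the quotient metric $d(Gx,Gy)=d(Gx,Gy)$ (distance between orbits). An isometric action of a compact Lie group is infinitesimally polar if all its slice representations are polar (by Lytchak–Thorbergsson this is equivalent to the quotient being a Riemannian orbifold). A piecewise smooth curve in $\mathbb{S}^n$ is horizontal if its velocity is everywhere orthogonal to the orbit (leaf) through the point. The horizontal distance $d_{\mathcal{H}}(p,q)$ is the infimum of lengths of horizontal curves from $p$ to $q$, and $\mathrm{diam}_{\mathcal{H}}\mathbb{S}^n=\sup_{p,q}d_{\mathcal{H}}(p,q)$.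
   Formalization: The action is assumed non-transitive and n ≥ 1: for a transitive action (quotient a point) or for S^0, horizontal curves are constant and the horizontal diameter is infinite. Piecewise smooth is read as piecewise C^1. *)

(* Defs.v *)
From HB Require Import structures.
From mathcomp Require Import all_boot all_order all_algebra.
From mathcomp Require Import all_classical all_reals all_analysis.
Set Implicit Arguments. Unset Strict Implicit. Unset Printing Implicit Defensive.
Import Order.TTheory GRing.Theory Num.Theory.
Import numFieldNormedType.Exports.
Local Open Scope classical_set_scope.
Local Open Scope ring_scope.

Section Defs.
Variables (R : realType) (n : nat).
Local Notation vec := 'cV[R]_(n.+1).
Local Notation mat := 'M[R]_(n.+1).

Definition dotv (u v : vec) : R := (u^T *m v) 0 0.
Definition enorm (u : vec) : R := Num.sqrt (dotv u u).

Definition sphere : set vec := [set p | dotv p p = 1].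

Definition orthogonal_mx : set mat := [set g | g^T *m g = 1%:M].

Definition is_subgroup (G : set mat) : Prop :=
  G 1%:M /\ (forall g h, G g -> G h -> G (g *m h)) /\
  (forall g, G g -> g \in unitmx /\ G (invmx g)).

Definition lie_alg (G : set mat) : set mat :=
  [set X | exists c : R -> mat, (forall t, G (c t)) /\ c 0 = 1%:M /\
      derivable c 0 1 /\ 'D_1 c 0 = X].

Definition orbit_tangent (H : set mat) (v : vec) : set vec :=
  [set X *m v | X in lie_alg H].

Definition isotropy (G : set mat) (p : vec) : set mat :=
  [set g | G g /\ g *m p = p].

Definition normal_space (G : set mat) (p : vec) : set vec :=
  [set w | dotv w p = 0 /\ forall u, orbit_tangent G p u -> dotv w u = 0].

Definition is_lin_subspace (S : set vec) : Prop :=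
  S 0 /\ (forall u v, S u -> S v -> S (u + v)) /\
  (forall (a : R) u, S u -> S (a *: u)).

Definition polar_rep (H : set mat) (V : set vec) : Prop :=
  exists Sigma : set vec, is_lin_subspace Sigma /\ Sigma `<=` V /\
    (forall w, V w -> exists h, H h /\ Sigma (h *m w)) /\
    (forall v u, Sigma v -> Sigma u ->
       forall x, orbit_tangent H v x -> dotv u x = 0).

Definition infinitesimally_polar (G : set mat) : Prop :=
  forall p, sphere p -> polar_rep (isotropy G p) (normal_space G p).

Definition C1 (f : R -> vec) : Prop :=
  (forall t, derivable f t 1) /\ continuous (fun t => 'D_1 f t).

Definition horizontal_curve (G : set mat) (p q : vec) (L : \bar R) : Prop :=
  exists (k : nat) (ts : nat -> R) (fs : nat -> R -> vec),
    (0 < k)%N /\ ts 0%N = 0 /\ ts k = 1 /\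
    (forall i, (i < k)%N -> ts i < ts i.+1) /\
    (forall i, (i < k)%N -> C1 (fs i)) /\
    (forall i t, (i < k)%N -> ts i <= t <= ts i.+1 -> sphere (fs i t)) /\
    (forall i, (i.+1 < k)%N -> fs i (ts i.+1) = fs i.+1 (ts i.+1)) /\
    fs 0%N 0 = p /\ fs k.-1 1 = q /\
    (forall i t, (i < k)%N -> ts i <= t <= ts i.+1 ->
       forall u, orbit_tangent G (fs i t) u -> dotv ('D_1 (fs i) t) u = 0) /\
    L = (\sum_(i < k)
           \int[lebesgue_measure]_(t in `[ts i, ts i.+1])
              (enorm ('D_1 (fs i) t))%:E)%E.

Definition hdist (G : set mat) (p q : vec) : \bar R :=
  ereal_inf [set L | horizontal_curve G p q L].

Definition hdiam (G : set mat) : \bar R :=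
  ereal_sup [set hdist G p q | p in sphere & q in sphere].

End Defs.

(* Main.v *)
(* The lower bound: a horizontal curve from [p] to [- p] is at least as long as the
   angle it sweeps.

   The upper bound: for a chord [s(t) = p + t (x - p)] the curve [c(t) = g(t)^T s(t)]
   is horizontal when [g' = Y g] and [Y] is the element of the Lie algebra whose field
   at [s(t)] is the vertical part of [x - p]; its radial projection to the sphere is
   no longer than the arc from [p] to [x]. It ends at
   [g(1)^T x], so reaching a prescribed [q] is the fixed point equation [x = g(1) q],
   solved by Brouwer's theorem. The field [Y] is singular where the orbit dimension
   drops, that is at the zeros of a Gram determinant, which is polynomial in [t]. So
   the equation is solved for regularised, discretised transports, and an
   ultrafilter limit is taken: the limit curve is Lipschitz, and differentiable and
   horizontal off finitely many times. A reparametrisation stopping at these times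
   makes it piecewise C1. If [x <> - p] the length is less than [pi]; the remaining
   endpoints are handled by first moving [p] slightly towards the farthest point of a
   suitable orbit, along a segment which is horizontal by maximality. *)
Require Import Defs.
From HB Require Import structures.
From mathcomp Require Import all_boot all_order all_algebra zify.
Set Implicit Arguments. Unset Strict Implicit. Unset Printing Implicit Defensive.

(** * Kuhn's combinatorial lemma *)

(** Prescribing the end [q] is a fixed point problem because [g(1)] depends on the whole chord,
    hence on [x]. As [g(1)] lies in [G], the solution [x] lies on the orbit of [q], so the chord can
    pass through the origin only if that orbit contains [- p]. Two obstacles shape the argument.
    Brouwer's theorem needs continuity in [x], which the exact field lacks at degenerate points; and
    no bound on the coefficients of the regularised field is available as the regularisation tends
    to zero. What survives is a bound on the velocity of the curve: subtracting any fraction between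
    0 and 1 of the vertical projection shortens the chord velocity, whatever the Gram determinant.
    Hence the limit curve crosses degenerate times as a Lipschitz curve. The transports are finite
    Euler products, so that no differential equation has to be solved; they are neither orthogonal
    nor in [G], and both properties return in the limit, by closedness of [G]. The value pi bounds
    the angle that a chord subtends at the origin, as a difference of two values of [atan]. *)

Lemma even_card_involution (T : finType) (A : {set T}) (f : T -> T) :
  (forall x, x \in A -> [/\ f x \in A, f (f x) = x & f x != x]) -> ~~ odd #|A|.
Proof.
have [n] := ubnP #|A|; elim: n A => // n IHn A /ltnSE-leAn fA.
have [->|[x xA]] := set_0Vmem A; first by rewrite cards0.
have [fxA ffx fxx] := fA _ xA.
have xD : x \in A :\ f x by rewrite !inE eq_sym fxx.
rewrite (cardsD1 (f x)) fxA (cardsD1 x) xD /= negbK.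
apply: IHn => [|y].
  by move: leAn; rewrite (cardsD1 (f x)) fxA (cardsD1 x) xD; lia.
rewrite !inE => /and3P[yx yfx yA]; have [fyA ffy fyy] := fA _ yA.
split=> //; rewrite fyA andbT; apply/andP; split.
  by apply: contra yfx => /eqP <-; rewrite ffy.
by apply: contra yx => /eqP e; rewrite -ffy e ffx.
Qed.

(** If deleting entry [i] leaves the labels 0 to [k], and [a] is the deleted label, then the rainbow
    facets are exactly those that delete an entry equal to [a]. That label occurs once when
    [a = k.+1] and twice otherwise. *)
Lemma odd_rainbow_facets (k : nat) (s : seq nat) :
  size s = k.+2 -> all (fun a => a <= k.+1) s ->
  odd #|[set i : 'I_k.+2 |
    perm_eq [seq nth 0 s (bump i j) | j <- iota 0 k.+1] (iota 0 k.+1)]|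
  = perm_eq s (iota 0 k.+2).
Proof.
move=> ss sle.
have iS : iota 0 k.+2 = rcons (iota 0 k.+1) k.+1.
  by rewrite -[k.+2]addn1 iotaD cats1 add0n.
have facet (i : 'I_k.+2) :
    perm_eq s (nth 0 s i :: [seq nth 0 s (bump i j) | j <- iota 0 k.+1]).
  rewrite -{1}(mkseq_nth 0 s) /mkseq ss.
  have -> : map (fun j => nth 0 s (bump i j)) (iota 0 k.+1) =
            map (nth 0 s) (map (bump i) (iota 0 k.+1)) by rewrite -map_comp.
  rewrite -map_cons; apply: perm_map; apply: uniq_perm.
  - exact: iota_uniq.
  - rewrite cons_uniq map_inj_uniq ?iota_uniq ?andbT; last exact: can_inj (bumpK i).
    by apply/negP => /mapP[j _]; rewrite /bump; case: leqP; lia.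
  move=> j; rewrite mem_iota in_cons add0n leq0n andTb; apply/idP/orP => [jk|[/eqP->|/mapP[a]]].
  - case: (eqVneq j i) => [|ji]; [by left|right].
    apply/mapP; exists (unbump i j); last by rewrite unbumpK // inE.
    by rewrite mem_iota /unbump; have := ltn_ord i; case: ltnP; lia.
  - by have := ltn_ord i; lia.
  - by rewrite mem_iota => ak ->; rewrite /bump; case: leqP; lia.
set P := [set i | _].
have [P0|[i iP]] := set_0Vmem P.
  (* A permutation of 0 to [k.+1] always has a rainbow facet, the one deleting the label [k.+1]. *)
  rewrite P0 cards0 [odd 0]/=; apply/esym/negbTE/negP => ps.
  have : k.+1 \in s by rewrite (perm_mem ps) mem_iota add0n ltnSn.
  move=> /(nthP 0)[i]; rewrite ss => ik si.
  have : Ordinal ik \in P.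
    rewrite inE /= -(perm_cons k.+1) -{1}si.
    rewrite perm_sym; apply: perm_trans (facet (Ordinal ik)).
    rewrite perm_sym; apply: perm_trans ps _.
    by rewrite iS perm_rcons.
  by rewrite P0 inE.
pose a := nth 0 s i.
have psa : perm_eq s (a :: iota 0 k.+1).
  apply: perm_trans (facet i) _; rewrite perm_cons.
  by move: iP; rewrite inE.
have PE : P = [set j : 'I_k.+2 | nth 0 s j == a].
  apply/setP => j; rewrite !inE; apply/idP/eqP => [pj|sj].
    have pj' : perm_eq s (nth 0 s j :: iota 0 k.+1).
      by apply: perm_trans (facet j) _; rewrite perm_cons.
    have := permP psa (pred1 a); rewrite (permP pj' (pred1 a)) /= eqxx.
    by case: eqP => // _; lia.
  rewrite -(perm_cons a) -{1}sj; rewrite perm_sym; apply: perm_trans (facet j).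
  by rewrite perm_sym.
have -> : #|P| = count_mem a s.
  rewrite PE.
  have {2}-> : s = map (nth 0 s) (map val (enum 'I_k.+2)).
    by rewrite val_enum_ord -ss -[RHS]/(mkseq (nth 0 s) (size s)) mkseq_nth.
  rewrite -map_comp count_map -sum1_count big_enum_cond -sum1_card.
  by apply: eq_bigl => j; rewrite inE.
rewrite (permP psa (pred1 a)) -[a :: iota _ _]cat1s count_cat /= eqxx addn0 add1n -[(0 == a) + _]/(count_mem a (iota 0 k.+1)).
rewrite -[_ :: _]/(iota 0 k.+2).
rewrite count_uniq_mem ?iota_uniq // mem_iota add0n leq0n andTb.
have ale : a <= k.+1 by move/allP: sle; apply; apply: mem_nth; rewrite ss.
apply/idP/idP => [|ps].
  case: ltnP => // ka _; rewrite iS perm_sym perm_rcons; have {1}-> : k.+1 = a by lia.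
  by rewrite perm_sym.
have : count_mem a (a :: iota 0 k.+1) = 1.
  by rewrite -(permP psa) (permP ps) count_uniq_mem ?iota_uniq // mem_iota; lia.
rewrite -[a :: iota _ _]cat1s count_cat /= eqxx addn0 add1n -[(0 == a) + _]/(count_mem a (iota 0 k.+1)).
by rewrite count_uniq_mem ?iota_uniq // mem_iota add0n leq0n andTb; case: ltnP.
Qed.

Definition swap_pred (i r : nat) : nat :=
  if r == i.-1 then i else if r == i then i.-1 else r.

Lemma swap_predK i : 0 < i -> involutive (swap_pred i).
Proof.
move=> i0 r; rewrite /swap_pred.
have [->|r1] := eqVneq r i.-1; first by rewrite eqxx; case: ifP => // /eqP; lia.
by have [->|r2] := eqVneq r i; rewrite ?eqxx // (negbTE r1) (negbTE r2).
Qed.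

(** The ranks [i.-1] and [i] are separated only by the threshold [i], a value that [bump i] never
    takes; hence exchanging the two directions moves only the vertex of index [i]. *)
Lemma ltn_swap_pred_bump i r j : 0 < i ->
  (swap_pred i r < bump i j) = (r < bump i j).
Proof.
by move=> i0; rewrite /swap_pred /bump; case: (leqP i j) => ij; do ?[case: ifP => ?]; lia.
Qed.

Lemma swap_pred_leq i r n : i < n -> (swap_pred i r < n) = (r < n).
Proof. by move=> ii; rewrite /swap_pred; do ?[case: ifP => ?]; lia. Qed.

Section Kuhn.
Variables (N m : nat) (lab : {ffun 'I_N -> nat} -> nat).
Let S := ({ffun 'I_N -> 'I_m.+1} * {ffun 'I_N -> 'I_N.+1})%type.

(* A simplex [(x, r)] of Kuhn's triangulation of the grid [[0, m]^N] has as [j]-th vertex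
   [x] plus the unit vectors of the coordinates of rank [r] less than [j]. A [k]-simplex
   lies in the face where the coordinates from [k] on equal [m]; there [r] takes the
   dummy value [k]. *)
Definition kuhn_vertex (s : S) (j : nat) : {ffun 'I_N -> nat} :=
  [ffun a => s.1 a + (s.2 a < j)].

Definition kuhn_simplex (k : nat) (s : S) : bool :=
  [forall a : 'I_N, if a < k then (s.1 a < m) && (s.2 a < k)
                    else (s.1 a == m :> nat) && (s.2 a == k :> nat)] &&
  [forall a : 'I_N, forall b : 'I_N,
     (a < k) ==> (b < k) ==> (s.2 a == s.2 b) ==> (a == b)].

Definition kuhn_labels (k : nat) (s : S) : seq nat :=
  [seq lab (kuhn_vertex s j) | j <- iota 0 k.+1].

Definition rainbow (k : nat) : {set S} :=
  [set s : S | kuhn_simplex k s & perm_eq (kuhn_labels k s) (iota 0 k.+1)].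

Lemma kuhn_simplexP k (s : S) : reflect
  [/\ forall a : 'I_N, a < k -> s.1 a < m, forall a : 'I_N, a < k -> s.2 a < k,
      forall a : 'I_N, k <= a -> s.1 a = m :> nat,
      forall a : 'I_N, k <= a -> s.2 a = k :> nat &
      forall a b : 'I_N, a < k -> b < k -> s.2 a = s.2 b :> nat -> a = b]
  (kuhn_simplex k s).
Proof.
apply: (iffP andP) => [[/forallP h /forallP i]|[h1 h2 h3 h4 h5]].
  split=> [a ak|a ak|a ak|a ak|a b ak bk ab].
  - by have := h a; rewrite ak => /andP[].
  - by have := h a; rewrite ak => /andP[].
  - by have := h a; rewrite ltnNge ak => /andP[/eqP].
  - by have := h a; rewrite ltnNge ak => /andP[_ /eqP].
  - by have /forallP/(_ b) := i a; rewrite ak bk (val_inj ab) eqxx => /eqP.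
split; apply/forallP => a.
  by case: ltnP => ak; rewrite ?h1 ?h2 ?h3 ?h4 ?eqxx.
apply/forallP => b; apply/implyP => ak; apply/implyP => bk; apply/implyP => /eqP.
by move=> ab; apply/eqP; apply: h5; rewrite ?ab.
Qed.

(** Sperner-type boundary conditions for a cube. By [labm] the face of dimension [k] carries only
    the labels 0 to [k], which makes an induction on [k] possible. *)
Hypothesis labN : forall y, lab y <= N.
Hypothesis lab0 : forall (y : {ffun 'I_N -> nat}) (i : 'I_N), y i = 0 -> lab y <> i.
Hypothesis labm : forall (y : {ffun 'I_N -> nat}) (i : 'I_N), y i = m -> lab y <= i.

Lemma kuhn_vertex_label k (s : S) j : k <= N -> kuhn_simplex k s -> j <= k ->
  lab (kuhn_vertex s j) <= k.
Proof.
rewrite leq_eqVlt => /orP[/eqP->|kN] /kuhn_simplexP[_ _ h3 h4 _] jk.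
  exact: labN.
apply: (labm (i := Ordinal kN)); rewrite ffunE h3 // h4 //=.
by rewrite ltnNge jk addn0.
Qed.

(** The only 0-simplex is the corner with all coordinates [m], where the label is forced to be 0. *)
Lemma card_rainbow0 : odd #|rainbow 0|.
Proof.
suff -> : rainbow 0 = [set ([ffun=> ord_max], [ffun=> ord0])] by rewrite cards1.
apply/setP => s; rewrite !inE; apply/andP/eqP => [[/kuhn_simplexP[_ _ h3 h4 _] _]|->].
  case: s h3 h4 => x r /= h3 h4; congr pair; apply/ffunP => a; apply/val_inj;
  by rewrite ffunE /= ?h3 ?h4.
have v : kuhn_simplex 0 ([ffun=> ord_max], [ffun=> ord0]).
  by apply/kuhn_simplexP; split=> //= a; rewrite ffunE.
split=> //; rewrite /kuhn_labels /=.
by have := kuhn_vertex_label (leq0n N) v (leqnn 0); rewrite leqn0 => /eqP ->.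
Qed.

(* Double counting of the pairs (k+1-simplex, facet with labels [0] to [k]): each such facet
   is shared by two simplices, except for those in the face of dimension [k]. *)
Definition facet_rainbow k (s : S) (i : nat) : bool :=
  perm_eq [seq lab (kuhn_vertex s (bump i j)) | j <- iota 0 k.+1] (iota 0 k.+1).

Definition rainbow_flags k : {set S * 'I_k.+2} :=
  [set z : S * 'I_k.+2 | kuhn_simplex k.+1 z.1 & facet_rainbow k z.1 z.2].

(** Both sides are sums over simplices modulo 2; the flags over one simplex are counted by
    [odd_rainbow_facets]. *)
Lemma odd_rainbow_flags k : k < N -> odd #|rainbow_flags k| = odd #|rainbow k.+1|.
Proof.
move=> kN; rewrite -!sum1_card !(big_morph odd oddD (erefl : odd 0 = false)).
rewrite big_mkcond [RHS]big_mkcond /=.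
pose F (s : S) (i : 'I_k.+2) := if (s, i) \in rainbow_flags k then true else false.
transitivity (\big[addb/false]_(p : S * 'I_k.+2) F p.1 p.2).
  by apply: eq_bigr => -[].
rewrite -(pair_bigA _ F) /=.
apply: eq_bigr => s _; rewrite inE.
have [v|nv] := boolP (kuhn_simplex k.+1 s); last first.
  by rewrite big1 // => i _; rewrite /F inE /= (negbTE nv).
have sz : size (kuhn_labels k.+1 s) = k.+2 by rewrite size_map size_iota.
have le : all (fun a => a <= k.+1) (kuhn_labels k.+1 s).
  apply/allP => a /mapP[j]; rewrite mem_iota add0n leq0n andTb => jk ->.
  by apply: kuhn_vertex_label => //; lia.
have := odd_rainbow_facets sz le.
rewrite -sum1_card (big_morph odd oddD (erefl : odd 0 = false)) big_mkcond /= => e.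
transitivity (perm_eq (kuhn_labels k.+1 s) (iota 0 k.+2)); last by case: perm_eq.
rewrite -e; apply: eq_bigr => i _; rewrite /F !inE /= v andTb; congr (if _ then _ else _).
congr perm_eq; apply/eq_in_map => j; rewrite mem_iota add0n leq0n andTb => jk.
rewrite (nth_map 0) ?nth_iota ?size_iota //; have := ltn_ord i;
by rewrite /bump; case: leqP; lia.
Qed.

(** Once vertex 0 is dropped, the coordinate of rank 0 has been increased in all remaining vertices.
    With base value [m.-1] it is constantly [m] there, so the facet lies on the boundary of the cube
    and has no neighbour beyond it. *)
Definition boundary_flags k : {set S * 'I_k.+2} :=
  [set z in rainbow_flags k | (z.2 == ord0) &&
     [exists a : 'I_N, (z.1.2 a == 0 :> nat) && (z.1.1 a == m.-1 :> nat)]].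

(** The base moves to vertex 1, and the direction that was used first is used last; [flip_down] is
    the inverse move. Coordinates beyond [k] keep their dummy rank. *)
Definition flip_up k (s : S) : S :=
  ([ffun a => inord (s.1 a + (s.2 a == 0 :> nat))],
   [ffun a : 'I_N => inord (if k < a then s.2 a : nat
      else if s.2 a == 0 :> nat then k else (s.2 a).-1)]).

Definition flip_down k (s : S) : S :=
  ([ffun a => inord (s.1 a - (s.2 a == k :> nat))],
   [ffun a : 'I_N => inord (if k < a then s.2 a : nat
      else if s.2 a == k :> nat then 0 else (s.2 a).+1)]).

Definition flip_swap (i : nat) (s : S) : S :=
  (s.1, [ffun a => inord (swap_pred i (s.2 a))]).

(* Replaces a simplex by its neighbour across the facet opposite to the given vertex. *)
Definition flag_flip k (z : S * 'I_k.+2) : S * 'I_k.+2 :=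
  if z.2 == ord0 then (flip_up k z.1, ord_max)
  else if z.2 == ord_max then (flip_down k z.1, ord0)
  else (flip_swap z.2 z.1, z.2).

(** Otherwise coordinate [a] would vanish at all vertices of the facet, and by [lab0] the label [a],
    which is at most [k], would be missing. This keeps the truncated subtraction of [flip_down]
    exact. *)
Lemma rainbow_flag_top k (s : S) : k < N -> (s, ord_max) \in rainbow_flags k ->
  forall a : 'I_N, s.2 a = k :> nat -> 0 < s.1 a.
Proof.
move=> kN; rewrite inE /= => /andP[/kuhn_simplexP[h1 h2 h3 h4 h5] fs] a ak.
have aK : a < k.+1 by case: ltnP => // /h4; rewrite ak; lia.
rewrite lt0n; apply/eqP => xa0.
have : (a : nat) \in iota 0 k.+1 by rewrite mem_iota add0n.
rewrite -(perm_mem fs) => /mapP[j]; rewrite mem_iota add0n leq0n andTb => jk.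
move/esym; apply: lab0; rewrite ffunE xa0 ak.
have -> : bump k.+1 j = j by rewrite /bump; case: leqP; lia.
by rewrite ltnNge -ltnS jk.
Qed.

Lemma kuhn_rank_onto k (s : S) j : k < N -> kuhn_simplex k.+1 s -> j <= k ->
  exists2 a : 'I_N, a < k.+1 & s.2 a = j :> nat.
Proof.
move=> kN /kuhn_simplexP[_ h2 _ _ h5] jk.
pose f (a : 'I_k.+1) : 'I_k.+1 := inord (s.2 (widen_ord kN a)).
have fE a : f a = s.2 (widen_ord kN a) :> nat.
  by rewrite inordK // h2 //=; case: a.
have fI : injective f.
  move=> a b /(congr1 val); rewrite /= !fE => ab.
  by have /(congr1 val) /= := h5 (widen_ord kN a) (widen_ord kN b) (ltn_ord a) (ltn_ord b) ab; exact: val_inj.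
have /codomP[a ja] : (inord j : 'I_k.+1) \in codom f by apply: inj_card_onto.
exists (widen_ord kN a); first by case: a {ja}.
by rewrite -fE -ja inordK.
Qed.

Lemma flag_flipP k (s : S) (i : 'I_k.+2) : k < N ->
  (s, i) \in rainbow_flags k :\: boundary_flags k ->
  [/\ flag_flip (s, i) \in rainbow_flags k :\: boundary_flags k,
      flag_flip (flag_flip (s, i)) = (s, i) & flag_flip (s, i) != (s, i)].
Proof.
move=> kN; rewrite in_setD => /andP[nb zr].
have := zr; rewrite inE /= => /andP[v fs].
have [h1 h2 h3 h4 h5] := kuhn_simplexP _ _ v.
have rN (a : 'I_N) : s.2 a <= k.+1.
  by case: (ltnP a k.+1) => ak; [rewrite ltnW ?h2|rewrite h4].
have xm (a : 'I_N) : s.1 a <= m by rewrite -ltnS.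
have rk (a : 'I_N) : (s.2 a < k.+1) = (a < k.+1).
  by case: (ltnP a k.+1) => ak; [rewrite h2|rewrite h4 ?ltnn].
have flag s' (i' : 'I_k.+2) : kuhn_simplex k.+1 s' ->
    (forall j, j <= k -> kuhn_vertex s' (bump i' j) = kuhn_vertex s (bump i j)) ->
    (s', i') \in rainbow_flags k.
  move=> v' e; rewrite inE /= v' /=; move: fs; rewrite /facet_rainbow.
  congr (perm_eq _ _); apply/eq_in_map => j.
  by rewrite mem_iota add0n leq0n andTb => jk; rewrite e.
have ord_max0 : (ord_max == ord0 :> 'I_k.+2) = false by [].
have bump0 j : bump 0 j = j.+1 by [].
have bumpK j : j <= k -> bump k.+1 j = j by rewrite /bump; case: leqP; lia.
have [i0|i0] := eqVneq i ord0.
  have x0 (a : 'I_N) : s.2 a = 0 :> nat -> s.1 a < m.-1.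
    move=> ra; have := h1 a; rewrite -rk ra => /(_ isT) => xa.
    rewrite ltn_neqAle; apply/andP; split; last lia.
    apply: contra nb => xa'; rewrite inE zr /= i0 eqxx /=.
    by apply/existsP; exists a; rewrite ra xa' eqxx.
  have x'E a : (flip_up k s).1 a = s.1 a + (s.2 a == 0 :> nat) :> nat.
    rewrite ffunE inordK //; have := xm a.
    by have [/x0|] := eqVneq (s.2 a : nat) 0; lia.
  have r'E (a : 'I_N) : (flip_up k s).2 a = (if k < a then s.2 a : nat
      else if s.2 a == 0 :> nat then k else (s.2 a).-1) :> nat.
    rewrite ffunE inordK //; case: ifP => _; first by [].
    by case: ifP => _; [lia|have := ltn_ord (s.2 a); lia].
  have v' : kuhn_simplex k.+1 (flip_up k s).
    apply/kuhn_simplexP; split=> [a ak|a ak|a ak|a ak|a b ak bk].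
    - by rewrite x'E; have := h1 a ak; have [/x0|] := eqVneq (s.2 a : nat) 0; lia.
    - rewrite r'E; have -> : (k < a) = false by lia.
      by have := h2 a ak; case: ifP; lia.
    - by rewrite x'E h3 // h4 //= addn0.
    - by rewrite r'E ak h4.
    - rewrite !r'E; have -> : (k < a) = false by lia.
      have -> : (k < b) = false by lia.
      move=> e; apply: h5 => //.
      by move: e; have := h2 a ak; have := h2 b bk; do 2 case: ifP; lia.
  have e1 : flag_flip (s, i) = (flip_up k s, ord_max) by rewrite /flag_flip i0 eqxx.
  have e2 : flag_flip (flip_up k s, ord_max : 'I_k.+2) = (flip_down k (flip_up k s), ord0).
    by rewrite /flag_flip ord_max0 eqxx.
  rewrite e1 e2; split.
  - rewrite in_setD; apply/andP; split.
      by rewrite inE [X in _ && (X && _)]ord_max0 !andbF.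
    apply: flag => // j jk; apply/ffunP => a; rewrite [LHS]ffunE [RHS]ffunE x'E r'E i0.
    rewrite [bump (ord_max : 'I_k.+2) j]bumpK // [bump (ord0 : 'I_k.+2) j]bump0.
    have := rk a; have := rN a; case: (ltnP k a) => ak.
      by rewrite h4 //=; lia.
    by case: eqP => [->|]; lia.
  - rewrite i0; congr (_, _).
    rewrite [RHS]surjective_pairing; congr (_, _); apply/ffunP => a; apply/val_inj.
      rewrite ffunE /= inordK x'E r'E; have := rk a; have := xm a; have := x0 a;
      have := h4 a; have := kN; clear; case: (ltnP k a) => ak; have [r0|r0] := eqVneq (s.2 a : nat) 0;
      by do ?[case: ifP => ?]; lia.
    rewrite ffunE /= inordK !r'E; have := rk a; have := ltn_ord (s.2 a);
    have := h4 a; have := kN; clear; case: (ltnP k a) => ak; have [r0|r0] := eqVneq (s.2 a : nat) 0;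
      do ?[case: ifP => ?]; lia.
  - by rewrite i0 xpair_eqE [X in _ && X]ord_max0 andbF.
have [i1|i1] := eqVneq i ord_max.
  have x0 (a : 'I_N) : s.2 a = k :> nat -> 0 < s.1 a.
    by apply: rainbow_flag_top kN _ a; rewrite -i1.
  have x'E a : (flip_down k s).1 a = s.1 a - (s.2 a == k :> nat) :> nat.
    by rewrite ffunE inordK //; have := xm a; lia.
  have r'E (a : 'I_N) : (flip_down k s).2 a = (if k < a then s.2 a : nat
      else if s.2 a == k :> nat then 0 else (s.2 a).+1) :> nat.
    rewrite ffunE inordK //; case: ifP => ak //.
    by have := rk a; case: ifP => //; lia.
  have v' : kuhn_simplex k.+1 (flip_down k s).
    apply/kuhn_simplexP; split=> [a ak|a ak|a ak|a ak|a b ak bk].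
    - by rewrite x'E; have := h1 a ak; lia.
    - rewrite r'E; have -> : (k < a) = false by lia.
      by have := h2 a ak; case: ifP; lia.
    - by rewrite x'E h3 // h4 //; lia.
    - by rewrite r'E ak h4.
    - rewrite !r'E; have -> : (k < a) = false by lia.
      have -> : (k < b) = false by lia.
      move=> e; apply: h5 => //.
      by move: e; have := h2 a ak; have := h2 b bk; do 2 case: ifP; lia.
  have e1 : flag_flip (s, i) = (flip_down k s, ord0).
    by rewrite /flag_flip (negbTE i0) i1 eqxx.
  have e2 : flag_flip (flip_down k s, ord0 : 'I_k.+2) = (flip_up k (flip_down k s), ord_max).
    by rewrite /flag_flip eqxx.
  rewrite e1 e2; split.
  - rewrite in_setD; apply/andP; split.
      (* The direction of rank 0 after the move has just lost one unit, so its base value is smaller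
         than [m.-1]. *)
      rewrite inE eqxx; apply/nandP; right; apply/existsPn => a.
      by rewrite [(_, _).1]/= r'E x'E; have := h1 a; have := h4 a; have := x0 a;
      case: (ltnP k a) => ak; do ?[case: ifP => ?]; lia.
    apply: flag => // j jk; apply/ffunP => a; rewrite [LHS]ffunE [RHS]ffunE x'E r'E i1.
    rewrite [bump (ord_max : 'I_k.+2) j]bumpK // [bump (ord0 : 'I_k.+2) j]bump0.
    have := rk a; have := rN a; have := h4 a; have := x0 a.
    case: (ltnP k a) => ak; have [r0|r0] := eqVneq (s.2 a : nat) k => xa ha; last by lia.
    - by move: (ha isT); lia.
    - by move: (ha isT); lia.
    - by move: (xa r0); lia.
  - rewrite i1; congr (_, _).
    rewrite [RHS]surjective_pairing; congr (_, _); apply/ffunP => a; apply/val_inj.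
      rewrite ffunE /= inordK x'E r'E; have := rk a; have := xm a; have := x0 a;
      have := h4 a; have := kN; clear; case: (ltnP k a) => ak; have [r0|r0] := eqVneq (s.2 a : nat) k;
      by do ?[case: ifP => ?]; lia.
    rewrite ffunE /= inordK !r'E; have := rk a; have := ltn_ord (s.2 a);
    have := h4 a; have := kN; clear; case: (ltnP k a) => ak; have [r0|r0] := eqVneq (s.2 a : nat) k;
      do ?[case: ifP => ?]; move=> /=; lia.
  - by rewrite xpair_eqE [X in _ && X]eq_sym (negbTE i0) andbF.
have i0' : 0 < i by rewrite lt0n; apply: contra i0 => /eqP i0; apply/eqP/val_inj.
have i1' : i <= k.
  rewrite -ltnS ltn_neqAle -ltnS ltn_ord andbT.
  by apply: contra i1 => /eqP i1; apply/eqP/val_inj.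
have iN : i < N.+1 by lia.
have r'E t (a : 'I_N) : (flip_swap i t).2 a = swap_pred i (t.2 a) :> nat.
  by rewrite ffunE inordK // swap_pred_leq.
have v' : kuhn_simplex k.+1 (flip_swap i s).
  apply/kuhn_simplexP; split=> [a ak|a ak|a ak|a ak|a b ak bk].
  - exact: h1.
  - by rewrite r'E swap_pred_leq // h2.
  - exact: h3.
  - rewrite r'E h4 // /swap_pred; move: i1' i0'; clear => ? ?.
    by do ?[case: ifP => ?]; lia.
  - by rewrite !r'E => /(can_inj (swap_predK i0')); apply: h5.
have e1 s' : flag_flip (s', i) = (flip_swap i s', i).
  by rewrite /flag_flip (negbTE i0) (negbTE i1).
rewrite !e1; split.
- rewrite in_setD; apply/andP; split; first by rewrite inE (negbTE i0) andbF.
  apply: flag => // j jk; apply/ffunP => a; rewrite [LHS]ffunE [RHS]ffunE r'E.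
  by rewrite ltn_swap_pred_bump.
- congr (_, _); rewrite [RHS]surjective_pairing; congr (_, _).
  by apply/ffunP => a; apply/val_inj; rewrite [LHS]r'E r'E swap_predK.
(* Some direction has rank [i], and the exchange changes its rank, so the flip has no fixed
   point. *)
- have [a _ ra] := kuhn_rank_onto kN v i1'.
  apply/eqP => e; have : (flip_swap i s).2 a = s.2 a :> nat by rewrite [X in X.2](congr1 fst e : flip_swap i s = s).
  by rewrite r'E ra /swap_pred; move: i0'; clear => ?; do ?[case: ifP => ?]; lia.
Qed.

(** The facet carries the label [k], while by [labm] all its labels are at most the index [a] of the
    coordinate that is constantly [m]. Hence [a = k], and the facet is a rainbow simplex of the face
    of dimension [k]. Conversely, such a simplex is completed by one vertex below it in direction
    [k], which becomes the first direction. *)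
Lemma card_boundary_flags k : 0 < m -> k < N -> #|boundary_flags k| = #|rainbow k|.
Proof.
move=> m_gt0 kN; pose c : 'I_N := Ordinal kN.
pose f (s : S) : S :=
  ([ffun a : 'I_N => if a == k :> nat then inord m.-1 else s.1 a],
   [ffun a : 'I_N => inord (if a == k :> nat then 0
       else if a < k then (s.2 a).+1 else k.+1)]).
have f1 s (a : 'I_N) : (f s).1 a = (if a == k :> nat then m.-1 else s.1 a) :> nat.
  by rewrite ffunE; case: ifP => // _; rewrite inordK //; lia.
have f2 s (a : 'I_N) : kuhn_simplex k s -> (f s).2 a =
    (if a == k :> nat then 0 else if a < k then (s.2 a).+1 else k.+1) :> nat.
  move=> /kuhn_simplexP[_ h2 _ _ _]; rewrite ffunE inordK //.
  by have := h2 a; do ?[case: ifP => ?]; lia.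
pose F (s : S) : S * 'I_k.+2 := (f s, ord0).
have FI : {in rainbow k &, injective F}.
  move=> s t; rewrite !inE => /andP[vs _] /andP[vt _] [] /ffunP e1 /ffunP e2.
  have [_ g2 g3 g4 _] := kuhn_simplexP _ _ vs.
  have [_ h2 h3 h4 _] := kuhn_simplexP _ _ vt.
  rewrite [s]surjective_pairing [t]surjective_pairing; congr (_, _);
  apply/ffunP => a; apply/val_inj => /=.
    have /(congr1 val) := e1 a; rewrite /= -[LHS]/(nat_of_ord ((f s).1 a)).
    rewrite -[X in _ = X -> _]/(nat_of_ord ((f t).1 a)) !f1.
    by case: eqP => // ak _; rewrite g3 ?h3 ?ak.
  have /(congr1 val) := e2 a; rewrite /= -[LHS]/(nat_of_ord ((f s).2 a)).
  rewrite -[X in _ = X -> _]/(nat_of_ord ((f t).2 a)) !f2 //.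
  case: eqP => [ak _|_]; first by rewrite g4 ?h4 ?ak.
  by case: (ltnP a k) => ak; [case|rewrite g4 ?h4].
have fv s j : kuhn_simplex k s -> j <= k ->
    kuhn_vertex (f s) (bump 0 j) = kuhn_vertex s j.
  move=> vs jk; have [_ _ g3 g4 _] := kuhn_simplexP _ _ vs.
  apply/ffunP => a; rewrite [LHS]ffunE [RHS]ffunE f1 f2 // /bump leq0n add1n.
  have [ak|ak] := eqVneq (a : nat) k.
    by rewrite g3 ?g4 ?ak //; move: m_gt0 jk; clear; lia.
  case: (ltnP a k) => ak'; first by rewrite ltnS.
  by rewrite g4 //; move: jk; clear; lia.
rewrite -(card_in_imset FI); apply: eq_card => z.
apply/idP/imsetP => [|[s]].
  case: z => s0 i; have [s <-] : exists s : S, s = s0 by exists s0.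
  rewrite inE => /and3P[zr /eqP /= i0 /existsP[a /andP[/eqP ra /eqP xa]]].
  rewrite {}i0 in zr *.
  have := zr; rewrite inE /= => /andP[v fs].
  have [h1 h2 h3 h4 h5] := kuhn_simplexP _ _ v.
  have ac : a = c.
    have aK : a < k.+1 by case: ltnP => // /h4; rewrite ra.
    apply/val_inj/eqP; rewrite eqn_leq -ltnS aK /=.
    have : k \in iota 0 k.+1 by rewrite mem_iota add0n leq0n andTb.
    rewrite -(perm_mem fs) => /mapP[j _ ->]; apply: labm.
    by rewrite ffunE ra xa -[bump _ j]/(j.+1) addn1 prednK.
  rewrite {}ac in ra xa.
  pose t : S := ([ffun a : 'I_N => if a == k :> nat then ord_max else s.1 a],
    [ffun a : 'I_N => inord (if a < k then (s.2 a).-1 else k)]).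
  have t1 (b : 'I_N) : t.1 b = (if b == k :> nat then m else s.1 b) :> nat.
    by rewrite ffunE; case: ifP.
  have t2 (b : 'I_N) : t.2 b = (if b < k then (s.2 b).-1 else k) :> nat.
    rewrite ffunE inordK //; case: ifP => _; last by lia.
    by have := ltn_ord (s.2 b); clear; lia.
  have s2 (b : 'I_N) : b < k -> 0 < s.2 b.
    move=> bk; rewrite lt0n; apply/eqP => sb.
    have /(congr1 val)/= : b = c by apply: h5; rewrite ?ra //= ltnS ltnW.
    by move: bk; clear; lia.
  have vt : kuhn_simplex k t.
    apply/kuhn_simplexP; split=> [b bk|b bk|b bk|b bk|b d bk dk].
    - by rewrite t1 ltn_eqF // h1 // ltnW.
    - by rewrite t2 bk; have := s2 b bk; have := h2 b (ltnW bk); clear; lia.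
    - by rewrite t1; case: eqP => // bk'; apply: h3; move: bk bk'; clear; lia.
    - by rewrite t2 ltnNge bk.
    - rewrite !t2 bk dk => e; apply: h5; rewrite ?ltnS ?(ltnW bk) ?(ltnW dk) //.
      by have := s2 b bk; have := s2 d dk; move: e; clear; lia.
  have ft : f t = s.
    rewrite [LHS]surjective_pairing [RHS]surjective_pairing.
    congr (_, _); apply/ffunP => b; apply/val_inj.
      rewrite -[LHS]/(nat_of_ord ((f t).1 b)) f1 t1; case: eqP => // bk.
      by rewrite -xa; congr (nat_of_ord (s.1 _)); apply/val_inj.
    rewrite -[LHS]/(nat_of_ord ((f t).2 b)) f2 // t2; case: eqP => [bk|bk].
      by rewrite -ra; congr (nat_of_ord (s.2 _)); apply/val_inj.
    case: (ltnP b k) => bk'; first by rewrite prednK // s2.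
    by rewrite /= h4 //; move: bk bk'; clear; lia.
  exists t; last by rewrite /F ft.
  rewrite inE vt /=; move: fs; rewrite -ft /facet_rainbow /kuhn_labels.
  congr (perm_eq _ _); apply/eq_in_map => j.
  by rewrite mem_iota add0n leq0n andTb => jk; rewrite fv.
rewrite inE => /andP[vs rs] ->.
have [g1 g2 g3 g4 g5] := kuhn_simplexP _ _ vs.
rewrite inE; apply/andP; split; last first.
  by rewrite eqxx; apply/existsP; exists c; rewrite -[(F s).1]/(f s) f1 f2 //= !eqxx.
rewrite inE; apply/andP; split; last first.
  move: rs; rewrite /facet_rainbow /kuhn_labels.
  congr (perm_eq _ _); apply/eq_in_map => j.
  by rewrite mem_iota add0n leq0n andTb => jk; rewrite fv.
apply/kuhn_simplexP; split=> [b bk|b bk|b bk|b bk|b d bk dk].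
- rewrite f1; case: eqP => bk'; first by have := m_gt0; clear; lia.
  by apply: g1; move: bk bk'; clear; lia.
- rewrite f2 //; case: eqP => // bk'; have bk2 : b < k by move: bk bk'; clear; lia.
  by rewrite bk2 ltnS g2.
- by rewrite f1 gtn_eqF // g3 // ltnW.
- by rewrite f2 // gtn_eqF // ltnNge ltnW.
- rewrite !f2 //; have bk1 : b <= k by []; have dk1 : d <= k by [].
  case: (eqVneq (b : nat) k) => bk2; case: (eqVneq (d : nat) k) => dk2.
  + by move=> _; apply/val_inj; rewrite /= bk2.
  + by rewrite ltn_neqAle dk2 dk1.
  + by rewrite ltn_neqAle bk2 bk1.
  + rewrite !ltn_neqAle dk2 dk1 bk2 bk1 /= => -[].
    by apply: g5; rewrite ltn_neqAle ?dk2 ?bk2.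
Qed.

(** Flags off the boundary cancel in pairs, so the parity passes from dimension [k] to [k.+1]. *)
Lemma odd_card_rainbow k : 0 < m -> k <= N -> odd #|rainbow k|.
Proof.
move=> m_gt0; elim: k => [|k IH] kN; first exact: card_rainbow0.
rewrite -odd_rainbow_flags // -(cardsID (boundary_flags k)).
have sub : boundary_flags k \subset rainbow_flags k.
  by apply/subsetP => z; rewrite inE => /andP[].
rewrite (setIidPr sub) oddD card_boundary_flags // IH ?(ltnW kN) //.
rewrite (negbTE (even_card_involution (f := @flag_flip k) _)) // => -[s i] zA.
exact: flag_flipP.
Qed.

Lemma kuhn_lemma : 0 < m -> exists x : {ffun 'I_N -> nat},
  (forall a, x a < m) /\
  forall l, l <= N -> exists y : {ffun 'I_N -> nat},
    (forall a, x a <= y a <= (x a).+1) /\ lab y = l.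
Proof.
move=> m_gt0; have := odd_card_rainbow m_gt0 (leqnn N).
have [->|[s]] := set_0Vmem (rainbow N); first by rewrite cards0.
rewrite inE => /andP[/kuhn_simplexP[h1 _ _ _ _] rs] _.
exists [ffun a => s.1 a : nat]; split=> [a|l lN]; first by rewrite ffunE h1.
have : l \in iota 0 N.+1 by rewrite mem_iota add0n leq0n andTb ltnS.
rewrite -(perm_mem rs) => /mapP[j _ ->]; exists (kuhn_vertex s j); split=> // a.
by rewrite !ffunE; case: (_ < j); rewrite ?addn1 ?addn0 leqnn ?leqnSn.
Qed.

End Kuhn.

From mathcomp Require Import all_classical all_reals all_analysis.
From mathcomp Require Import ring lra.
Import Order.TTheory GRing.Theory Num.Theory.
Import numFieldNormedType.Exports.
Local Open Scope classical_set_scope.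
Local Open Scope ring_scope.

(** * Limits of matrices along filters *)

Section MatrixLimits.
Context {R : realType} {T : Type} {F : set_system T} {FF : Filter F}.

Lemma cvg_mx m n (f : T -> 'M[R]_(m, n)) (l : 'M[R]_(m, n)) :
  (forall i j, f x i j @[x --> F] --> l i j) -> f @ F --> l.
Proof.
move=> fl; apply/cvg_ballP => e e0.
suff : \forall x \near F, forall i j, ball (l i j) e (f x i j).
  by apply: filterS => x h; split.
apply: filter_forall => i; apply: filter_forall => j.
by move/cvg_ballP: (fl i j) => /(_ e e0).
Qed.

Lemma cvg_entry m n (f : T -> 'M[R]_(m, n)) (l : 'M[R]_(m, n)) i j :
  f @ F --> l -> f x i j @[x --> F] --> l i j.
Proof. by move=> fl; apply: cvg_comp fl (@coord_continuous R m n i j l). Qed.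

Lemma cvg_sumr (I : Type) (r : seq I) (f : I -> T -> R) (l : I -> R) :
  (forall i, f i @ F --> l i) -> \sum_(i <- r) f i x @[x --> F] --> \sum_(i <- r) l i.
Proof.
move=> fl; elim: r => [|i r IH].
  by rewrite big_nil; under eq_fun do rewrite big_nil; exact: cvg_cst.
by rewrite big_cons; under eq_fun do rewrite big_cons; exact: cvgD.
Qed.

Lemma cvg_prodr (I : Type) (r : seq I) (f : I -> T -> R) (l : I -> R) :
  (forall i, f i @ F --> l i) -> \prod_(i <- r) f i x @[x --> F] --> \prod_(i <- r) l i.
Proof.
move=> fl; elim: r => [|i r IH].
  by rewrite big_nil; under eq_fun do rewrite big_nil; exact: cvg_cst.
by rewrite big_cons; under eq_fun do rewrite big_cons; exact: cvgM.
Qed.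

Lemma cvg_mulmx m n p (f : T -> 'M[R]_(m, n)) (g : T -> 'M[R]_(n, p))
    (a : 'M[R]_(m, n)) (b : 'M[R]_(n, p)) :
  f @ F --> a -> g @ F --> b -> f x *m g x @[x --> F] --> a *m b.
Proof.
move=> fa gb; apply: cvg_mx => i j; rewrite mxE.
under eq_fun do rewrite mxE.
by apply: cvg_sumr => k; apply: cvgM; apply: cvg_entry.
Qed.

Lemma cvg_trmx m n (f : T -> 'M[R]_(m, n)) (a : 'M[R]_(m, n)) :
  f @ F --> a -> (f x)^T @[x --> F] --> a^T.
Proof.
move=> fa; apply: cvg_mx => i j; rewrite mxE.
by under eq_fun do rewrite mxE; apply: cvg_entry.
Qed.

Lemma cvg_det n (f : T -> 'M[R]_n) (a : 'M[R]_n) :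
  f @ F --> a -> \det (f x) @[x --> F] --> \det a.
Proof.
move=> fa; apply: cvg_sumr => s; apply: cvgM; first exact: cvg_cst.
by apply: cvg_prodr => i; apply: cvg_entry.
Qed.

Lemma cvg_adj n (f : T -> 'M[R]_n) (a : 'M[R]_n) :
  f @ F --> a -> \adj (f x) @[x --> F] --> \adj a.
Proof.
move=> fa; apply: cvg_mx => i j; rewrite mxE; under eq_fun do rewrite mxE.
apply: cvgM; first exact: cvg_cst.
apply: cvg_det; apply: cvg_mx => k l; rewrite !mxE.
by under eq_fun do rewrite !mxE; apply: cvg_entry.
Qed.

End MatrixLimits.

Lemma norm_entry_le_mx_norm {R : realType} m n (A : 'M[R]_(m, n)) i j : `|A i j| <= `|A|.
Proof.
rewrite [leRHS]/Num.Def.normr /= mx_normrE.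
by apply/bigmax_geP; right; exists (i, j).
Qed.

Section Ultralimits.
Context {R : realType}.

Lemma ultra_fmap (S T : Type) (f : S -> T) (U : set_system S) :
  UltraFilter U -> UltraFilter (f @ U).
Proof.
move=> UU; split; first exact: fmap_proper_filter.
move=> G GP sub; apply/seteqP; split=> [A GA|A GA]; last exact: sub.
 have [//|UC] := in_ultra_setVsetC (f @^-1` A) UU.
have /sub GC : (f @ U) (~` A) := UC.
by have /filter_ex[x []] : G (A `&` ~` A) by exact: filterI.
Qed.

Lemma ultra_bounded_cvg (U : set_system nat) m n (u : nat -> 'M[R]_(m, n)) (C : R) :
  UltraFilter U -> (\forall k \near U, forall i j, `|u k i j| <= C) ->
  exists l : 'M[R]_(m, n), u @ U --> l.
Proof.
move=> UU uC.
have ex i j : exists x : R, u k i j @[k --> U] --> x.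
  have := @segment_compact R (- C) C; rewrite compact_ultra.
  move=> /(_ _ (ultra_fmap (fun k => u k i j) UU)).
  case=> [|x [_ h]]; last by exists x.
  by near=> k; rewrite /= in_itv /= -ler_norml; near: k; apply: filterS uC => k; exact.
exists (\matrix_(i, j) projT1 (cid (ex i j))); apply: cvg_mx => i j.
by rewrite mxE; case: cid.
Unshelve. all: by end_near. Qed.

(** One free ultrafilter gives every bounded sequence a limit. This replaces the extraction of
    subsequences, and the uncountably many times of a curve are treated at once. *)
Lemma free_ultrafilter : exists U : set_system nat, UltraFilter U /\ U --> \oo.
Proof. by have [U [UU sub]] := ultraFilterLemma eventually_filter; exists U. Qed.

End Ultralimits.

Lemma cvg_limit_unique {R : realType} {V : normedModType R} {T : Type} {F : set_system T}
    {PF : ProperFilter F} (f : T -> V) (a b : V) : f @ F --> a -> f @ F --> b -> a = b.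
Proof. by move=> fa fb; apply: (@cvg_unique _ (@norm_hausdorff _ _) (f @ F)). Qed.

(** * Brouwer's fixed point theorem *)

Section Brouwer.
Context {R : realType}.

Definition grid_point (N m : nat) (x : {ffun 'I_N -> nat}) : 'cV[R]_N :=
  \col_i (2 * (x i)%:R / m%:R - 1).

Lemma grid_almost_fixed (N m : nat) (f : 'cV[R]_N -> 'cV[R]_N) : (0 < m)%N ->
  (forall x i, `|f x i 0| <= 1) ->
  exists z : 'cV[R]_N, (forall i, `|z i 0| <= 1) /\ forall i, exists y y' : 'cV[R]_N,
    [/\ forall j, `|y j 0 - z j 0| <= 2 / m%:R, forall j, `|y' j 0 - z j 0| <= 2 / m%:R,
      f y i 0 <= y i 0 & y' i 0 <= f y' i 0].
Proof.
move=> m0 f1; pose pt := @grid_point N m.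
have m0' : 0 < m%:R :> R by rewrite ltr0n.
(* The label of a point is the first coordinate that is maximal or that [f] decreases, and [N], the
   default value of [find], if there is none. At a maximal coordinate [f] cannot exceed the value 1
   of the point. *)
pose bl (x : {ffun 'I_N -> nat}) i := (x i == m) || (f (pt x) i 0 < pt x i 0).
pose lab (x : {ffun 'I_N -> nat}) := find (bl x) (enum 'I_N).
have nthE (i : 'I_N) : nth i (enum 'I_N) i = i by rewrite nth_ord_enum.
have hasl x (i : 'I_N) : lab x = i -> bl x i.
  move=> li; have h : has (bl x) (enum 'I_N).
    by rewrite has_find size_enum_ord -/(lab x) li.
  by have := nth_find i h; rewrite -/(lab x) li nthE.
have := @kuhn_lemma N m lab _ _ _ m0; case.
- by move=> x; rewrite -[leqRHS](size_enum_ord N) find_size.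
- move=> x i xi /hasl; rewrite /bl xi eq_sym (gtn_eqF m0) /= mxE xi mulr0 mul0r sub0r.
  by apply/negP; rewrite -leNgt; have := f1 (pt x) i; rewrite ler_norml => /andP[].
- move=> x i xi; rewrite leqNgt; apply/negP => /(before_find i).
  by rewrite nthE /bl xi eqxx.
move=> x [xm xl]; exists (pt x); split=> [i|i].
  rewrite mxE ler_norml; have : (x i)%:R <= m%:R :> R by rewrite ler_nat ltnW.
  have : 0 <= (x i)%:R :> R by [].
  move=> h1 h2; have h3 : 0 <= ((x i)%:R / m%:R : R) <= 1.
    by rewrite divr_ge0 ?ler0n //= ler_pdivrMr // mul1r.
  by rewrite -mulrA; move: h3; set u := _ / _; lra.
have near_pt (y : {ffun 'I_N -> nat}) j : (forall a, x a <= y a <= (x a).+1)%N ->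
    `|pt y j 0 - pt x j 0| <= 2 / m%:R.
  move=> /(_ j) /andP[xy yx]; rewrite !mxE.
  have -> : 2 * (y j)%:R / m%:R - 1 - (2 * (x j)%:R / m%:R - 1) =
            2 / m%:R * ((y j)%:R - (x j)%:R) :> R by ring.
  have d0 : 0 <= 2 / m%:R :> R by rewrite divr_ge0.
  rewrite normrM ger0_norm // ler_piMr // -natrB // ger0_norm // (ler_nat _ _ 1).
  by rewrite leq_subLR addn1.
(* The vertex of label [i] gives the inequality in one direction for coordinate [i]; the vertex of
   label [N] gives the opposite one for all coordinates. *)
have [y [xy ly]] := xl i (ltnW (ltn_ord i)).
have [y' [xy' ly']] := xl N (leqnn N).
exists (pt y), (pt y'); split=> [j|j||]; try exact: near_pt.
- have := hasl _ _ ly; rewrite /bl => /orP[/eqP yi|/ltW //].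
  have -> : pt y i 0 = 1.
    have mne : m%:R != 0 :> R by rewrite gt_eqF.
    by rewrite mxE yi mulfK //; ring.
  exact: le_trans (ler_norm _) (f1 _ _).
- have : bl y' i = false.
    by rewrite -[X in bl y' X]nthE; apply: before_find; rewrite -/(lab y') ly'.
  by move/negbT; rewrite negb_or -leNgt => /andP[].
Qed.

Theorem brouwer_fixed_point (N : nat) (f : 'cV[R]_N -> 'cV[R]_N) :
  continuous f -> (forall x i, `|f x i 0| <= 1) -> exists x, f x = x.
Proof.
move=> fc f1.
have /choice[z zP] : forall k : nat, exists z : 'cV[R]_N, (forall i, `|z i 0| <= 1) /\
  forall i, exists y y' : 'cV[R]_N,
    [/\ forall j, `|y j 0 - z j 0| <= 2 / k.+1%:R,
        forall j, `|y' j 0 - z j 0| <= 2 / k.+1%:R,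
      f y i 0 <= y i 0 & y' i 0 <= f y' i 0].
  by move=> k; apply: grid_almost_fixed.
have [U [UU Uoo]] := free_ultrafilter.
have [x zx] : exists x : 'cV[R]_N, z @ U --> x.
  apply: (@ultra_bounded_cvg R U _ _ z 1); apply: nearW => k i j.
  by rewrite (ord1 j); have [] := zP k.
exists x; apply/matrixP => i j; rewrite (ord1 j).
have small : 2 / k.+1%:R @[k --> U] --> (0 : R).
  apply: cvg_trans (_ : (fun k => 2 / k.+1%:R : R) @ \oo --> 0).
    by apply: cvg_fmap2.
  rewrite -[X in _ --> X](mulr0 2); apply: cvgM; first exact: cvg_cst.
  exact: cvg_harmonic.
have close (y : nat -> 'cV[R]_N) :
    (forall k j, `|y k j 0 - z k j 0| <= 2 / k.+1%:R) -> y @ U --> x.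
  move=> yz; apply: cvg_mx => a b; rewrite (ord1 b).
  have : (y k a 0 - z k a 0) @[k --> U] --> 0.
    apply/norm_cvg0P; apply: (squeeze_cvgr _ (cvg_cst 0) small).
    by near=> k; rewrite normr_ge0 yz.
  move/(cvgD (cvg_entry (i := a) (j := 0) zx)); rewrite addr0.
  by apply: cvg_trans; apply: near_eq_cvg; near=> k; rewrite /= addrC subrK.
have /choice[y yP] : forall k, exists y : 'cV[R]_N,
    (forall j, `|y j 0 - z k j 0| <= 2 / k.+1%:R) /\ f y i 0 <= y i 0.
  by move=> k; have [_ /(_ i)[y [_ [? _ ? _]]]] := zP k; exists y.
have /choice[y' y'P] : forall k, exists y : 'cV[R]_N,
    (forall j, `|y j 0 - z k j 0| <= 2 / k.+1%:R) /\ y i 0 <= f y i 0.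
  by move=> k; have [_ /(_ i)[_ [w [_ ? _ ?]]]] := zP k; exists w.
have yx := close y (fun k j => (yP k).1 j).
have y'x := close y' (fun k j => (y'P k).1 j).
have lim (w : nat -> 'cV[R]_N) : w @ U --> x ->
    w k i 0 @[k --> U] --> x i 0 /\ f (w k) i 0 @[k --> U] --> f x i 0.
  move=> wx; split; first exact: cvg_entry.
  have fw : f (w k) @[k --> U] --> f x by apply: cvg_comp wx _; exact: fc.
  exact: cvg_entry fw.
have [yi fyi] := lim _ yx; have [y'i fy'i] := lim _ y'x.
apply: le_anti; apply/andP; split.
  by apply: (ler_cvg_to fyi yi); apply: nearW => k; have [] := yP k.
by apply: (ler_cvg_to y'i fy'i); apply: nearW => k; have [] := y'P k.
Unshelve. all: by end_near. Qed.

End Brouwer.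

(** * Euclidean geometry *)

Section EuclideanNorm.
Context {R : realType} {n : nat}.
Implicit Types (u v w : 'cV[R]_n.+1) (A B : 'M[R]_n.+1) (a b : R).

Lemma dotvE u v : dotv u v = \sum_i u i 0 * v i 0.
Proof. by rewrite /dotv mxE; apply: eq_bigr => i _; rewrite mxE. Qed.

Lemma dotvC u v : dotv u v = dotv v u.
Proof. by rewrite !dotvE; apply: eq_bigr => i _; rewrite mulrC. Qed.

Lemma dotvDl u v w : dotv (u + v) w = dotv u w + dotv v w.
Proof. by rewrite /dotv linearD /= mulmxDl mxE. Qed.

Lemma dotvDr u v w : dotv w (u + v) = dotv w u + dotv w v.
Proof. by rewrite /dotv mulmxDr mxE. Qed.

Lemma dotvZl a u v : dotv (a *: u) v = a * dotv u v.
Proof. by rewrite /dotv linearZ /= -scalemxAl mxE. Qed.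

Lemma dotvZr a u v : dotv u (a *: v) = a * dotv u v.
Proof. by rewrite /dotv -scalemxAr mxE. Qed.

Lemma dotvNl u v : dotv (- u) v = - dotv u v.
Proof. by rewrite -scaleN1r dotvZl mulN1r. Qed.

Lemma dotvNr u v : dotv u (- v) = - dotv u v.
Proof. by rewrite -scaleN1r dotvZr mulN1r. Qed.

Lemma dotvBl u v w : dotv (u - v) w = dotv u w - dotv v w.
Proof. by rewrite dotvDl dotvNl. Qed.

Lemma dotvBr u v w : dotv w (u - v) = dotv w u - dotv w v.
Proof. by rewrite dotvDr dotvNr. Qed.

Lemma dot0v u : dotv 0 u = 0. Proof. by rewrite -(scale0r u) dotvZl mul0r. Qed.

Lemma dotv0 u : dotv u 0 = 0. Proof. by rewrite dotvC dot0v. Qed.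

Lemma dotv_mulmxl A u v : dotv (A *m u) v = dotv u (A^T *m v).
Proof. by rewrite /dotv trmx_mul mulmxA. Qed.

Lemma dotv_mulmxr A u v : dotv u (A *m v) = dotv (A^T *m u) v.
Proof. by rewrite dotv_mulmxl trmxK. Qed.

Lemma dotv_ge0 u : 0 <= dotv u u.
Proof. by rewrite dotvE; apply: sumr_ge0 => i _; rewrite -expr2 sqr_ge0. Qed.

Lemma dotv_eq0 u : (dotv u u == 0) = (u == 0).
Proof.
apply/eqP/eqP => [|->]; last by rewrite dotv0.
rewrite dotvE => /eqP; rewrite psumr_eq0 => [|i _]; last by rewrite -expr2 sqr_ge0.
move=> /allP h; apply/matrixP => i j; rewrite (ord1 j) mxE.
by have := h i (mem_index_enum i); rewrite -expr2 sqrf_eq0 => /eqP.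
Qed.

Lemma enorm_ge0 u : 0 <= enorm u. Proof. exact: sqrtr_ge0. Qed.

Lemma sqr_enorm u : enorm u ^+ 2 = dotv u u.
Proof. by rewrite sqr_sqrtr // dotv_ge0. Qed.

Lemma enorm_eq0 u : (enorm u == 0) = (u == 0).
Proof. by rewrite -dotv_eq0 -sqr_enorm sqrf_eq0. Qed.

Lemma enorm0 : enorm (0 : 'cV[R]_n.+1) = 0.
Proof. by apply/eqP; rewrite enorm_eq0. Qed.

Lemma enormZ a u : enorm (a *: u) = `|a| * enorm u.
Proof.
by rewrite /enorm dotvZl dotvZr mulrA -expr2 sqrtrM ?sqr_ge0 // sqrtr_sqr.
Qed.

Lemma enormN u : enorm (- u) = enorm u.
Proof. by rewrite -scaleN1r enormZ normrN1 mul1r. Qed.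

Lemma ler_enorm u v : (enorm u <= enorm v) = (dotv u u <= dotv v v).
Proof. by rewrite -!sqr_enorm ler_pXn2r // nnegrE enorm_ge0. Qed.

Lemma enorm_le u a : 0 <= a -> (enorm u <= a) = (dotv u u <= a ^+ 2).
Proof. by move=> a0; rewrite -sqr_enorm ler_pXn2r // nnegrE enorm_ge0. Qed.

Lemma cauchy_schwarz u v : dotv u v ^+ 2 <= dotv u u * dotv v v.
Proof.
have [->|v0] := eqVneq v 0; first by rewrite !dotv0 mulr0 expr0n.
have vv : 0 < dotv v v by rewrite lt_neqAle eq_sym dotv_eq0 v0 dotv_ge0.
have := dotv_ge0 (u - (dotv u v / dotv v v) *: v).
rewrite dotvBl !dotvBr !dotvZl !dotvZr (dotvC v u) mulfVK ?gt_eqF // subrr subr0.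
by rewrite mulrAC -expr2 subr_ge0 ler_pdivrMr.
Qed.

Lemma dotv_le_enorm u v : dotv u v <= enorm u * enorm v.
Proof.
apply: le_trans (ler_norm _) _.
rewrite -(@ler_pXn2r _ 2) ?nnegrE ?mulr_ge0 ?enorm_ge0 //.
by rewrite real_normK ?num_real // exprMn !sqr_enorm cauchy_schwarz.
Qed.

Lemma enormD u v : enorm (u + v) <= enorm u + enorm v.
Proof.
rewrite enorm_le ?addr_ge0 ?enorm_ge0 // dotvDl !dotvDr (dotvC v u) sqrrD !sqr_enorm.
by have := dotv_le_enorm u v; lra.
Qed.

Lemma enormB u v : enorm (u - v) = enorm (v - u).
Proof. by rewrite -enormN opprB. Qed.

Lemma enorm_sum (I : Type) (r : seq I) (F : I -> 'cV[R]_n.+1) :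
  enorm (\sum_(i <- r) F i) <= \sum_(i <- r) enorm (F i).
Proof.
elim: r => [|i r IH]; first by rewrite !big_nil enorm0.
by rewrite !big_cons (le_trans (enormD _ _)) // lerD2l.
Qed.

Lemma norm_entry_le u i : `|u i 0| <= enorm u.
Proof.
rewrite -sqrtr_sqr ler_sqrt ?dotv_ge0 // dotvE (bigD1 i) //= -expr2 lerDl.
by apply: sumr_ge0 => j _; rewrite -expr2 sqr_ge0.
Qed.

Lemma enorm_le_sum u : enorm u <= \sum_i `|u i 0|.
Proof.
rewrite {1}[u](matrix_sum_delta); apply: le_trans (enorm_sum _ _) _.
apply: ler_sum => i _; rewrite big_ord1 enormZ ler_piMr //.
by rewrite enorm_le // dotvE (bigD1 i) //= big1 ?mxE ?eqxx /= => [|j /negbTE ji]; rewrite ?mxE ?ji //=; lra.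
Qed.

(** A Euclidean operator norm bound, submultiplicative by [opboundM]; the norm of matrices in scope
    is the largest entry, which is not submultiplicative. *)
Definition opbound A a := forall v, enorm (A *m v) <= a * enorm v.

Lemma opboundM A B a b : 0 <= a -> opbound A a -> opbound B b -> opbound (A *m B) (a * b).
Proof.
move=> a0 Aa Bb v; rewrite -mulmxA (le_trans (Aa _)) // -mulrA.
exact: ler_wpM2l (Bb v).
Qed.

Lemma opboundD A B a b : opbound A a -> opbound B b -> opbound (A + B) (a + b).
Proof.
by move=> Aa Bb v; rewrite mulmxDl (le_trans (enormD _ _)) // mulrDl lerD.
Qed.

Lemma opboundZ A a b : opbound A a -> opbound (b *: A) (`|b| * a).
Proof. by move=> Aa v; rewrite -scalemxAl enormZ -mulrA ler_wpM2l. Qed.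

Lemma opboundW A a b : a <= b -> opbound A a -> opbound A b.
Proof. by move=> ab Aa v; rewrite (le_trans (Aa v)) // ler_wpM2r ?enorm_ge0. Qed.

Lemma opbound1 : opbound 1%:M 1. Proof. by move=> v; rewrite mul1mx mul1r. Qed.

Lemma opbound0 : opbound 0 0. Proof. by move=> v; rewrite mul0mx enorm0 mul0r. Qed.

Lemma opbound_entry A a i j : opbound A a -> `|A i j| <= a.
Proof.
move=> /(_ (delta_mx j 0)); rewrite -colE => h.
have -> : A i j = col j A i 0 by rewrite mxE.
apply: le_trans (norm_entry_le _ _) (le_trans h _).
suff -> : enorm (delta_mx j 0 : 'cV[R]_n.+1) = 1 by rewrite mulr1.
rewrite /enorm dotvE (bigD1 j) //= big1 ?mxE ?eqxx /= => [|k /negbTE kj].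
  by rewrite mul1r addr0 sqrtr1.
by rewrite mxE kj mul0r.
Qed.

Lemma opbound_of_entries A a : (forall i j, `|A i j| <= a) -> opbound A (n.+1%:R ^+ 2 * a).
Proof.
move=> Aa v; apply: le_trans (enorm_le_sum _) _.
have a0 : 0 <= a by apply: le_trans (Aa 0 0).
have h i : `|(A *m v) i 0| <= n.+1%:R * (a * enorm v).
  rewrite mxE (le_trans (ler_norm_sum _ _ _)) //.
  apply: le_trans (ler_sum _ (G := fun=> a * enorm v) _) _.
    by move=> j _; rewrite normrM ler_pM // norm_entry_le.
  by rewrite sumr_const card_ord mulr_natl.
apply: le_trans (ler_sum _ (fun i _ => h i)) _.
by rewrite sumr_const card_ord -[_ *+ _]mulr_natl !mulrA -expr2.
Qed.

Lemma opbound_isometry A : A^T *m A = 1%:M -> opbound A 1.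
Proof.
move=> AA v; rewrite mul1r ler_enorm dotv_mulmxl mulmxA AA mul1mx //.
Qed.

End EuclideanNorm.

Section EuclideanLimits.
Context {R : realType} {n : nat} {T : Type} {F : set_system T} {FF : Filter F}.

Lemma cvg_dotv (f g : T -> 'cV[R]_n.+1) (a b : 'cV[R]_n.+1) :
  f @ F --> a -> g @ F --> b -> dotv (f x) (g x) @[x --> F] --> dotv a b.
Proof. by move=> fa gb; apply: cvg_entry; apply: cvg_mulmx => //; apply: cvg_trmx. Qed.

Lemma cvg_enorm (f : T -> 'cV[R]_n.+1) (a : 'cV[R]_n.+1) :
  f @ F --> a -> enorm (f x) @[x --> F] --> enorm a.
Proof.
by move=> fa; apply: (cvg_comp _ _ (cvg_dotv fa fa) (@sqrt_continuous R _)).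
Qed.

End EuclideanLimits.

(** * The tangent space of the group at the identity *)

Section LieAlgebra.
Context {R : realType} {n : nat} (G : set 'M[R]_n.+1).
Hypothesis subG : is_subgroup G.
Hypothesis orthG : G `<=` @orthogonal_mx R n.
Implicit Types (X Y : 'M[R]_n.+1) (g : 'M[R]_n.+1).

Lemma grp1 : G 1%:M. Proof. by have [] := subG. Qed.
Lemma grpM g h : G g -> G h -> G (g *m h). Proof. by have [_ [m _]] := subG; exact: m. Qed.

Lemma grp_trK g : G g -> g^T *m g = 1%:M. Proof. exact: orthG. Qed.

Lemma grpKtr g : G g -> g *m g^T = 1%:M. Proof. by move/orthG/mulmx1C. Qed.

Lemma grpT g : G g -> G g^T.
Proof.
move=> Gg; have [_ [_ /(_ _ Gg)[gU Gi]]] := subG.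
suff -> : g^T = invmx g by [].
by rewrite -[LHS]mulmx1 -(mulmxV gU) mulmxA grp_trK // mul1mx.
Qed.

Lemma dotv_grp g (u v : 'cV[R]_n.+1) : G g -> dotv (g *m u) (g *m v) = dotv u v.
Proof. by move=> Gg; rewrite dotv_mulmxl mulmxA grp_trK // mul1mx. Qed.

Lemma lie_algP X : lie_alg G X <->
  exists c : R -> 'M[R]_n.+1, [/\ forall t, G (c t), c 0 = 1%:M &
    h^-1 *: (c h - 1%:M) @[h --> 0^'] --> X].
Proof.
have shiftE (c : R -> 'M[R]_n.+1) : c 0 = 1%:M ->
    (fun h : R => h^-1 *: ((c \o shift 0) (h *: 1) - c 0)) =
    (fun h => h^-1 *: (c h - 1%:M)).
  by move=> c0; apply/funext => h; rewrite /= addr0 /GRing.scale /= mulr1 c0.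
split=> [[c [cG [c0 [dc DX]]]]|[c [cG c0 cX]]]; exists c.
  split=> //; rewrite -shiftE // -DX; exact: dc.
split=> //; split=> //; split.
  by apply/cvg_ex; exists X; rewrite shiftE.
by rewrite /derive shiftE //; exact/cvg_lim.
Qed.

Lemma curve_cvg1 (c : R -> 'M[R]_n.+1) X :
  h^-1 *: (c h - 1%:M) @[h --> 0^'] --> X -> c h @[h --> 0^'] --> (1%:M : 'M[R]_n.+1).
Proof.
move=> cX; have h0 : (fun h : R => h) @ 0^' --> (0 : R) by exact: cvg_within.
have : (1%:M + h *: (h^-1 *: (c h - 1%:M)) : 'M[R]_n.+1) @[h --> 0^'] --> 1%:M + 0 *: X.
  by apply: cvgD; [exact: cvg_cst|apply: cvgZ; [exact: h0|exact: cX]].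
rewrite scale0r addr0; apply: cvg_trans.
apply: near_eq_cvg; near=> h; rewrite /= scalerA divff ?scale1r; last first.
  by near: h; exact: nbhs_dnbhs_neq.
by rewrite addrC subrK.
Unshelve. all: by end_near. Qed.

Lemma lie_alg0 : lie_alg G 0.
Proof.
apply/lie_algP; exists (fun=> 1%:M); split=> // [_|]; first exact: grp1.
by under eq_fun do rewrite subrr scaler0; exact: cvg_cst.
Qed.

Lemma lie_algD X Y : lie_alg G X -> lie_alg G Y -> lie_alg G (X + Y).
Proof.
move=> /lie_algP[c [cG c0 cX]] /lie_algP[d [dG d0 dY]]; apply/lie_algP.
exists (fun t => c t *m d t); split=> [t||]; first exact: grpM.
  by rewrite c0 d0 mulmx1.
rewrite -[X in X + _]mulmx1.
have -> : (fun h => h^-1 *: (c h *m d h - 1%:M)) =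
    (fun h => (h^-1 *: (c h - 1%:M)) *m d h + h^-1 *: (d h - 1%:M)).
  apply/funext => h; rewrite -scalemxAl -scalerDr mulmxBl mul1mx.
  by rewrite addrA subrK.
by apply: cvgD => //; apply: cvg_mulmx => //; exact: curve_cvg1 dY.
Qed.

Lemma lie_algZ (a : R) X : lie_alg G X -> lie_alg G (a *: X).
Proof.
have [->|a0] := eqVneq a 0; first by rewrite scale0r => _; exact: lie_alg0.
move=> /lie_algP[c [cG c0 cX]]; apply/lie_algP; exists (fun t => c (a * t)).
split=> //; first by rewrite mulr0.
have -> : (fun h => h^-1 *: (c (a * h) - 1%:M)) =
    (fun h => a *: ((a * h)^-1 *: (c (a * h) - 1%:M))).
  by apply/funext => h; rewrite scalerA invfM mulrA divff // mul1r.
apply: cvgZr; apply: cvg_comp cX.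
move=> A [e /= e0 Ae]; exists (e / `|a|) => /=; first by rewrite divr_gt0 ?normr_gt0.
move=> h /=; rewrite !sub0r !normrN => he h0; apply: Ae => /=.
  by rewrite sub0r normrN normrM mulrC -ltr_pdivlMr ?normr_gt0.
by rewrite mulf_neq0.
Qed.

(** The relation [c^T *m c = 1] along a curve in [G], differentiated at 0. *)
Lemma lie_alg_skew X : lie_alg G X -> X^T = - X.
Proof.
move=> /lie_algP[c [cG c0 cX]]; apply/eqP; rewrite -addr_eq0; apply/eqP.
rewrite -[X in X + _]mulmx1.
have lim : (h^-1 *: (c h - 1%:M))^T *m c h + h^-1 *: (c h - 1%:M) @[h --> 0^']
    --> X^T *m 1%:M + X.
  apply: cvgD => //; apply: cvg_mulmx; first exact: cvg_trmx.
  exact: curve_cvg1 cX.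
apply: (cvg_unique _ lim); rewrite //.
have -> : (fun h => (h^-1 *: (c h - 1%:M))^T *m c h + h^-1 *: (c h - 1%:M)) =
    (fun=> 0).
  apply/funext => h; rewrite linearZ /= -scalemxAl -scalerDr linearB /= trmx1.
  by rewrite mulmxBl mul1mx grp_trK // addrA subrK subrr scaler0.
exact: cvg_cst.
Qed.

Lemma lie_alg_conj g X : G g -> lie_alg G X -> lie_alg G (g *m X *m g^T).
Proof.
move=> Gg /lie_algP[c [cG c0 cX]]; apply/lie_algP.
exists (fun t => g *m c t *m g^T); split=> [t||].
- by apply: grpM; [exact: grpM|exact: grpT].
- by rewrite c0 mulmx1 grpKtr.
have -> : (fun h => h^-1 *: (g *m c h *m g^T - 1%:M)) =
    (fun h => g *m (h^-1 *: (c h - 1%:M)) *m g^T).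
  apply/funext => h; rewrite -scalemxAr -scalemxAl mulmxBr mulmxBl mulmx1.
  by rewrite grpKtr.
by apply: cvg_mulmx; [apply: cvg_mulmx|]; [exact: cvg_cst| |exact: cvg_cst].
Qed.

Lemma lie_alg_dotv X (u v : 'cV[R]_n.+1) : lie_alg G X -> dotv (X *m u) v = - dotv u (X *m v).
Proof. by move=> /lie_alg_skew XT; rewrite dotv_mulmxl XT mulNmx dotvNr. Qed.

Lemma lie_alg_dotvv X (u : 'cV[R]_n.+1) : lie_alg G X -> dotv u (X *m u) = 0.
Proof. by move=> LX; have := lie_alg_dotv u u LX; rewrite dotvC; lra. Qed.

(* Products of curves through 1 approximate [1 + h Y] to first order, uniformly in
   the coefficients of [Y]; this replaces the exponential map. *)
Lemma near_grp1 (X : 'M[R]_n.+1) (C e : R) : lie_alg G X -> 0 < e ->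
  exists2 d : R, 0 < d & forall h y : R, 0 < h < d -> `|y| <= C ->
    exists2 g, G g & opbound (g - (1%:M + (h * y) *: X)) (e * h).
Proof.
move=> /lie_algP[c [cG c0 cX]] e0.
have [C0|C0] := ltP C 0.
  exists 1 => // h y _ yC; have := le_trans yC (ltW C0); rewrite normr_le0 => /eqP y0.
  by move: yC; rewrite y0 normr0 leNgt C0.
have K0 : 0 < n.+1%:R ^+ 2 * (C + 1) :> R by rewrite mulr_gt0 ?exprn_gt0 ?ltr_wpDl.
pose e' := e / (n.+1%:R ^+ 2 * (C + 1)).
have e'0 : 0 < e' by rewrite divr_gt0.
have /cvgrPdist_le/(_ _ e'0)[d /= d0 dP] := cX.
exists (d / (C + 1)) => [|h y /andP[h0 hd] yC]; first by rewrite divr_gt0 ?ltr_wpDl.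
have [->|y0] := eqVneq y 0.
  exists 1%:M; first exact: grp1.
  rewrite mulr0 scale0r addr0 subrr; apply: (opboundW _ opbound0).
  by rewrite mulr_ge0 // ltW.
pose s := h * y; have s0 : s != 0 by rewrite mulf_neq0 // gt_eqF.
have sC : `|s| <= h * C by rewrite normrM (gtr0_norm h0) ler_wpM2l // ltW.
exists (c s) => //; rewrite -/s.
have -> : c s - (1%:M + s *: X) = s *: (s^-1 *: (c s - 1%:M) - X).
  by rewrite scalerBr scalerA divff // scale1r opprD addrA.
have sd : `|s| < d.
  apply: le_lt_trans sC _; move: hd; rewrite ltr_pdivlMr ?ltr_wpDl //.
  by apply: le_lt_trans; rewrite ler_wpM2l ?lerDl // ltW.
have ent i j : `|(s^-1 *: (c s - 1%:M) - X) i j| <= e'.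
  have := dP s; rewrite /= sub0r normrN => /(_ sd s0); rewrite distrC.
  by apply: le_trans; exact: norm_entry_le_mx_norm.
apply: (opboundW _ (opboundZ s (opbound_of_entries ent))).
apply: le_trans (ler_wpM2r _ sC) _; first by rewrite mulr_ge0 ?exprn_ge0 // ltW.
have -> : h * C * (n.+1%:R ^+ 2 * e') = e * h * (C / (C + 1)).
  by rewrite /e'; field; rewrite addrC nat1r pnatr_eq0 andbT gt_eqF //= addrC ltr_wpDl.
rewrite ler_piMr ?mulr_ge0 ?(ltW e0) ?(ltW h0) // ler_pdivrMr ?ltr_wpDl //.
by rewrite mul1r lerDl.
Qed.

Lemma near_grp (I : Type) (r : seq I) (B : I -> 'M[R]_n.+1) (C : R) :
  (forall i, lie_alg G (B i)) -> forall e : R, 0 < e ->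
  exists2 d : R, 0 < d & forall (h : R) (y : I -> R), 0 < h < d -> (forall i, `|y i| <= C) ->
    exists2 g, G g & opbound (g - (1%:M + h *: \sum_(i <- r) y i *: B i)) (e * h).
Proof.
move=> LB; elim: r => [|i r IH] e e0.
  exists 1 => // h y /andP[h0 _] _; exists 1%:M; first exact: grp1.
  rewrite big_nil scaler0 addr0 subrr; apply: (opboundW _ opbound0).
  by rewrite mulr_ge0 // ltW.
have bnd (X : 'M[R]_n.+1) : exists2 b : R, 0 <= b & opbound X b.
  exists (n.+1%:R ^+ 2 * `|X|); first by rewrite mulr_ge0 ?exprn_ge0.
  by apply: opbound_of_entries => j k; exact: norm_entry_le_mx_norm.
pose C' := Num.max C 0.
have C'0 : 0 <= C' by rewrite le_max lexx orbT.
have [b b0 bB] : exists2 b : R, 0 <= b &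
    forall y : I -> R, (forall i, `|y i| <= C) -> opbound (y i *: B i) b.
  have [b b0 bB] := bnd (B i); exists (C' * b) => [|y yC]; first exact: mulr_ge0.
  apply: opboundW (opboundZ _ bB); rewrite ler_wpM2r //.
  by rewrite (le_trans (yC i)) // le_max lexx.
have [s s0 sB] : exists2 s : R, 0 <= s &
    forall y : I -> R, (forall i, `|y i| <= C) -> opbound (\sum_(j <- r) y j *: B j) s.
  elim: (r) => [|j q [s s0 sB]].
    by exists 0 => // y _; rewrite big_nil; exact: opbound0.
  have [c c0 cB] := bnd (B j); exists (C' * c + s); first by rewrite addr_ge0 ?mulr_ge0.
  move=> y yC; rewrite big_cons; apply: opboundD; last exact: sB.
  apply: opboundW (opboundZ _ cB); rewrite ler_wpM2r //.
  by rewrite (le_trans (yC j)) // le_max lexx.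
have e40 : 0 < e / 4 by rewrite divr_gt0.
have [d1 d10 d1P] := near_grp1 C (LB i) e40.
have [d2 d20 d2P] := IH _ e40.
(* The bound [(b + 1)^-1] gives the first factor operator norm at most 2, and the last bound makes
   the cross term [h ^+ 2 *: (Y *m S)] at most [e / 4 * h]. The total is
   [e / 4 + 2 * (e / 4) + e / 4]. *)
exists (Num.min (Num.min d1 d2) (Num.min (b + 1)^-1 (e / (4 * (b * s + 1))))).
  by rewrite !lt_min d10 d20 invr_gt0 ltr_wpDl //= divr_gt0 ?mulr_gt0 ?ltr_wpDl ?mulr_ge0.
move=> h y /andP[h0]; rewrite !lt_min => /andP[/andP[hd1 hd2] /andP[hb hs]] yC.
have [g1 Gg1 g1P] := d1P h (y i) (introT andP (conj h0 hd1)) (yC i).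
have [g2 Gg2 g2P] := d2P h y (introT andP (conj h0 hd2)) yC.
exists (g1 *m g2); first exact: grpM.
set S := \sum_(j <- r) _ in g2P *; rewrite big_cons -/S; set Y := y i *: B i.
have YE : (h * y i) *: B i = h *: Y by rewrite scalerA.
rewrite {}YE in g1P.
have -> : g1 *m g2 - (1%:M + h *: (Y + S)) = (g1 - (1%:M + h *: Y)) *m g2 +
    ((1%:M + h *: Y) *m (g2 - (1%:M + h *: S)) + h ^+ 2 *: (Y *m S)).
  have PQ : (1%:M + h *: Y) *m (1%:M + h *: S) =
      1%:M + h *: (Y + S) + h ^+ 2 *: (Y *m S).
    rewrite mulmxDl !mulmxDr !mulmx1 mul1mx -scalemxAl -scalemxAr expr2 -scalerA scalerDr.
    by rewrite !addrA; congr (_ + _); exact: addrAC.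
  have tele (a c d k : 'M[R]_n.+1) : a - d = (a - c) + ((c - (d + k)) + k).
    by rewrite opprD !addrA subrK subrK.
  by rewrite mulmxBl mulmxBr PQ; exact: tele.
have YB : opbound Y b by exact: bB.
have SB : opbound S s by exact: sB.
have PB : opbound (1%:M + h *: Y) 2.
  apply: opboundW (opboundD opbound1 (opboundZ h YB)).
  rewrite (gtr0_norm h0) -[leRHS]/(1 + 1) lerD2l.
  rewrite -[X in _ <= X](@mulVf _ (b + 1)) ?gt_eqF ?ltr_wpDl //.
  by apply: ler_pM => //; [exact: ltW|exact: ltW|rewrite lerDl].
have := opboundD (opboundM (ltW (mulr_gt0 e40 h0)) g1P (opbound_isometry (grp_trK Gg2)))
  (opboundD (opboundM (ler0n _ 2) PB g2P) (opboundZ (h ^+ 2) (opboundM b0 YB SB))).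
apply: opboundW; rewrite mulr1 ger0_norm ?exprn_ge0 ?(ltW h0) //.
suff : h * (b * s) <= e / 4.
  move=> hbs; have : h ^+ 2 * (b * s) <= h * (e / 4).
    by rewrite expr2 -mulrA; apply: ler_wpM2l => //; exact: ltW.
  by lra.
apply: le_trans (ler_wpM2r _ (ltW hs)) _; first exact: mulr_ge0.
have k0 : 0 < b * s + 1 by rewrite ltr_wpDl ?mulr_ge0.
have -> : e / (4 * (b * s + 1)) * (b * s) = e / 4 * (b * s / (b * s + 1)).
  by field; rewrite gt_eqF.
by rewrite ler_piMr ?(ltW e40) // ler_pdivrMr // mul1r lerDl.
Qed.

End LieAlgebra.

(** * Vertical projection *)

Section VerticalProjection.
Context {R : realType} {n r : nat} (B : 'I_r -> 'M[R]_n.+1).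
Implicit Types (u v : 'cV[R]_n.+1) (a : 'cV[R]_r) (e : R).

Definition field_mx v : 'M[R]_(n.+1, r) := \matrix_(i, j) (B j *m v) i 0.

Definition gram v : 'M[R]_r := (field_mx v)^T *m field_mx v.

Definition gram_det v : R := \det (gram v).

Definition field_comb a : 'M[R]_n.+1 := \sum_j a j 0 *: B j.

Definition adj_coef v u : 'cV[R]_r := \adj (gram v) *m ((field_mx v)^T *m u).

(* Cramer's rule, with [1 / det] regularised to [det / (det ^ 2 + e)]. *)
Definition reg_coef e v u : 'cV[R]_r :=
  (gram_det v / (gram_det v ^+ 2 + e)) *: adj_coef v u.

Definition vert_coef v u : 'cV[R]_r := (gram_det v)^-1 *: adj_coef v u.

Definition reg_comb e v u : 'M[R]_n.+1 := field_comb (reg_coef e v u).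

Definition vert_comb v u : 'M[R]_n.+1 := field_comb (vert_coef v u).

Lemma field_mx_mul v a : field_mx v *m a = field_comb a *m v.
Proof.
apply/matrixP => i j; rewrite (ord1 j) mxE mulmx_suml summxE.
by apply: eq_bigr => k _; rewrite mxE -scalemxAl !mxE mulrC.
Qed.

Lemma dotv_field_mx v u a : dotv u (field_mx v *m a) = (((field_mx v)^T *m u)^T *m a) 0 0.
Proof. by rewrite /dotv mulmxA trmx_mul trmxK. Qed.

(** These are the normal equations of least squares: [vert_comb v u *m v] is the orthogonal
    projection of [u] on the span of the fields at [v]. *)
Lemma vert_comb_ortho v u a : gram_det v != 0 ->
  dotv (u - vert_comb v u *m v) (field_mx v *m a) = 0.
Proof.
move=> v0; rewrite -field_mx_mul dotv_field_mx mulmxBr mulmxA -/(gram v).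
rewrite /vert_coef -scalemxAr mulmxA mul_mx_adj -/(gram_det v) mul_scalar_mx.
by rewrite scalerA mulVf // scale1r subrr trmx0 mul0mx mxE.
Qed.

Lemma reg_combE e v u : gram_det v != 0 -> reg_comb e v u =
  (gram_det v ^+ 2 / (gram_det v ^+ 2 + e)) *: vert_comb v u.
Proof.
move=> v0; rewrite /reg_comb /vert_comb /field_comb scaler_sumr.
apply: eq_bigr => j _; rewrite scalerA; congr (_ *: _).
by rewrite !mxE mulrA; congr (_ * _); rewrite mulrAC expr2 mulfK.
Qed.

(** The regularised field subtracts a fraction between 0 and 1 of the orthogonal projection, and
    nothing where the Gram determinant vanishes. The bound involves neither [e] nor the determinant,
    which makes the Lipschitz constant of the limit curve uniform. *)
Lemma reg_comb_contraction e v u : 0 < e ->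
  enorm (u - reg_comb e v u *m v) <= enorm u.
Proof.
move=> e0; have [v0|v0] := eqVneq (gram_det v) 0.
  rewrite /reg_comb /reg_coef v0 mul0r scale0r /field_comb big1 => [|j _].
    by rewrite mul0mx subr0.
  by rewrite mxE scale0r.
rewrite reg_combE // -scalemxAl; set w := vert_comb v u *m v.
have uw : dotv u w = dotv w w.
  have := vert_comb_ortho u (vert_coef v u) v0.
  by rewrite field_mx_mul -/(vert_comb v u) -/w dotvBl => /eqP; rewrite subr_eq0 => /eqP.
have d0 : 0 < gram_det v ^+ 2 by rewrite exprn_even_gt0.
set p := _ / _; have p0 : 0 <= p by rewrite divr_ge0 // ?ltW // addr_gt0.
have p1 : p <= 1 by rewrite ler_pdivrMr ?addr_gt0 // mul1r lerDl ltW.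
rewrite ler_enorm dotvBl !dotvBr !dotvZl !dotvZr (dotvC w u) uw.
have : 0 <= p * (2 - p) * dotv w w.
  by rewrite mulr_ge0 ?dotv_ge0 // mulr_ge0 //; lra.
by set W := dotv w w; set V := dotv u u; nra.
Qed.

Lemma field_comb_skew a : (forall j, (B j)^T = - B j) -> (field_comb a)^T = - field_comb a.
Proof.
move=> Bs; rewrite /field_comb linear_sum /= -sumrN; apply: eq_bigr => j _.
by rewrite linearZ /= Bs scalerN.
Qed.

End VerticalProjection.

Section VerticalLimits.
Context {R : realType} {n r : nat} (B : 'I_r -> 'M[R]_n.+1).
Context {T : Type} {F : set_system T} {FF : Filter F}.

Lemma cvg_field_mx (v : T -> 'cV[R]_n.+1) (v0 : 'cV[R]_n.+1) :
  v @ F --> v0 -> field_mx B (v x) @[x --> F] --> field_mx B v0.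
Proof.
move=> vv; apply: cvg_mx => i j; rewrite mxE; under eq_fun do rewrite mxE.
by apply: cvg_entry; apply: cvg_mulmx => //; exact: cvg_cst.
Qed.

Lemma cvg_gram (v : T -> 'cV[R]_n.+1) (v0 : 'cV[R]_n.+1) :
  v @ F --> v0 -> gram B (v x) @[x --> F] --> gram B v0.
Proof.
by move=> vv; apply: cvg_mulmx; [apply: cvg_trmx|]; exact: cvg_field_mx.
Qed.

Lemma cvg_gram_det (v : T -> 'cV[R]_n.+1) (v0 : 'cV[R]_n.+1) :
  v @ F --> v0 -> gram_det B (v x) @[x --> F] --> gram_det B v0.
Proof. by move=> vv; apply: cvg_det; exact: cvg_gram. Qed.

Lemma cvg_adj_coef (v u : T -> 'cV[R]_n.+1) (v0 u0 : 'cV[R]_n.+1) :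
  v @ F --> v0 -> u @ F --> u0 ->
  adj_coef B (v x) (u x) @[x --> F] --> adj_coef B v0 u0.
Proof.
move=> vv uu; apply: cvg_mulmx; first by apply: cvg_adj; exact: cvg_gram.
by apply: cvg_mulmx => //; apply: cvg_trmx; exact: cvg_field_mx.
Qed.

Lemma cvg_field_comb (a : T -> 'cV[R]_r) (a0 : 'cV[R]_r) :
  a @ F --> a0 -> field_comb B (a x) @[x --> F] --> field_comb B a0.
Proof.
move=> aa; apply: cvg_mx => i j; rewrite summxE; under eq_fun do rewrite summxE.
apply: cvg_sumr => k; rewrite mxE; under eq_fun do rewrite mxE.
by apply: cvgM; [exact: cvg_entry|exact: cvg_cst].
Qed.

Lemma cvg_reg_coef (e : R) (v u : T -> 'cV[R]_n.+1) (v0 u0 : 'cV[R]_n.+1) :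
  0 < e -> v @ F --> v0 -> u @ F --> u0 ->
  reg_coef B e (v x) (u x) @[x --> F] --> reg_coef B e v0 u0.
Proof.
move=> e0 vv uu; have dv := cvg_gram_det vv.
apply: cvgZ; last exact: cvg_adj_coef.
apply: cvgM => //; apply: cvgV; first by rewrite gt_eqF // ltr_wpDl ?sqr_ge0.
by apply: cvgD; [rewrite expr2; under eq_fun do rewrite expr2; exact: cvgM|exact: cvg_cst].
Qed.

Lemma cvg_reg_coef0 (e : T -> R) (v u : T -> 'cV[R]_n.+1) (v0 u0 : 'cV[R]_n.+1) :
  gram_det B v0 != 0 -> e @ F --> (0 : R) -> v @ F --> v0 -> u @ F --> u0 ->
  reg_coef B (e x) (v x) (u x) @[x --> F] --> vert_coef B v0 u0.
Proof.
move=> g0 e0 vv uu; have dv := cvg_gram_det vv.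
apply: cvgZ; last exact: cvg_adj_coef.
have -> : (gram_det B v0)^-1 = gram_det B v0 / (gram_det B v0 ^+ 2 + 0).
  by rewrite addr0 expr2 invfM mulrA divff // mul1r.
apply: cvgM => //; apply: cvgV; first by rewrite addr0 expf_neq0.
by apply: cvgD => //; rewrite expr2; under eq_fun do rewrite expr2; exact: cvgM.
Qed.

End VerticalLimits.

(** Continuity on a compact set for fixed [e], argued by contradiction along an ultrafilter. The
    radii 1 and 2 are those of chord points and of differences of unit vectors. *)
Lemma reg_coef_bounded {R : realType} {n r : nat} (B : 'I_r -> 'M[R]_n.+1) (e : R) :
  0 < e -> exists2 C : R, 0 <= C & forall u v : 'cV[R]_n.+1, enorm v <= 1 -> enorm u <= 2 ->
    forall j, `|reg_coef B e v u j 0| <= C.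
Proof.
move=> e0; apply: contrapT => nb.
have /choice[w wP] : forall k : nat, exists w : 'cV[R]_n.+1 * 'cV[R]_n.+1,
    [/\ enorm w.2 <= 1, enorm w.1 <= 2 &
        exists j, k%:R < `|reg_coef B e w.2 w.1 j 0|].
  move=> k; apply: contrapT => nk; apply: nb; exists k%:R => // u v v1 u2 j.
  by rewrite leNgt; apply/negP => kj; apply: nk; exists (u, v); split=> //; exists j.
have [U [UU Uoo]] := free_ultrafilter.
have bnd (f : nat -> 'cV[R]_n.+1) (c : R) : (forall k, enorm (f k) <= c) ->
    exists l : 'cV[R]_n.+1, f @ U --> l.
  move=> fc; apply: (@ultra_bounded_cvg R U _ _ f c); apply: nearW => k i j.
  by rewrite (ord1 j) (le_trans (norm_entry_le _ _)).
have [v0 vv] := bnd (fun k => (w k).2) 1 (fun k => let: And3 a _ _ := wP k in a).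
have [u0 uu] := bnd (fun k => (w k).1) 2 (fun k => let: And3 _ a _ := wP k in a).
pose l := reg_coef B e v0 u0.
have lim : reg_coef B e (w k).2 (w k).1 @[k --> U] --> l by exact: cvg_reg_coef.
pose M : R := \sum_j (`|l j 0| + 1).
have coefM : \forall k \near U, forall j, `|reg_coef B e (w k).2 (w k).1 j 0| <= M.
  apply: filter_forall => j; have : `|reg_coef B e (w k).2 (w k).1 j 0| @[k --> U] --> `|l j 0|.
    by apply: cvg_norm; exact: cvg_entry.
  move/cvgrPdist_le => /(_ _ ltr01); apply: filterS => k /=.
  set x := `|reg_coef _ _ _ _ j 0| => xl; apply: (@le_trans _ _ (`|l j 0| + 1)).
    by move: xl; rewrite ler_norml => /andP[]; lra.
  by rewrite /M (bigD1 j) //= lerDl; apply: sumr_ge0 => i _; rewrite addr_ge0.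
have largeM : \forall k \near U, M <= k%:R by apply: Uoo; exact: nbhs_infty_ger.
have [k [kM Mk]] := @filter_ex _ U _ _ (filterI coefM largeM).
have [_ _ [j kj]] := wP k.
by have := lt_le_trans kj (le_trans (kM j) Mk); rewrite ltxx.
Qed.

(** * Transport along a chord *)

Section Transport.
Context {R : realType} {n r : nat} (G : set 'M[R]_n.+1) (B : 'I_r -> 'M[R]_n.+1).
Hypothesis subG : is_subgroup G.
Hypothesis orthG : G `<=` @orthogonal_mx R n.
Hypothesis LB : forall j, lie_alg G (B j).
Variable p : 'cV[R]_n.+1.
Implicit Types (w q x : 'cV[R]_n.+1) (e t : R) (K i : nat).

Definition chord w t : 'cV[R]_n.+1 := p + t *: (w - p).

Definition step_comb e K w i : 'M[R]_n.+1 :=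
  reg_comb B e (chord w (i%:R / K%:R)) (w - p).

(** Explicit Euler scheme with step [1 / K] for [g' = Y g] along the chord from [p] to [w], with the
    regularised field as [Y]. *)
Fixpoint transport e K w i : 'M[R]_n.+1 :=
  if i is j.+1 then (1%:M + K%:R^-1 *: step_comb e K w j) *m transport e K w j
  else 1%:M.

Lemma step_comb_skew e K w i : (step_comb e K w i)^T = - step_comb e K w i.
Proof. by apply: field_comb_skew => j; apply: (lie_alg_skew orthG). Qed.

Lemma dotv_step_comb e K w i (v : 'cV[R]_n.+1) : dotv v (step_comb e K w i *m v) = 0.
Proof.
have := dotv_mulmxr (step_comb e K w i) v v.
by rewrite step_comb_skew mulNmx dotvNl dotvC; lra.
Qed.

(** A step [1 + h Y] with [Y] skew changes the squared norm of [z] by [h ^+ 2] times that of [Y z].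
    So the image of [q] never vanishes and can be normalised. *)
Lemma transport_expands e K w i (v : 'cV[R]_n.+1) : enorm v <= enorm (transport e K w i *m v).
Proof.
elim: i => [|i IH] /=; first by rewrite mul1mx.
apply: le_trans IH _; rewrite -mulmxA; set z := transport _ _ _ _ *m v.
rewrite ler_enorm mulmxDl mul1mx -scalemxAl dotvDl !dotvDr !dotvZl !dotvZr.
rewrite (dotvC _ z) dotv_step_comb mulr0 addr0 add0r lerDl mulrA -expr2.
by rewrite mulr_ge0 ?dotv_ge0 ?sqr_ge0.
Qed.

Lemma cvg_chord (T : Type) (F : set_system T) {FF : Filter F} (w : T -> 'cV[R]_n.+1)
    (t : T -> R) (w0 : 'cV[R]_n.+1) (t0 : R) :
  w @ F --> w0 -> t @ F --> t0 -> chord (w x) (t x) @[x --> F] --> chord w0 t0.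
Proof.
move=> ww tt; apply: cvgD; first exact: cvg_cst.
by apply: cvgZ => //; apply: cvgB => //; exact: cvg_cst.
Qed.

Lemma cvg_transport (T : Type) (F : set_system T) {FF : Filter F} (w : T -> 'cV[R]_n.+1)
    (w0 : 'cV[R]_n.+1) e K i : 0 < e ->
  w @ F --> w0 -> transport e K (w x) i @[x --> F] --> transport e K w0 i.
Proof.
move=> e0 ww; elim: i => [|i IH] /=; first exact: cvg_cst.
apply: cvg_mulmx => //; apply: cvgD; first exact: cvg_cst.
apply: cvgZ; first exact: cvg_cst.
apply: cvg_field_comb; apply: cvg_reg_coef => //.
  by apply: cvg_chord => //; exact: cvg_cst.
by apply: cvgB => //; exact: cvg_cst.
Qed.

Lemma cvg_normalize (T : Type) (F : set_system T) {FF : Filter F}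
    (f : T -> 'cV[R]_n.+1) (a : 'cV[R]_n.+1) : a != 0 ->
  f @ F --> a -> (enorm (f x))^-1 *: f x @[x --> F] --> (enorm a)^-1 *: a.
Proof.
move=> a0 fa; apply: cvgZ => //; apply: cvgV; first by rewrite enorm_eq0.
exact: cvg_enorm.
Qed.

(** The normalisation compensates the expansion of the Euler steps, and it gives the map values in
    the cube, as Brouwer's theorem requires. *)
Lemma transport_fixed_point e K q : 0 < e -> enorm q = 1 ->
  exists2 x, enorm x = 1 &
    x = (enorm (transport e K x K *m q))^-1 *: (transport e K x K *m q).
Proof.
move=> e0 q1.
pose f w := (enorm (transport e K w K *m q))^-1 *: (transport e K w K *m q).
have fpos w : 0 < enorm (transport e K w K *m q).
  by apply: lt_le_trans (transport_expands _ _ _ _ _); rewrite q1.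
have f1 w : enorm (f w) = 1.
  by rewrite /f enormZ ger0_norm ?invr_ge0 ?enorm_ge0 // mulVf // gt_eqF.
have [|w i|x xE] := @brouwer_fixed_point R n.+1 f.
- move=> w; have lim : transport e K z K *m q @[z --> w] --> transport e K w K *m q.
    apply: (@cvg_mulmx _ _ (nbhs w) _ _ _ _ (fun z => transport e K z K) (fun=> q)).
      by apply: (@cvg_transport _ (nbhs w) _ id w e K K e0); exact: cvg_id.
    exact: cvg_cst.
  by apply: (@cvg_normalize _ (nbhs w) _ (fun z => transport e K z K *m q));
    rewrite // -enorm_eq0 gt_eqF.
- by apply: le_trans (norm_entry_le _ _) _; rewrite f1.
- by exists x => //; rewrite -xE f1.
Qed.

Lemma enorm_chord_le x t : enorm p = 1 -> enorm x = 1 -> 0 <= t <= 1 -> enorm (chord x t) <= 1.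
Proof.
move=> p1 x1 /andP[t0 t1]; have -> : chord x t = (1 - t) *: p + t *: x.
  by rewrite /chord scalerBr scalerBl scale1r addrCA addrC.
rewrite (le_trans (enormD _ _)) // !enormZ p1 x1 !mulr1 !ger0_norm //; lra.
Qed.

Lemma enorm_sub_le2 x : enorm p = 1 -> enorm x = 1 -> enorm (x - p) <= 2.
Proof. by move=> p1 x1; rewrite (le_trans (enormD _ _)) // enormN p1 x1. Qed.

Lemma field_comb_opbound (C : R) : 0 <= C -> exists2 b, 0 <= b &
  forall a : 'cV[R]_r, (forall j, `|a j 0| <= C) -> opbound (field_comb B a) b.
Proof.
move=> C0; exists (n.+1%:R ^+ 2 * \sum_j (C * `|B j|)).
  by rewrite mulr_ge0 ?exprn_ge0 // sumr_ge0 // => j _; rewrite mulr_ge0.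
move=> a aC; apply: opbound_of_entries => i j; rewrite summxE.
apply: le_trans (ler_norm_sum _ _ _) _; apply: ler_sum => k _.
by rewrite mxE normrM ler_pM // norm_entry_le_mx_norm.
Qed.

Lemma approx_transport q e (eta : R) : enorm p = 1 -> enorm q = 1 -> 0 < e ->
    0 < eta <= 1 -> exists K x,
  [/\ [/\ (0 < K)%N, K%:R^-1 <= eta & enorm x = 1],
      x = (enorm (transport e K x K *m q))^-1 *: (transport e K x K *m q),
      forall i, (i <= K)%N -> exists2 a, G a & opbound (transport e K x i - a) eta &
      forall i, (i < K)%N -> opbound (step_comb e K x i) (eta * K%:R)].
Proof.
move=> p1 q1 e0 /andP[eta0 eta1].
have [C C0 CB] := reg_coef_bounded B e0.
have [b b0 bB] := field_comb_opbound C0.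
have eta2 : 0 < eta / 2 by rewrite divr_gt0.
have [d d0 dP] := near_grp subG orthG (index_enum 'I_r) C LB eta2.
(* The three summands make the step [1 / K] smaller than the radius [d] of [near_grp], at most
   [eta], and the field at most [eta * K]. All of them depend on [e], which is fixed before [K]. *)
pose M := d^-1 + eta^-1 + b / eta.
have [K MK] : exists K : nat, M <= K%:R.
  exists (Num.truncn M).+1; apply: ltW; exact: truncnS_gt.
have dM : d^-1 < M by rewrite /M -addrA ltrDl ltr_wpDr ?divr_ge0 ?invr_gt0 // ltW.
have etaM : eta^-1 <= M.
  by rewrite /M addrAC lerDr addr_ge0 ?divr_ge0 ?invr_ge0 // ltW.
have bM : b / eta <= M by rewrite /M lerDr addr_ge0 ?invr_ge0 // ltW.
have K0 : 0 < K%:R :> R by apply: lt_le_trans MK; apply: lt_trans dM; rewrite invr_gt0.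
have [x x1 xE] := transport_fixed_point K e0 q1; exists K, x.
have small i : (i < K)%N -> forall j, `|reg_coef B e (chord x (i%:R / K%:R)) (x - p) j 0| <= C.
  move=> iK; apply: CB; last exact: enorm_sub_le2.
  apply: enorm_chord_le => //; rewrite divr_ge0 ?ler0n //= ler_pdivrMr // mul1r.
  by rewrite ler_nat ltnW.
have Kd : 0 < (K%:R^-1 : R) < d.
  by rewrite invr_gt0 K0 /= invf_plt ?posrE // (lt_le_trans dM).
(* The distance to [G] grows linearly: each step adds [eta / 2 / K] from [near_grp], multiplied by
   the bound 2 of the transport. *)
have claim i : (i <= K)%N -> exists2 a, G a &
    opbound (transport e K x i - a) (eta * (i%:R / K%:R)).
  elim: i => [_|i IH iK].
    exists 1%:M; first exact: grp1.
    by rewrite subrr mul0r mulr0; exact: opbound0.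
  have [a Ga aP] := IH (ltnW iK).
  have [g Gg gP] := dP K%:R^-1 (fun j => reg_coef B e (chord x (i%:R / K%:R)) (x - p) j 0) Kd (small i iK).
  exists (g *m a); first exact: grpM.
  set P := transport e K x i in aP *; set S := 1%:M + _ in gP.
  have -> : transport e K x i.+1 - g *m a = g *m (P - a) - (g - S) *m P.
    by rewrite /= -/P mulmxBr mulmxBl opprB [RHS]addrC addrA subrK.
  have iK1 : i%:R / K%:R <= 1 :> R by rewrite ler_pdivrMr // mul1r ler_nat ltnW.
  have PB : opbound P 2.
    have := opboundD aP (opbound_isometry (grp_trK orthG Ga)); rewrite subrK.
    apply: opboundW; have := ler_wpM2l (ltW eta0) iK1; lra.
  have N1 : opbound (- ((g - S) *m P)) (eta / 2 / K%:R * 2).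
    move=> v; rewrite mulNmx enormN; apply: opboundM => //.
    by rewrite divr_ge0 // ltW.
  apply: opboundW (opboundD (opboundM ler01 (opbound_isometry (grp_trK orthG Gg)) aP) N1).
  have -> : i.+1%:R = i%:R + 1 :> R by rewrite natr1.
  by rewrite le_eqVlt; apply/orP; left; apply/eqP; field; rewrite gt_eqF.
split=> //.
- split=> //; first by rewrite -(ltr_nat R).
  by rewrite invf_ple ?posrE // (le_trans etaM).
- move=> i iK; have [a Ga aP] := claim i iK; exists a => //; apply: opboundW aP.
  rewrite ler_piMr ?(ltW eta0) // ler_pdivrMr // mul1r ler_nat //.
- move=> i iK; apply: opboundW (bB _ (small i iK)).
  by rewrite mulrC -ler_pdivrMr // (le_trans bM).
Qed.

End Transport.

Lemma opbound_tr {R : realType} {n : nat} (A : 'M[R]_n.+1) (a : R) : opbound A a -> opbound A^T a.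
Proof.
move=> Aa v; have [w0|w0] := eqVneq (enorm (A^T *m v)) 0.
  have a0 : 0 <= a by apply: le_trans (normr_ge0 _) (opbound_entry 0 0 Aa).
  by rewrite w0 mulr_ge0 ?enorm_ge0.
have wpos : 0 < enorm (A^T *m v) by rewrite lt_neqAle eq_sym w0 enorm_ge0.
rewrite -(ler_pM2r wpos) -expr2 sqr_enorm dotv_mulmxl trmxK.
apply: (le_trans (dotv_le_enorm _ _)).
by rewrite [a * _]mulrC -mulrA ler_wpM2l ?enorm_ge0.
Qed.

(** * Increments of the discrete transport and of its curve *)

Section DiscreteTransport.
Context {R : realType} {n r : nat} (G : set 'M[R]_n.+1) (B : 'I_r -> 'M[R]_n.+1).
Hypothesis orthG : G `<=` @orthogonal_mx R n.
Hypothesis LB : forall j, lie_alg G (B j).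
Variables (p x : 'cV[R]_n.+1) (e : R) (K : nat).
Hypothesis K0 : (0 < K)%N.
Let g := transport B p e K x.
Let Y := step_comb B p e K x.
Let s i := chord p x (i%:R / K%:R).

Definition position i : 'cV[R]_n.+1 := (g i)^T *m s i.

Lemma transport_increment (m : R) i j : (i <= j)%N -> 0 <= m ->
  (forall l, (i <= l < j)%N -> opbound (Y l) m) ->
  (forall l, (i <= l < j)%N -> opbound (g l) 2) ->
  opbound (g j - g i) (2 * m * ((j - i)%:R / K%:R)).
Proof.
move=> ij m0 Ym g2; rewrite -(subnKC ij); move: (leqnn (j - i)).
elim: {1 3 4}(j - i)%N => [_|k IH kj].
  by rewrite addn0 subrr subnn mul0r mulr0; exact: opbound0.
rewrite addnS; have -> : g (i + k).+1 - g i = (g (i + k)%N - g i) + K%:R^-1 *: (Y (i + k)%N *m g (i + k)%N).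
  by rewrite /g /= mulmxDl mul1mx -scalemxAl addrAC.
have lb : (i <= i + k < j)%N by lia.
apply: opboundW (opboundD (IH (ltnW kj)) (opboundZ _ (opboundM m0 (Ym _ lb) (g2 _ lb)))).
rewrite ger0_norm ?invr_ge0 // -addnS !addKn -natr1.
by rewrite le_eqVlt; apply/orP; left; apply/eqP; ring.
Qed.

(** Discrete product rule. As [Y] is skew, transposing a step reverses the sign of [Y], so the main
    term is the chord velocity minus its approximate vertical part; the second term is of order
    [K ^- 2]. *)
Lemma position_step l : position l.+1 - position l =
  (g l)^T *m (K%:R^-1 *: ((x - p - Y l *m s l) - K%:R^-1 *: (Y l *m (x - p)))).
Proof.
have sS : s l.+1 = s l + K%:R^-1 *: (x - p).
  by rewrite /s /chord -natr1 mulrDl mul1r scalerDl addrA.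
have YT : (1%:M + K%:R^-1 *: Y l)^T = 1%:M - K%:R^-1 *: Y l.
  by rewrite linearD /= linearZ /= trmx1 (step_comb_skew orthG LB) scalerN.
have gS : (g l.+1)^T = (g l)^T *m (1%:M - K%:R^-1 *: Y l) by rewrite -YT -trmx_mul.
rewrite /position gS -mulmxA -mulmxBr; congr (_ *m _).
move: sS; move: (x - p) (s l) (s l.+1) => u a _ ->.
rewrite mulmxBl mul1mx -scalemxAl mulmxDr -scalemxAr scalerDr !scalerBr.
move: (K%:R^-1 *: u) (K%:R^-1 *: (Y l *m a)) (K%:R^-1 *: _) => b c d.
by apply/matrixP => i j; rewrite !mxE; ring.
Qed.

(** Used with [V = 0] for the Lipschitz bound and with the expected velocity for differentiability.
    The factor 4 is the bound 2 of the transport times the bound 2 of [x - p]. *)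
Lemma position_increment (V : 'cV[R]_n.+1) (z m : R) i j : (i <= j)%N -> 0 <= m ->
  (forall l, (i <= l < j)%N -> enorm ((g l)^T *m (x - p - Y l *m s l) - V) <= z) ->
  (forall l, (i <= l < j)%N -> opbound (Y l) (m * K%:R)) ->
  (forall l, (i <= l < j)%N -> opbound (g l) 2) -> enorm (x - p) <= 2 ->
  enorm (position j - position i - ((j - i)%:R / K%:R) *: V) <= (j - i)%:R / K%:R * (z + 4 * m).
Proof.
move=> ij m0 Vz Ym g2 u2; rewrite -(subnKC ij); move: (leqnn (j - i)).
have K0' : 0 < K%:R :> R by rewrite ltr0n.
elim: {1 3 4 5}(j - i)%N => [_|k IH kj].
  by rewrite addn0 subrr subnn !mul0r scale0r subr0 enorm0.
have lb : (i <= i + k < j)%N by lia.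
rewrite addnS -addnS !addKn addnS in IH *.
have -> : position (i + k).+1 - position i - (k.+1%:R / K%:R) *: V =
   (position (i + k) - position i - (k%:R / K%:R) *: V) +
   K%:R^-1 *: (((g (i + k))^T *m (x - p - Y (i + k)%N *m s (i + k)%N) - V) -
               (g (i + k))^T *m (K%:R^-1 *: (Y (i + k)%N *m (x - p)))).
  rewrite -natr1 mulrDl mul1r scalerDl.
  rewrite -[position (i + k).+1](subrK (position (i + k))) position_step.
  rewrite -scalemxAr mulmxBr.
  move: (position _) (position _) ((g _)^T *m _) ((g _)^T *m _) => P Q a b.
  by apply/matrixP => i' j'; rewrite !mxE; ring.
have K1 : 0 <= K%:R^-1 :> R by rewrite invr_ge0.
have last : enorm ((g (i + k))^T *m (K%:R^-1 *: (Y (i + k)%N *m (x - p)))) <= 4 * m.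
  apply: le_trans (opbound_tr (g2 _ lb) _) _.
  rewrite enormZ ger0_norm //.
  have := Ym _ lb (x - p) => h.
  have := ler_wpM2l K1 h.
  have -> : K%:R^-1 * (m * K%:R * enorm (x - p)) = m * enorm (x - p).
    by field; rewrite gt_eqF.
  have := ler_wpM2l m0 u2; set A := K%:R^-1 * enorm _; set D := m * _; lra.
rewrite (le_trans (enormD _ _)) //.
have := IH (ltnW kj); set I := enorm _ => h1.
have h2 : enorm (K%:R^-1 *: (((g (i + k))^T *m (x - p - Y (i + k)%N *m s (i + k)%N) - V) -
      (g (i + k))^T *m (K%:R^-1 *: (Y (i + k)%N *m (x - p))))) <= K%:R^-1 * (z + 4 * m).
  rewrite enormZ ger0_norm // ler_wpM2l // (le_trans (enormD _ _)) // enormN.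
  by rewrite lerD // Vz.
apply: le_trans (lerD h1 h2) _.
by rewrite -natr1 le_eqVlt; apply/orP; left; apply/eqP; ring.
Qed.

End DiscreteTransport.

(** * Ultrafilter limit of the discrete transports *)

Section TransportLimit.
Context {R : realType} {n r : nat} (G : set 'M[R]_n.+1) (B : 'I_r -> 'M[R]_n.+1).
Hypothesis subG : is_subgroup G.
Hypothesis orthG : G `<=` @orthogonal_mx R n.
Hypothesis closedG : closed G.
Hypothesis LB : forall j, lie_alg G (B j).
Variables (p q : 'cV[R]_n.+1).
Hypotheses (p1 : enorm p = 1) (q1 : enorm q = 1).

(** The last clause is strict differentiability, comparing two points near [t0]; continuity of the
    velocity is deduced from this form in [continuous_reparam]. *)
Lemma transport_limit : exists (x : 'cV[R]_n.+1) (c : R -> 'cV[R]_n.+1) (g : R -> 'M[R]_n.+1),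
  [/\ [/\ enorm x = 1, exists2 a, G a & x = a *m q, c 0 = p & c 1 = q],
      forall t, 0 <= t <= 1 -> G (g t) /\ c t = (g t)^T *m chord p x t,
      forall s t, 0 <= s <= 1 -> 0 <= t <= 1 -> enorm (c t - c s) <= 8 * `|t - s| &
      forall t0, 0 <= t0 <= 1 -> gram_det B (chord p x t0) != 0 ->
        forall z : R, 0 < z -> exists2 d : R, 0 < d &
        forall s t, 0 <= s <= 1 -> 0 <= t <= 1 -> `|s - t0| < d -> `|t - t0| < d ->
          enorm (c t - c s - (t - s) *: ((g t0)^T *m
            (x - p - vert_comb B (chord p x t0) (x - p) *m chord p x t0))) <= z * `|t - s|].
Proof.
pose eta (k : nat) : R := k.+1%:R^-1.
have eta0 k : 0 < eta k by rewrite invr_gt0.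
have eta1 k : eta k <= 1 by rewrite invf_ple ?posrE // invr1 ler1n.
have /choice[Kx KxP] : forall k, exists Kx : nat * 'cV[R]_n.+1,
  [/\ [/\ (0 < Kx.1)%N, Kx.1%:R^-1 <= eta k & enorm Kx.2 = 1],
      Kx.2 = (enorm (transport B p (eta k) Kx.1 Kx.2 Kx.1 *m q))^-1 *:
        (transport B p (eta k) Kx.1 Kx.2 Kx.1 *m q),
      forall i, (i <= Kx.1)%N -> exists2 a, G a &
        opbound (transport B p (eta k) Kx.1 Kx.2 i - a) (eta k) &
      forall i, (i < Kx.1)%N ->
        opbound (step_comb B p (eta k) Kx.1 Kx.2 i) (eta k * Kx.1%:R)].
  move=> k; have h : 0 < eta k <= 1 by rewrite eta0 eta1.
  by have [K [x H]] := approx_transport subG orthG LB p1 q1 (eta0 k) h; exists (K, x).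
pose K k := (Kx k).1; pose xs k := (Kx k).2.
pose gs k i := transport B p (eta k) (K k) (xs k) i.
pose Ys k i := step_comb B p (eta k) (K k) (xs k) i.
pose ss k i := chord p (xs k) (i%:R / (K k)%:R).
pose cs k i := position B p (xs k) (eta k) (K k) i.
have K0 k : (0 < K k)%N by have [[]] := KxP k.
have K0' k : 0 < (K k)%:R :> R by rewrite ltr0n.
have Keta k : (K k)%:R^-1 <= eta k by have [[]] := KxP k.
have xs1 k : enorm (xs k) = 1 by have [[]] := KxP k.
have xsE k : xs k = (enorm (gs k (K k) *m q))^-1 *: (gs k (K k) *m q) by have [] := KxP k.
have gsG k i : (i <= K k)%N -> exists2 a, G a & opbound (gs k i - a) (eta k).
  by have [_ _ h _] := KxP k; exact: h.
have YsB k i : (i < K k)%N -> opbound (Ys k i) (eta k * (K k)%:R).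
  by have [_ _ _ h] := KxP k; exact: h.
have gs2 k i : (i <= K k)%N -> opbound (gs k i) 2.
  move=> /gsG[a Ga aP]; have := opboundD aP (opbound_isometry (grp_trK orthG Ga)).
  by rewrite subrK; apply: opboundW; have := eta1 k; lra.
have us2 k : enorm (xs k - p) <= 2 by exact: enorm_sub_le2.
have [U [UU Uoo]] := free_ultrafilter.
have FU : ProperFilter U by exact: ultra_proper.
have etaU : eta @ U --> (0 : R).
  by apply: cvg_trans (@cvg_harmonic R); apply: cvg_fmap2.
pose idx k (t : R) := Num.truncn (t * (K k)%:R).
have posK k (t : R) : 0 <= t -> 0 <= t * (K k)%:R by move=> t0; rewrite mulr_ge0.
have idxK k (t : R) : 0 <= t <= 1 -> (idx k t <= K k)%N.
  move=> /andP[t0 t1]; rewrite -(ler_nat R).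
  by apply: (@le_trans _ _ (t * (K k)%:R)); rewrite ?truncn_le ?posK // ler_piMl.
have idxt k (t : R) : 0 <= t <= 1 -> t - eta k <= (idx k t)%:R / (K k)%:R <= t.
  move=> /andP[t0 t1]; have /andP[a b] := truncn_itv (posK k t t0); apply/andP; split.
    apply: (@le_trans _ _ (t - (K k)%:R^-1)); first by rewrite lerB.
    by rewrite lerBlDr -[X in _ + X]mul1r -mulrDl ler_pdivlMr // natr1 ltW.
  by rewrite ler_pdivrMr.
have idxU (t : R) : 0 <= t <= 1 -> (idx k t)%:R / (K k)%:R @[k --> U] --> t.
  move=> t01; apply/cvgrPdist_le => z z0.
  have /cvgrPdist_le/(_ z z0) := etaU; apply: filterS => k; rewrite sub0r normrN.
  move=> ez; have /andP[a b] := idxt k t t01.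
  by apply: le_trans (le_trans (ler_norm (eta k)) ez); rewrite ger0_norm; lra.
have idx_le k (s t : R) : s <= t -> (idx k s <= idx k t)%N.
  by move=> st; apply: le_truncn; rewrite ler_wpM2r.
have [x xsU] : exists x : 'cV[R]_n.+1, xs @ U --> x.
  apply: (@ultra_bounded_cvg R U _ _ xs 1); apply: nearW => k i j.
  by rewrite (ord1 j) (le_trans (norm_entry_le _ _)) ?xs1.
have /choice[g gP] : forall t : R, exists l : 'M[R]_n.+1, 0 <= t <= 1 ->
    gs k (idx k t) @[k --> U] --> l.
  move=> t; have [t01|t01] := boolP (0 <= t <= 1); last by exists 0.
  have [|l lP] := @ultra_bounded_cvg R U _ _ (fun k => gs k (idx k t)) 2; last by exists l.
  by apply: nearW => k i j; apply: opbound_entry; apply: gs2; exact: idxK.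
have x1 : enorm x = 1.
  apply: (@cvg_limit_unique R R^o _ U _ (fun k => enorm (xs k))); first exact: cvg_enorm.
  by under eq_fun do rewrite xs1; exact: cvg_cst.
have Gg t : 0 <= t <= 1 -> G (g t).
  (* The transports are only within [eta k] of [G], so closedness is applied to nearby elements
     [a k] having the same limit. *)
  move=> t01; have /choice[a aP] : forall k, exists a, G a /\ opbound (gs k (idx k t) - a) (eta k).
    by move=> k; have [a] := gsG k _ (idxK k t t01); exists a.
  apply: (@closed_cvg _ _ U _ a G closedG _ (g t)); first by apply: nearW => k; have [] := aP k.
  have diff : (gs k (idx k t) - a k) @[k --> U] --> (0 : 'M[R]_n.+1).
    apply: cvg_mx => i j; rewrite mxE; apply/norm_cvg0P.
    apply: (squeeze_cvgr _ (cvg_cst 0) etaU); apply: nearW => k.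
    by rewrite normr_ge0; apply: opbound_entry; have [] := aP k.
  have -> : a = (fun k => gs k (idx k t) - (gs k (idx k t) - a k)).
    by apply/funext => k; rewrite subKr.
  by rewrite -[g t]subr0; apply: cvgB => //; exact: gP.
have g0 : g 0 = 1%:M.
  have t01 : 0 <= (0 : R) <= 1 by rewrite lexx ler01.
  apply: (@cvg_limit_unique R _ _ U _ _ _ _ (gP 0 t01)).
  by under eq_fun do rewrite /idx mul0r truncn0; exact: cvg_cst.
have t11 : 0 <= (1 : R) <= 1 by rewrite lexx ler01.
have g1 : gs k (K k) @[k --> U] --> g 1.
  have <- : (fun k => gs k (idx k 1)) = (fun k => gs k (K k)).
    by apply/funext => k; rewrite /idx mul1r natrK.
  exact: gP.
have xg : x = g 1 *m q.
  have gq : gs k (K k) *m q @[k --> U] --> g 1 *m q by apply: cvg_mulmx => //; exact: cvg_cst.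
  have gq1 : enorm (g 1 *m q) = 1 by rewrite /enorm (dotv_grp orthG) -/(enorm q) //; exact: Gg.
  apply: (cvg_limit_unique xsU).
  have -> : xs = (fun k => (enorm (gs k (K k) *m q))^-1 *: (gs k (K k) *m q)).
    by apply/funext => k; exact: xsE.
  have gq0 : g 1 *m q != 0 by rewrite -enorm_eq0 gq1 oner_eq0.
  by have := cvg_normalize gq0 gq; rewrite gq1 invr1 scale1r; apply.
pose c t := (g t)^T *m chord p x t.
have cU t : 0 <= t <= 1 -> cs k (idx k t) @[k --> U] --> c t.
  move=> t01; apply: cvg_mulmx; first by apply: cvg_trmx; exact: gP.
  by apply: cvg_chord => //; exact: idxU.
have didxU s t : 0 <= s <= 1 -> 0 <= t <= 1 -> s <= t ->
    ((idx k t - idx k s)%:R / (K k)%:R : R) @[k --> U] --> t - s.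
  move=> s01 t01 st; have -> : (fun k => (idx k t - idx k s)%:R / (K k)%:R : R) =
      (fun k => (idx k t)%:R / (K k)%:R - (idx k s)%:R / (K k)%:R).
    by apply/funext => k; rewrite natrB ?idx_le // mulrBl.
  by apply: cvgB; exact: idxU.
exists x, c, g; split.
- split=> //; first by exists (g 1) => //; exact: Gg.
    by rewrite /c g0 trmx1 mul1mx /chord scale0r addr0.
  by rewrite /c /chord scale1r addrCA subrr addr0 xg mulmxA (grp_trK orthG) ?mul1mx //; exact: Gg.
- by move=> t t01; split=> //; exact: Gg.
(* The constant 8 is [4 + 4]: transport bound 2 times velocity bound 2, plus the second-order term
   [4 * eta k] with [eta k <= 1]. *)
- have lip s t : 0 <= s <= 1 -> 0 <= t <= 1 -> s <= t -> enorm (c t - c s) <= 8 * (t - s).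
    move=> s01 t01 st.
    have l1 : enorm (cs k (idx k t) - cs k (idx k s)) @[k --> U] --> enorm (c t - c s).
      by apply: cvg_enorm; apply: cvgB; exact: cU.
    have l2 : 8 * ((idx k t - idx k s)%:R / (K k)%:R) @[k --> U] --> 8 * (t - s).
      by apply: cvgM; [exact: cvg_cst|exact: didxU].
    apply: (ler_cvg_to l1 l2); apply: nearW => k.
    have b : forall l, (idx k s <= l < idx k t)%N -> (l < K k)%N.
      by move=> l /andP[_ lt]; apply: leq_trans lt (idxK k t t01).
    have := @position_increment R n r G B orthG LB p (xs k) (eta k) (K k) (K0 k) 0 4 (eta k)
      (idx k s) (idx k t) (idx_le k s t st) (ltW (eta0 k)).
    rewrite scaler0 subr0 => h; apply: le_trans (h _ _ _ (us2 k)) _.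
    + move=> l /b lK; rewrite subr0.
      apply: le_trans (opbound_tr (gs2 k l (ltnW lK)) _) _.
      have h1 : enorm (xs k - p - Ys k l *m ss k l) <= enorm (xs k - p).
        exact: reg_comb_contraction (eta0 k).
      by have := le_trans h1 (us2 k); rewrite -/(ss k l) -/(Ys k l); lra.
    + by move=> l /b lK; exact: YsB.
    + by move=> l /b lK; exact: gs2 (ltnW lK).
    + rewrite mulrC ler_wpM2r ?divr_ge0 //; have := eta1 k; lra.
  move=> s t s01 t01; have [st|ts] := leP s t.
    by rewrite ger0_norm ?subr_ge0 // lip.
  by rewrite enormB ltr0_norm ?subr_lt0 // opprB lip // ltW.
move=> t0 t01 gd0 z z0.
pose u0 := x - p; pose s0 := chord p x t0; pose Y0 := vert_comb B s0 u0.
pose P0 := u0 - Y0 *m s0; pose V := (g t0)^T *m P0; pose M0 := enorm P0.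
have M00 : 0 <= M0 by exact: enorm_ge0.
(* A joint limit in the index and the time: the estimates then hold on one neighbourhood of [t0] for
   [U]-almost all indices. *)
pose FP := filter_prod U (nbhs t0).
have FFP : Filter FP by exact: filter_prod_filter.
have fstU (T : topologicalType) (f : nat -> T) (l : T) : f @ U --> l ->
    f y.1 @[y --> FP] --> l.
  by move=> fl; apply: cvg_comp fl; exact: cvg_fst.
have lim_u : (xs y.1 - p) @[y --> FP] --> u0.
  by apply: cvgB; [exact: fstU|exact: cvg_cst].
have lim_s : chord p (xs y.1) y.2 @[y --> FP] --> s0.
  by apply: cvg_chord; [exact: fstU|exact: cvg_snd].
have lim_Y : reg_comb B (eta y.1) (chord p (xs y.1) y.2) (xs y.1 - p) @[y --> FP] --> Y0.
  apply: cvg_field_comb; apply: cvg_reg_coef0 => //.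
  exact: (fstU R^o).
have lim_P : (xs y.1 - p - reg_comb B (eta y.1) (chord p (xs y.1) y.2) (xs y.1 - p)
    *m chord p (xs y.1) y.2) @[y --> FP] --> P0.
  by apply: cvgB => //; exact: cvg_mulmx.
pose m : R := n.+1%:R ^+ 2 * (`|Y0| + 1).
have m0 : 0 <= m by rewrite mulr_ge0 ?exprn_ge0 ?addr_ge0.
have nearP : \forall y \near FP, enorm (xs y.1 - p - reg_comb B (eta y.1)
    (chord p (xs y.1) y.2) (xs y.1 - p) *m chord p (xs y.1) y.2 - P0) <= z / 8.
  have : enorm (xs y.1 - p - reg_comb B (eta y.1)
    (chord p (xs y.1) y.2) (xs y.1 - p) *m chord p (xs y.1) y.2 - P0) @[y --> FP] --> (0 : R).
    rewrite -(@enorm0 R n) -(subrr P0); apply: cvg_enorm; apply: cvgB => //; exact: cvg_cst.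
  move=> /cvgrPdist_le/(_ (z / 8)); rewrite divr_gt0 // => /(_ isT).
  by apply: filterS => y; rewrite sub0r normrN ger0_norm // enorm_ge0.
have nearY : \forall y \near FP, opbound (reg_comb B (eta y.1)
    (chord p (xs y.1) y.2) (xs y.1 - p)) m.
  move/cvgrPdist_le: lim_Y => /(_ 1 ltr01); apply: filterS => y Yy.
  apply: opbound_of_entries => i j; set W := reg_comb _ _ _ _ in Yy *.
  rewrite -(subrK (Y0 i j) (W i j)) (le_trans (ler_normD _ _)) // addrC lerD //.
    exact: norm_entry_le_mx_norm.
  apply: le_trans Yy; rewrite distrC; apply: le_trans (norm_entry_le_mx_norm (Y0 - W) i j).
  by rewrite !mxE.
have [[Q D] /= [UQ Dt0] QD] : FP [set y |
    enorm (xs y.1 - p - reg_comb B (eta y.1)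
    (chord p (xs y.1) y.2) (xs y.1 - p) *m chord p (xs y.1) y.2 - P0) <= z / 8 /\
    opbound (reg_comb B (eta y.1) (chord p (xs y.1) y.2) (xs y.1 - p)) m].
  exact: filterI nearP nearY.
have [d1 d10 Dd1] : exists2 d1 : R, 0 < d1 & forall t : R, `|t - t0| < d1 -> D t.
  move/nbhs_ballP: Dt0 => [d1 /= d10 h]; exists d1 => // t td; apply: h.
  by rewrite /ball /= distrC.
(* Within [rho] of [t0] the variation of the transport changes the velocity by at most [z / 8]. The
   bound [z / 2] of [key] is [2 * (z / 8)] from [nearP], [z / 8] from this variation and [z / 8]
   from [g_near]; the other [z / 2] absorbs [4 * eta k]. *)
pose rho := Num.min (d1 / 4) (z / (32 * ((m + 1) * (M0 + 1)))).
have mM : 0 < (m + 1) * (M0 + 1) by rewrite mulr_gt0 // ltr_wpDl.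
have rho0 : 0 < rho by rewrite lt_min !divr_gt0 // mulr_gt0.
have rhod : rho <= d1 / 4 by rewrite ge_min lexx.
have rhoz : rho * ((m + 1) * (M0 + 1)) <= z / 32.
  rewrite -ler_pdivlMr //; rewrite ge_min orbC (_ : z / 32 / _ = z / (32 * ((m + 1) * (M0 + 1)))) ?lexx //.
  by field; rewrite !gt_eqF // ltr_wpDl.
have eta_rho : \forall k \near U, eta k <= rho / 4.
  move/cvgrPdist_le: etaU => /(_ (rho / 4)); rewrite divr_gt0 // => /(_ isT).
  by apply: filterS => k; rewrite sub0r normrN ger0_norm // ltW.
have eta_z : \forall k \near U, eta k <= z / 8.
  move/cvgrPdist_le: etaU => /(_ (z / 8)); rewrite divr_gt0 // => /(_ isT).
  by apply: filterS => k; rewrite sub0r normrN ger0_norm // ltW.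
have g_near : \forall k \near U, opbound (gs k (idx k t0) - g t0) (z / (8 * (M0 + 1))).
  pose w := z / (8 * (M0 + 1)) / n.+1%:R ^+ 2.
  have w0 : 0 < w by rewrite !divr_gt0 // ?mulr_gt0 ?exprn_gt0 // ltr_wpDl.
  move/cvgrPdist_le: (gP t0 t01) => /(_ w w0); apply: filterS => k gk.
  apply: (@opboundW _ _ _ (n.+1%:R ^+ 2 * w)).
    by rewrite /w mulrC divfK // expf_neq0 // pnatr_eq0.
  apply: opbound_of_entries => i j; apply: le_trans gk; rewrite distrC.
  exact: norm_entry_le_mx_norm.
have key : \forall k \near U, forall l, (l < K k)%N -> `|l%:R / (K k)%:R - t0| <= rho ->
    enorm ((gs k l)^T *m (xs k - p - Ys k l *m ss k l) - V) <= z / 2.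
  apply: filterS (filterI UQ (filterI eta_rho g_near)) => k [Qk [ek gk]] l lK lt0.
  have local l' : `|l'%:R / (K k)%:R - t0| < d1 ->
      enorm (xs k - p - Ys k l' *m ss k l' - P0) <= z / 8 /\ opbound (Ys k l') m.
    by move=> lt1; apply: (QD (k, l'%:R / (K k)%:R)); split=> //; exact: Dd1.
  have rho_d1 : rho < d1 by move: rhod d10; lra.
  have incr i j : (i <= j <= K k)%N -> `|i%:R / (K k)%:R - t0| <= rho ->
      `|j%:R / (K k)%:R - t0| <= rho -> opbound (gs k j - gs k i) (4 * m * rho).
    move=> /andP[ij jK]; rewrite !ler_norml => /andP[i1 i2] /andP[j1 j2].
    have bnd l' : (i <= l' < j)%N -> opbound (Ys k l') m /\ opbound (gs k l') 2.
      move=> /andP[il lj]; split; last by apply: gs2; apply: leq_trans (ltnW lj) jK.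
      have [] // := local l'; apply: le_lt_trans rho_d1; rewrite ler_norml.
      have h1 : i%:R / (K k)%:R <= l'%:R / (K k)%:R :> R by rewrite ler_wpM2r // ler_nat.
      have h2 : l'%:R / (K k)%:R <= j%:R / (K k)%:R :> R by rewrite ler_wpM2r // ler_nat ltnW.
      by apply/andP; split; lra.
    have inc := @transport_increment R n r B p (xs k) (eta k) (K k) (K0 k) m i j ij m0
      (fun l' h => (bnd l' h).1) (fun l' h => (bnd l' h).2).
    apply: (opboundW _ inc).
    have jiK : j%:R / (K k)%:R - i%:R / (K k)%:R <= 2 * rho by lra.
    rewrite natrB // mulrBl; apply: le_trans (ler_wpM2l (mulr_ge0 (ler0n _ 2) m0) jiK) _.
    by have -> : 2 * m * (2 * rho) = 4 * m * rho by ring.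
  have i0t : `|(idx k t0)%:R / (K k)%:R - t0| <= rho.
    have /andP[a b] := idxt k t0 t01; rewrite ler_norml; apply/andP; split; lra.
  have dg : opbound (gs k l - g t0) (4 * m * rho + z / (8 * (M0 + 1))).
    rewrite -(subrK (gs k (idx k t0)) (gs k l)) -addrA.
    apply: opboundD => //; have [li|il] := leqP l (idx k t0).
      have h : opbound (gs k (idx k t0) - gs k l) (4 * m * rho).
        by apply: incr => //; rewrite li idxK.
      by move=> v; rewrite -opprB mulNmx enormN.
    by apply: incr => //; rewrite ltnW //= ltnW.
  have [lP _] : enorm (xs k - p - Ys k l *m ss k l - P0) <= z / 8 /\ opbound (Ys k l) m.
    by apply: local; exact: le_lt_trans lt0 rho_d1.
  have -> : (gs k l)^T *m (xs k - p - Ys k l *m ss k l) - V =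
      (gs k l)^T *m (xs k - p - Ys k l *m ss k l - P0) + (gs k l - g t0)^T *m P0.
    have trB : (gs k l - g t0)^T = (gs k l)^T - (g t0)^T by rewrite linearB.
    rewrite trB; move: (xs k - p - _) => X.
    by rewrite mulmxBr mulmxBl addrA subrK.
  rewrite (le_trans (enormD _ _)) //.
  have h1 := le_trans (opbound_tr (gs2 k l (ltnW lK)) _) (ler_wpM2l (ler0n _ 2) lP).
  have h2 := opbound_tr dg P0.
  apply: le_trans (lerD h1 h2) _; rewrite -/M0.
  have h3 : 4 * m * rho * M0 <= z / 8.
    have := ler_wpM2l (ler0n R 4) rhoz; have : 4 * m * rho * M0 <= 4 * (rho * ((m + 1) * (M0 + 1))).
      rewrite -subr_ge0 (_ : _ - _ = 4 * (rho * (m + M0 + 1))); last by ring.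
      by rewrite !mulr_ge0 // ?(ltW rho0) // addr_ge0 // addr_ge0.
    by lra.
  have h4 : z / (8 * (M0 + 1)) * M0 <= z / 8.
    rewrite -subr_ge0 (_ : _ - _ = z / (8 * (M0 + 1))); last by field; rewrite gt_eqF // ltr_wpDl.
    by rewrite divr_ge0 ?(ltW z0) // mulr_ge0 // addr_ge0.
  rewrite [X in _ + X <= _]mulrDl; move: h3 h4; set A := 4 * _ * _ * _; set A' := z / _ * _; lra.
have half s t : 0 <= s <= 1 -> 0 <= t <= 1 -> s <= t -> `|s - t0| < rho / 2 ->
    `|t - t0| < rho / 2 -> enorm (c t - c s - (t - s) *: V) <= z * (t - s).
  move=> s01 t01' st; rewrite !ltr_norml => /andP[sa sb] /andP[ta tb].
  have l1 : enorm (cs k (idx k t) - cs k (idx k s) -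
      ((idx k t - idx k s)%:R / (K k)%:R) *: V) @[k --> U] --> enorm (c t - c s - (t - s) *: V).
    apply: cvg_enorm; apply: cvgB; first by apply: cvgB; exact: cU.
    by apply: cvgZ; [exact: didxU|exact: cvg_cst].
  have l2 : z * ((idx k t - idx k s)%:R / (K k)%:R) @[k --> U] --> z * (t - s).
    by apply: cvgM; [exact: cvg_cst|exact: didxU].
  apply: (ler_cvg_to l1 l2).
  apply: filterS (filterI key (filterI eta_rho eta_z)) => k [kk [er ez]].
  have b : forall l, (idx k s <= l < idx k t)%N -> (l < K k)%N.
    by move=> l /andP[_ lt]; apply: leq_trans lt (idxK k t t01').
  have := @position_increment R n r G B orthG LB p (xs k) (eta k) (K k) (K0 k) V (z / 2) (eta k)
    (idx k s) (idx k t) (idx_le k s t st) (ltW (eta0 k)).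
  move=> h; apply: le_trans (h _ _ _ (us2 k)) _.
  - move=> l lb; apply: kk (b _ lb) _.
    have /andP[s1 s2] := idxt k s s01; have /andP[t1 t2] := idxt k t t01'.
    move: lb => /andP[il lj].
    have h1 : (idx k s)%:R / (K k)%:R <= l%:R / (K k)%:R :> R by rewrite ler_wpM2r // ler_nat.
    have h2 : l%:R / (K k)%:R <= (idx k t)%:R / (K k)%:R :> R by rewrite ler_wpM2r // ler_nat ltnW.
    by rewrite ler_norml; apply/andP; split; lra.
  - by move=> l /b lK; exact: YsB.
  - by move=> l /b lK; exact: gs2 (ltnW lK).
  - by rewrite mulrC ler_wpM2r ?divr_ge0 //; lra.
exists (rho / 2); first by rewrite divr_gt0.
move=> s t s01 t01' sd td; have [st|ts] := leP s t.
  by rewrite ger0_norm ?subr_ge0 //; exact: half.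
have neg (a b W : 'cV[R]_n.+1) (k : R) : a - b - k *: W = - (b - a - (- k) *: W).
  by rewrite scaleNr opprK opprD opprB.
rewrite ltr0_norm ?subr_lt0 // neg enormN opprB.
exact: half (ltW ts) td sd.
Qed.

End TransportLimit.

(** * Reparametrisation and horizontal arcs *)

Section RealCalculus.
Context {R : realType}.
Implicit Types (a b : R) (F f v : R -> R).

Lemma continuous_integrable_itv a b v : continuous v ->
  (@lebesgue_measure R).-integrable `[a, b] (EFin \o v).
Proof.
move=> cv; apply: continuous_compact_integrable; first exact: segment_compact.
exact: continuous_subspaceT.
Qed.

Lemma FTC_is_derive a b F f : a < b ->
  (forall t, a <= t <= b -> is_derive t (1 : R) F (f t)) ->
  (forall t, a <= t <= b -> {for t, continuous f}) ->
  (\int[lebesgue_measure]_(t in `[a, b]) (f t)%:E = (F b - F a)%:E)%E /\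
  (@lebesgue_measure R).-integrable `[a, b] (EFin \o f).
Proof.
move=> ab dF cf; have cF t : a <= t <= b -> {for t, continuous F}.
  move=> tab; apply: differentiable_continuous; apply/derivable1_diffP.
  by have [] := dF t tab.
have wf : {within `[a, b], continuous f}.
  by apply: continuous_in_subspaceT => t; rewrite inE /= in_itv /=; exact: cf.
split; last by apply: continuous_compact_integrable => //; exact: segment_compact.
rewrite (continuous_FTC2 (F := F)) //.
- split.
  + by move=> t; rewrite in_itv /= => /andP[ta tb]; have [] := dF t; rewrite ?ltW.
  + by apply: cvg_at_right_filter; apply: cF; rewrite lexx ltW.
  + by apply: cvg_at_left_filter; apply: cF; rewrite lexx ltW.
- move=> t; rewrite in_itv /= => /andP[ta tb]; rewrite derive1E.
  by have [] := dF t; rewrite ?ltW.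
Qed.

Lemma integral_le_FTC a b F f v : a < b ->
  (forall t, a <= t <= b -> is_derive t (1 : R) F (f t)) ->
  (forall t, a <= t <= b -> {for t, continuous f}) ->
  continuous v -> (forall t, a <= t <= b -> v t <= f t) ->
  (\int[lebesgue_measure]_(t in `[a, b]) (v t)%:E <= (F b - F a)%:E)%E.
Proof.
move=> ab dF cf cv vf; have [<- intf] := FTC_is_derive ab dF cf.
apply: le_integral => //; first exact: continuous_integrable_itv.
by move=> t; rewrite inE /= in_itv /= lee_fin; exact: vf.
Qed.

Lemma FTC_le_integral a b F f v : a < b ->
  (forall t, a <= t <= b -> is_derive t (1 : R) F (f t)) ->
  (forall t, a <= t <= b -> {for t, continuous f}) ->
  continuous v -> (forall t, a <= t <= b -> f t <= v t) ->
  ((F b - F a)%:E <= \int[lebesgue_measure]_(t in `[a, b]) (v t)%:E)%E.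
Proof.
move=> ab dF cf cv vf; have [<- intf] := FTC_is_derive ab dF cf.
apply: le_integral => //; first exact: continuous_integrable_itv.
by move=> t; rewrite inE /= in_itv /= lee_fin; exact: vf.
Qed.

(* Since the speed vanishes at the ends, precomposing with such a function turns a
   Lipschitz curve that is C1 only on the open interval into a C1 curve. *)
Lemma smooth_step a b s0 s1 : a < b -> s0 < s1 -> exists phi dphi : R -> R,
  [/\ forall t, is_derive t (1 : R) phi (dphi t), continuous dphi,
      phi s0 = a /\ phi s1 = b,
      forall t, a <= phi t <= b /\ (phi t = a \/ phi t = b -> dphi t = 0) &
      forall t, s0 <= t <= s1 -> 0 <= dphi t].
Proof.
move=> ab s01.
pose w := pi / (s1 - s0); pose u t := w * (t - s0).
have w0 : 0 < w by rewrite divr_gt0 ?pi_gt0 ?subr_gt0.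
have cu : continuous u.
  by move=> t; apply: cvgM; [exact: cvg_cst|apply: cvgB; [exact: cvg_id|exact: cvg_cst]].
(* [C1] concerns the whole line, so a cosine profile is chosen: it stays in [[a, b]] for all times
   and is stationary whenever it meets an end. *)
exists (fun t => a + (b - a) / 2 * (1 - cos (u t))), (fun t => (b - a) / 2 * (sin (u t) * w)).
split.
- move=> t; apply: is_derive_eq; rewrite /GRing.scale /=; ring.
- move=> t; apply: cvgM; first exact: cvg_cst.
  apply: cvgM; last exact: cvg_cst.
  by apply: (@continuous_comp _ _ _ u sin); [exact: cu|exact: continuous_sin].
- rewrite /u subrr mulr0 cos0 subrr mulr0 addr0; split=> //.
  by rewrite /w divfK ?gt_eqF ?subr_gt0 // cospi; field.
- move=> t; have c1 := cos_le1 (u t); have c2 := cos_geN1 (u t).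
  split.
    have h1 : 0 <= (b - a) / 2 * (1 - cos (u t)) by rewrite mulr_ge0 ?divr_ge0 ?subr_ge0 // ltW.
    have h2 : 0 <= (b - a) / 2 * (1 + cos (u t)).
      by rewrite mulr_ge0 ?divr_ge0 ?subr_ge0 ?(ltW ab) //; lra.
    by apply/andP; split; lra.
  move=> h; have ba0 : (b - a) / 2 != 0 by rewrite mulf_neq0 ?gt_eqF ?subr_gt0.
  suff -> : sin (u t) = 0 by rewrite mul0r mulr0.
  apply/eqP; rewrite -sqrf_eq0 sin2cos2; case: h => h.
    have : (b - a) / 2 * (1 - cos (u t)) = 0 by lra.
    by move/eqP; rewrite mulf_eq0 (negbTE ba0) subr_eq0 => /eqP <-; rewrite expr1n subrr.
  have : (b - a) / 2 * (1 + cos (u t)) = 0 by lra.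
  move/eqP; rewrite mulf_eq0 (negbTE ba0) addr_eq0 => /eqP /= e.
  by rewrite -[cos _]opprK -e sqrrN expr1n subrr.
- move=> t /andP[t0 t1]; rewrite mulr_ge0 ?divr_ge0 ?subr_ge0 ?(ltW ab) //.
  rewrite mulr_ge0 ?(ltW w0) // sin_ge0_pi // /u mulr_ge0 ?(ltW w0) ?subr_ge0 //=.
  by rewrite -[leRHS](@divfK _ (s1 - s0)) ?gt_eqF ?subr_gt0 // ler_wpM2l ?(ltW w0) // lerB.
Qed.

End RealCalculus.

Section VectorCalculus.
Context {R : realType} {n : nat}.
Implicit Types (f w : R -> 'cV[R]_n.+1) (k : R -> R) (D : 'cV[R]_n.+1).

Lemma is_derive_vecP f (t : R) D :
  is_derive t (1 : R) f D <-> h^-1 *: (f (h + t) - f t) @[h --> 0^'] --> D.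
Proof.
have shiftE : (fun h : R => h^-1 *: ((f \o shift t) (h *: 1) - f t)) =
    (fun h => h^-1 *: (f (h + t) - f t)).
  by apply/funext => h; rewrite /= /GRing.scale /= mulr1.
split=> [[df Df]|fD].
  by rewrite -shiftE -Df; exact: df.
split; first by apply/cvg_ex; exists D; rewrite shiftE.
by rewrite /derive shiftE; exact/cvg_lim.
Qed.

Lemma is_derive_of_bound f (t : R) D :
  (forall z : R, 0 < z -> exists2 d : R, 0 < d & forall s, `|s - t| < d ->
     enorm (f s - f t - (s - t) *: D) <= z * `|s - t|) ->
  is_derive t (1 : R) f D.
Proof.
move=> fD; apply/is_derive_vecP; apply: cvg_mx => i j; rewrite (ord1 j).
apply/cvgrPdist_le => z z0; have [d d0 dP] := fD z z0.
near=> h; have h0 : h != 0 by near: h; exact: nbhs_dnbhs_neq.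
have hd : `|h + t - t| < d.
  rewrite addrK; near: h; apply: nbhs_dnbhs; apply/nbhs_ballP; exists d => //= h.
  by rewrite /ball /= sub0r normrN.
have := dP _ hd; rewrite addrK => hz.
have := le_trans (norm_entry_le _ i) hz.
have -> : (f (h + t) - f t - h *: D) i 0 = - (h * (D i 0 - (h^-1 *: (f (h + t) - f t)) i 0)).
  by rewrite !mxE; field.
by rewrite normrN normrM mulrC ler_pM2r ?normr_gt0.
Unshelve. all: by end_near. Qed.

Lemma is_derive_continuous f (t : R) D : is_derive t (1 : R) f D -> {for t, continuous f}.
Proof. by case=> df _; apply: differentiable_continuous; exact/derivable1_diffP. Qed.

Lemma is_derive_scale k f (t k' : R) D :
  is_derive t (1 : R) k k' -> is_derive t (1 : R) f D ->
  is_derive t (1 : R) (fun s => k s *: f s) (k' *: f t + k t *: D).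
Proof.
move=> dk df; have cf := is_derive_continuous df.
have cft : f (h + t) @[h --> 0^'] --> f t.
  have hs : h + t @[h --> (0 : R)^'] --> 0 + t.
    by apply: cvgD; [exact: cvg_within|exact: cvg_cst].
  by rewrite add0r in hs; exact: cvg_comp hs cf.
have lk : h^-1 * (k (h + t) - k t) @[h --> 0^'] --> k'.
  case: dk => dk <-; have := dk; rewrite /derivable /derive.
  have -> // : (fun h : R => h^-1 *: ((k \o shift t) (h *: 1) - k t)) =
    (fun h => h^-1 * (k (h + t) - k t)).
  by apply/funext => h; rewrite /= /GRing.scale /= mulr1.
move/is_derive_vecP in df; apply/is_derive_vecP.
have -> : (fun h => h^-1 *: (k (h + t) *: f (h + t) - k t *: f t)) =
    (fun h => (h^-1 * (k (h + t) - k t)) *: f (h + t) + k t *: (h^-1 *: (f (h + t) - f t))).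
  apply/funext => h; apply/matrixP => i j; rewrite !mxE; ring.
by apply: cvgD; apply: cvgZ => //; exact: cvg_cst.
Qed.

End VectorCalculus.

(** * Horizontal arcs from reparametrised Lipschitz curves *)

Section Arcs.
Context {R : realType} {n : nat} (G : set 'M[R]_n.+1).
Implicit Types (p q : 'cV[R]_n.+1) (a b : R).

(* The parameter interval is left free so that arcs can be chained. *)
Definition harc p q (l : R) : Prop := forall s0 s1 : R, s0 < s1 ->
  exists f : R -> 'cV[R]_n.+1,
  [/\ C1 f, forall t, s0 <= t <= s1 -> sphere (f t), f s0 = p /\ f s1 = q,
      forall t, s0 <= t <= s1 -> forall u, orbit_tangent G (f t) u -> dotv ('D_1 f t) u = 0 &
      (\int[lebesgue_measure]_(t in `[s0, s1]) (enorm ('D_1 f t))%:E <= l%:E)%E].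

Section Reparametrisation.
Variables (a b L : R) (c V : R -> 'cV[R]_n.+1).
Hypothesis ab : a < b.
Hypothesis c_lip : forall s t, a <= s <= b -> a <= t <= b -> enorm (c t - c s) <= L * `|t - s|.
Hypothesis V_le : forall t, a < t < b -> enorm (V t) <= L.
Hypothesis c_diff : forall t0, a < t0 < b -> forall z : R, 0 < z -> exists2 d : R, 0 < d &
  forall s t, a <= s <= b -> a <= t <= b -> `|s - t0| < d -> `|t - t0| < d ->
  enorm (c t - c s - (t - s) *: V t0) <= z * `|t - s|.

Let L0 : 0 <= L.
Proof.
have h : a < (a + b) / 2 < b by move: ab => ?; apply/andP; split; lra.
exact: le_trans (enorm_ge0 _) (V_le h).
Qed.

Variables (phi dphi : R -> R).
Hypothesis dphiP : forall t, is_derive t (1 : R) phi (dphi t).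
Hypothesis cdphi : continuous dphi.
Hypothesis phiab : forall t, a <= phi t <= b /\ (phi t = a \/ phi t = b -> dphi t = 0).

Let phi_cases t : a < phi t < b \/ dphi t = 0.
Proof.
have [/andP[pa pb] h] := phiab t.
have [pa'|pa'] := eqVneq (phi t) a; first by right; apply: h; left.
have [pb'|pb'] := eqVneq (phi t) b; first by right; apply: h; right.
by left; rewrite !lt_neqAle pa pb pb' eq_sym pa'.
Qed.

Let phi_cont : continuous phi.
Proof.
by move=> t; apply: differentiable_continuous; apply/derivable1_diffP; have [] := dphiP t.
Qed.

Let phi_diff t (z : R) : 0 < z -> exists2 d : R, 0 < d &
  forall s, `|s - t| < d -> `|phi s - phi t - (s - t) * dphi t| <= z * `|s - t|.
Proof.
move=> z0; have lim : h^-1 * (phi (h + t) - phi t) @[h --> 0^'] --> dphi t.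
  case: (dphiP t) => dk <-; have := dk; rewrite /derivable /derive.
  have -> // : (fun h : R => h^-1 *: ((phi \o shift t) (h *: 1) - phi t)) =
    (fun h => h^-1 * (phi (h + t) - phi t)).
  by apply/funext => h; rewrite /= /GRing.scale /= mulr1.
have /cvgrPdist_le/(_ z z0)[d /= d0 dP] := lim; exists d => // s sd.
have [->|st] := eqVneq s t; first by rewrite !subrr mul0r subrr normr0 mulr0.
have st0 : s - t != 0 by rewrite subr_eq0.
have := dP (s - t); rewrite /= sub0r normrN subrK => /(_ sd st0) h.
have -> : phi s - phi t - (s - t) * dphi t =
    - ((s - t) * (dphi t - (s - t)^-1 * (phi s - phi t))) by field.
by rewrite normrN normrM mulrC ler_pM2r ?normr_gt0.
Qed.

(** Inside the interval this is the chain rule. At an end [c] need not be differentiable, but [dphi]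
    vanishes and the Lipschitz bound gives derivative 0. *)
Lemma is_derive_reparam t : is_derive t (1 : R) (c \o phi) (dphi t *: V (phi t)).
Proof.
apply: is_derive_of_bound => z z0.
have [pin|p0] := phi_cases t; last first.
  have z' : 0 < z / (L + 1) by rewrite divr_gt0 // ltr_wpDl.
  have [d d0 dP] := phi_diff t z'; exists d => // s sd.
  rewrite p0 scale0r scaler0 subr0.
  apply: (le_trans (c_lip (phiab t).1 (phiab s).1)).
  have := dP s sd; rewrite p0 mulr0 subr0 => h.
  apply: le_trans (ler_wpM2l L0 h) _; rewrite mulrA ler_wpM2r //.
  by rewrite mulrA ler_pdivrMr ?ltr_wpDl // mulrC ler_wpM2l ?lerDl // ltW.
have P0 : 0 < `|dphi t| + 1 by rewrite ltr_wpDl.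
(* Half of [z] pays for the error of [c], the other half for that of [phi]. The bound [z2 <= 1]
   gives [phi] the local Lipschitz factor dphi + 1 (in absolute value) that the first half uses. *)
pose z1 := z / (2 * (`|dphi t| + 1)).
have z10 : 0 < z1 by rewrite divr_gt0 // mulr_gt0.
have [d1 d10 d1P] := c_diff pin z10.
pose z2 := Num.min 1 (z / (2 * (L + 1))).
have z20 : 0 < z2 by rewrite lt_min ltr01 divr_gt0 // mulr_gt0 // ltr_wpDl.
have [d2 d20 d2P] := phi_diff t z20.
have /cvgrPdist_lt/(_ d1 d10)/nbhs_ballP[d3 /= d30 d3P] := phi_cont (x := t).
exists (Num.min d2 d3) => [|s]; first by rewrite lt_min d20.
rewrite lt_min => /andP[s2 s3]; have h2 := d2P s s2.
have h1 : enorm (c (phi s) - c (phi t) - (phi s - phi t) *: V (phi t)) <= z1 * `|phi s - phi t|.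
  apply: d1P; [exact: (phiab t).1|exact: (phiab s).1|by rewrite subrr normr0|].
  by rewrite distrC; apply: d3P; rewrite /ball /= distrC.
have h3 : `|phi s - phi t| <= (`|dphi t| + 1) * `|s - t|.
  rewrite -(subrK ((s - t) * dphi t) (phi s - phi t)) (le_trans (ler_normD _ _)) //.
  rewrite [leRHS]mulrDl mul1r addrC lerD //; first by rewrite normrM mulrC.
  apply: le_trans h2 _; rewrite ler_piMl // ge_min lexx //.
have -> : (c \o phi) s - (c \o phi) t - (s - t) *: (dphi t *: V (phi t)) =
    (c (phi s) - c (phi t) - (phi s - phi t) *: V (phi t)) +
    (phi s - phi t - (s - t) * dphi t) *: V (phi t).
  by apply/matrixP => i j; rewrite !mxE /=; ring.
rewrite (le_trans (enormD _ _)) // enormZ.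
have h4 := ler_wpM2l (ltW z10) h3.
have h5 := ler_pM (normr_ge0 _) (enorm_ge0 _) h2 (V_le pin).
apply: le_trans (lerD (le_trans h1 h4) h5) _.
have -> : z * `|s - t| = z / 2 * `|s - t| + z / 2 * `|s - t| by field.
apply: lerD.
  rewrite mulrA ler_wpM2r // /z1 le_eqVlt; apply/orP; left; apply/eqP.
  by field; rewrite gt_eqF.
rewrite mulrAC ler_wpM2r //.
apply: (@le_trans _ _ (z / (2 * (L + 1)) * L)).
  by rewrite ler_wpM2r // ge_min lexx orbT.
rewrite mulrAC ler_pdivrMr ?mulr_gt0 // ?ltr_wpDl //.
have -> : z / 2 * (2 * (L + 1)) = z * (L + 1) by field.
by rewrite ler_wpM2l ?(ltW z0) // lerDl.
Qed.

(** Inside the interval [V] is continuous thanks to the two-point form of [c_diff]. At the ends [V]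
    is only bounded, and the factor [dphi] tends to 0. *)
Lemma continuous_reparam : continuous (fun t => dphi t *: V (phi t)).
Proof.
move=> t; apply: cvg_mx => i j; rewrite (ord1 j).
have [pin|p0] := phi_cases t; last first.
  rewrite p0 scale0r mxE; apply/norm_cvg0P.
  have lim : `|dphi s| * L @[s --> t] --> (0 : R).
    rewrite -(mul0r L) -(@normr0 _ R) -p0; apply: cvgM; last exact: cvg_cst.
    by apply: cvg_norm; exact: cdphi.
  apply: (squeeze_cvgr _ (cvg_cst 0) lim); apply: nearW => s.
  rewrite normr_ge0 mxE normrM /=.
  have [->|] := eqVneq (dphi s) 0; first by rewrite normr0 !mul0r.
  move=> ds; rewrite ler_wpM2l // (le_trans (norm_entry_le _ _)) //; apply: V_le.
  by have [//|/eqP] := phi_cases s; rewrite (negbTE ds).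
rewrite mxE; under eq_fun do rewrite mxE.
apply: cvgM; first exact: cdphi.
apply/cvgrPdist_le => z z0.
have [d d0 dP] := c_diff pin z0.
have /cvgrPdist_lt/(_ d d0) ed := phi_cont (x := t).
have /andP[pa pb] := pin.
have ea : \forall s \near t, a < phi s by exact: (cvgr_gt _ (phi_cont (x := t)) _ pa).
have eb : \forall s \near t, phi s < b by exact: (cvgr_lt _ (phi_cont (x := t)) _ pb).
near=> s; have sa : a < phi s by near: s.
have sb : phi s < b by near: s.
have sd : `|phi t - phi s| < d by near: s.
have sin : a < phi s < b by rewrite sa.
rewrite -normrN opprB; have -> : V (phi s) i 0 - V (phi t) i 0 = (V (phi s) - V (phi t)) i 0.
  by rewrite !mxE.
apply: (le_trans (norm_entry_le _ _)).
apply/ler_addgt0Pr => e e0.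
have [d' d'0 d'P] := c_diff sin e0.
(* The increment of [c] over a short step [r] after [phi s] is compared with [V (phi s)], to
   arbitrary accuracy [e], and with [V (phi t)], to accuracy [z]. Halving makes the constraints on
   [r] strict. *)
pose r := Num.min (Num.min (d - `|phi t - phi s|) d') (b - phi s) / 2.
have r0 : 0 < r by rewrite divr_gt0 // !lt_min !subr_gt0 sd d'0.
have [r1 r2 r3] : [/\ r < d - `|phi t - phi s|, r < d' & r < b - phi s].
  have h : r < r * 2 by rewrite ltr_pMr // ltr1n.
  have e2 : r * 2 = Num.min (Num.min (d - `|phi t - phi s|) d') (b - phi s) by rewrite divfK.
  by move: h; rewrite e2 !lt_min => /andP[/andP[]].
have in1 : a <= phi s <= b by exact: (phiab s).1.
have in2 : a <= phi s + r <= b by move: in1 => /andP[]; move: r0 r3 => ? ? ? ?; apply/andP; split; lra.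
have nd : `|phi s + r - phi s| = r by rewrite addrAC subrr add0r gtr0_norm.
have q1 := d'P _ _ in1 in2; rewrite subrr normr0 nd in q1.
have {}q1 := q1 d'0 r2.
have q2 := dP _ _ in1 in2; rewrite nd distrC in q2.
have {}q2 : enorm (c (phi s + r) - c (phi s) - (phi s + r - phi s) *: V (phi t)) <= z * r.
  apply: q2 => //; rewrite -addrA [r - _]addrC addrA; apply: le_lt_trans (ler_normD _ _) _.
  by rewrite (gtr0_norm r0) distrC; lra.
have e1 : phi s + r - phi s = r by rewrite addrAC subrr add0r.
rewrite !e1 in q1 q2.
have : enorm (r *: (V (phi s) - V (phi t))) <= (z + e) * r.
  have -> : r *: (V (phi s) - V (phi t)) =
    (c (phi s + r) - c (phi s) - r *: V (phi t)) - (c (phi s + r) - c (phi s) - r *: V (phi s)).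
    by apply/matrixP => i' j'; rewrite !mxE; ring.
  by rewrite mulrDl (le_trans (enormD _ _)) // enormN lerD.
by rewrite enormZ gtr0_norm // mulrC ler_pM2r.
Unshelve. all: by end_near. Qed.

End Reparametrisation.
End Arcs.

Section ArcConstruction.
Context {R : realType} {n : nat} (G : set 'M[R]_n.+1).

(** The factor [k] projects the curve [c] radially to the sphere, and [theta] is a primitive of a
    bound of the resulting speed. Applied both to the limit curve and to a straight segment. *)
Lemma harc_reparam (a b L : R) (c V : R -> 'cV[R]_n.+1) (k k' theta omega : R -> R) :
  a < b ->
  (forall s t, a <= s <= b -> a <= t <= b -> enorm (c t - c s) <= L * `|t - s|) ->
  (forall t, a < t < b -> enorm (V t) <= L) ->
  (forall t0, a < t0 < b -> forall z : R, 0 < z -> exists2 d : R, 0 < d &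
    forall s t, a <= s <= b -> a <= t <= b -> `|s - t0| < d -> `|t - t0| < d ->
    enorm (c t - c s - (t - s) *: V t0) <= z * `|t - s|) ->
  (forall t, is_derive t (1 : R) k (k' t)) -> continuous k' ->
  (forall t, a <= t <= b -> enorm (k t *: c t) = 1) ->
  (forall t X, a < t < b -> lie_alg G X -> dotv (k' t *: c t + k t *: V t) (X *m c t) = 0) ->
  (forall t, is_derive t (1 : R) theta (omega t)) -> continuous omega ->
  (forall t, a < t < b -> enorm (k' t *: c t + k t *: V t) <= omega t) ->
  harc G (k a *: c a) (k b *: c b) (theta b - theta a).
Proof.
move=> ab c_lip V_le c_diff dk ck' sph hor dtheta comega speed s0 s1 s01.
have [phi [dphi [dphiP cdphi [phi0 phi1] phiab dphi0]]] := smooth_step ab s01.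
have L0 : 0 <= L.
  have h : a < (a + b) / 2 < b by apply/andP; split; lra.
  exact: le_trans (enorm_ge0 _) (V_le _ h).
pose f t := k (phi t) *: c (phi t).
pose D t := (k' (phi t) * dphi t) *: c (phi t) + k (phi t) *: (dphi t *: V (phi t)).
have DE t : D t = dphi t *: (k' (phi t) *: c (phi t) + k (phi t) *: V (phi t)).
  by apply/matrixP => i j; rewrite !mxE; ring.
have dc t : is_derive t (1 : R) (c \o phi) (dphi t *: V (phi t)).
  exact (@is_derive_reparam R n a b L c V ab c_lip V_le c_diff phi dphi dphiP phiab t).
have dkphi t : is_derive t (1 : R) (k \o phi) (k' (phi t) * dphi t).
  exact: is_derive1_comp.
have df t : is_derive t (1 : R) f (D t) by exact: is_derive_scale (dkphi t) (dc t).
have Df t : 'D_1 f t = D t by have [_] := df t.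
have cphi : continuous phi.
  by move=> t; apply: differentiable_continuous; apply/derivable1_diffP; have [] := dphiP t.
have ck : continuous k.
  by move=> t; apply: differentiable_continuous; apply/derivable1_diffP; have [] := dk t.
have cD : continuous D.
  move=> t; apply: cvgD.
    apply: cvgZ; last exact: is_derive_continuous (dc t).
    apply: cvgM; last exact: cdphi.
    by apply: cvg_comp (cphi t) _; exact: ck'.
  apply: cvgZ; last exact (@continuous_reparam R n a b L c V V_le c_diff phi dphi dphiP cdphi phiab t).
  by apply: cvg_comp (cphi t) _; exact: ck.
have cases t : a < phi t < b \/ dphi t = 0.
  have [/andP[pa pb] h] := phiab t.
  have [pa'|pa'] := eqVneq (phi t) a; first by right; apply: h; left.
  have [pb'|pb'] := eqVneq (phi t) b; first by right; apply: h; right.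
  by left; rewrite !lt_neqAle pa pb pb' eq_sym pa'.
have sphf t : sphere (f t).
  by rewrite /sphere /= -sqr_enorm sph ?expr1n //; exact: (phiab t).1.
exists f; split=> //.
- split=> [t|]; first by have [] := df t.
  by have -> : (fun t => 'D_1 f t) = D by apply/funext.
- by rewrite /f phi0 phi1.
- move=> t t01 u [X LX <-]; rewrite Df DE dotvZl.
  have [pin|->] := cases t; last by rewrite mul0r.
  by rewrite /f -scalemxAr dotvZr hor // !mulr0.
have enD : continuous (fun t => enorm ('D_1 f t)).
  have -> : (fun t => enorm ('D_1 f t)) = (fun t => enorm (D t)).
    by apply/funext => t; rewrite Df.
  by move=> t; apply: cvg_enorm; exact: cD.
have dth t : is_derive t (1 : R) (theta \o phi) (omega (phi t) * dphi t).
  exact: is_derive1_comp.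
have ctp : continuous (fun t => omega (phi t) * dphi t).
  move=> t; apply: cvgM; last exact: cdphi.
  by apply: cvg_comp (cphi t) _; exact: comega.
rewrite -phi0 -phi1; apply: (integral_le_FTC s01 (fun t _ => dth t) (fun t _ => ctp t) enD) => t t01.
rewrite Df DE enormZ ger0_norm ?dphi0 // mulrC.
have [pin|->] := cases t; last by rewrite !mulr0.
by rewrite ler_wpM2r ?dphi0 // speed.
Qed.

Lemma hdist_chain (k : nat) (v : nat -> 'cV[R]_n.+1) (l : nat -> R) : (0 < k)%N ->
  (forall i, (i < k)%N -> harc G (v i) (v i.+1) (l i)) ->
  (hdist G (v 0%N) (v k) <= (\sum_(i < k) l i)%:E)%E.
Proof.
move=> k0 arcs; pose ts (i : nat) : R := i%:R / k%:R.
have k0' : 0 < k%:R :> R by rewrite ltr0n.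
have ts_lt i : ts i < ts i.+1 by rewrite ltr_pM2r ?invr_gt0 // ltr_nat.
have /choice[f fP] : forall i, exists f : R -> 'cV[R]_n.+1, (i < k)%N ->
  [/\ C1 f, forall t, ts i <= t <= ts i.+1 -> sphere (f t),
      f (ts i) = v i /\ f (ts i.+1) = v i.+1,
      forall t, ts i <= t <= ts i.+1 ->
        forall u, orbit_tangent G (f t) u -> dotv ('D_1 f t) u = 0 &
      (\int[lebesgue_measure]_(t in `[ts i, ts i.+1]) (enorm ('D_1 f t))%:E <= (l i)%:E)%E].
  move=> i; have [ik|ik] := ltnP i k; last by exists (fun=> 0).
  by have [f h] := arcs i ik _ _ (ts_lt i); exists f.
have ts0 : ts 0%N = 0 by rewrite /ts mul0r.
have tsk : ts k = 1 by rewrite /ts divff ?gt_eqF.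
apply: (@le_trans _ _ (\sum_(i < k)
   \int[lebesgue_measure]_(t in `[ts i, ts i.+1]) (enorm ('D_1 (f i) t))%:E)%E); last first.
  by rewrite -sumEFin; apply: lee_sum => i _; have [] := fP i (ltn_ord i).
apply: ereal_inf_lbound; exists k, ts, f.
refine (conj k0 (conj ts0 (conj tsk (conj (fun i _ => ts_lt i)
  (conj _ (conj _ (conj _ (conj _ (conj _ (conj _ erefl)))))))))).
- by move=> i ik; have [] := fP i ik.
- by move=> i t ik; have [_ h _ _ _] := fP i ik; exact: h.
- move=> i ik; have [_ _ [_ ->] _ _] := fP i (ltnW ik).
  by have [_ _ [-> _] _ _] := fP _ ik.
- by rewrite -ts0; have [_ _ [-> _] _ _] := fP _ k0.
- have k1 : (k.-1 < k)%N by rewrite prednK.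
  by have [_ _ [_ h] _ _] := fP _ k1; rewrite prednK // tsk in h.
- by move=> i t ik; have [_ _ _ h _] := fP i ik; exact: h.
Qed.

End ArcConstruction.

(** * The lower bound *)

Section LowerBound.
Context {R : realType} {n : nat}.

Lemma is_derive_dotv (f g : R -> 'cV[R]_n.+1) (t : R) (f' g' : 'cV[R]_n.+1) :
  is_derive t (1 : R) f f' -> is_derive t (1 : R) g g' ->
  is_derive t (1 : R) (fun s => dotv (f s) (g s)) (dotv f' (g t) + dotv (f t) g').
Proof.
move=> df dg; have cg := is_derive_continuous dg.
have hs : h + t @[h --> (0 : R)^'] --> t.
  rewrite -[X in _ --> X]add0r; apply: cvgD; last exact: cvg_cst.
  exact: cvg_within.
have cgt : g (h + t) @[h --> 0^'] --> g t by exact: cvg_comp hs cg.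
move/is_derive_vecP in df; move/is_derive_vecP in dg.
have lim : h^-1 *: (dotv (f (h + t)) (g (h + t)) - dotv (f t) (g t)) @[h --> 0^'] -->
    (dotv f' (g t) + dotv (f t) g' : R).
  have -> : (fun h => h^-1 *: (dotv (f (h + t)) (g (h + t)) - dotv (f t) (g t))) =
    (fun h => dotv (h^-1 *: (f (h + t) - f t)) (g (h + t)) +
              dotv (f t) (h^-1 *: (g (h + t) - g t))).
    apply/funext => h; rewrite !dotvZl !dotvZr dotvBl dotvBr /GRing.scale /=; ring.
  apply: cvgD; first exact: cvg_dotv.
  by apply: cvg_dotv => //; exact: cvg_cst.
have shiftE (F : R -> R) : (fun h : R => h^-1 *: ((F \o shift t) (h *: 1) - F t)) =
    (fun h => h^-1 *: (F (h + t) - F t)).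
  by apply/funext => h; rewrite /= /GRing.scale /= mulr1.
split; first by apply/cvg_ex; exists (dotv f' (g t) + dotv (f t) g'); rewrite shiftE.
by rewrite /derive shiftE; exact/cvg_lim.
Qed.

(** Differentiating the constant norm works only in the open interval, since [f] may leave the
    sphere outside; the ends follow by continuity of the derivative. *)
Lemma sphere_velocity (f : R -> 'cV[R]_n.+1) (a b : R) : a < b -> C1 f ->
  (forall t, a <= t <= b -> sphere (f t)) ->
  forall t, a <= t <= b -> dotv (f t) ('D_1 f t) = 0.
Proof.
move=> ab [df cdf] sf.
have inner t : a < t < b -> dotv (f t) ('D_1 f t) = 0.
  move=> tab; have d1 := is_derive_dotv (derivableP (df t)) (derivableP (df t)).
  have d2 : is_derive t (1 : R) (fun s => dotv (f s) (f s)) 0.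
    have d0 : is_derive t (1 : R) (cst (1 : R)) 0 by exact: is_derive_cst.
    apply: near_eq_is_derive d0.
    have /andP[ta tb] := tab.
    near=> s; apply/esym/sf.
    have sa : a < s by near: s; exact: lt_nbhsr.
    have sb : s < b by near: s; exact: lt_nbhsl.
    by rewrite !ltW.
  have [_ e1] := d1; have [_ e2] := d2.
  by move: e1; rewrite e2 dotvC; lra.
have cN : continuous (fun t => dotv (f t) ('D_1 f t)).
  by move=> t; apply: cvg_dotv; [exact: is_derive_continuous (derivableP (df t))|exact: cdf].
move=> t tab; apply: contrapT => /eqP nz.
have /cvgrPdist_lt/(_ `|dotv (f t) ('D_1 f t)|) := cN t.
rewrite normr_gt0 => /(_ nz)/nbhs_ballP[d /= d0 dP].
pose e := Num.min d (b - a) / 4.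
have m0 : 0 < Num.min d (b - a) by rewrite lt_min d0 subr_gt0.
have e0 : 0 < e by rewrite divr_gt0.
have ed : e < d.
  apply: (@lt_le_trans _ _ (Num.min d (b - a))); last by rewrite ge_min lexx.
  by rewrite /e; lra.
have eb : 4 * e <= b - a by rewrite /e mulrC divfK // ge_min lexx orbT.
have [s sab st] : exists2 s, a < s < b & `|t - s| < d.
  move: tab => /andP[ta tb]; have [tm|tm] := leP t ((a + b) / 2).
    exists (t + e); first by apply/andP; split; lra.
    by rewrite opprD addrA subrr add0r normrN gtr0_norm.
  exists (t - e); first by apply/andP; split; lra.
  by rewrite opprB addrCA subrr addr0 gtr0_norm.
by have := dP s st; rewrite /= (inner s sab) subr0 ltxx.
Unshelve. all: by end_near. Qed.

(* Shrinking the inner product by [r < 1] keeps it inside the open interval where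
   [acos] is differentiable, and only improves the speed estimate. *)
Lemma angle_le_length (f : R -> 'cV[R]_n.+1) (p : 'cV[R]_n.+1) (a b r : R) :
  a < b -> C1 f -> (forall t, a <= t <= b -> sphere (f t)) -> sphere p -> 0 < r < 1 ->
  ((acos (r * dotv (f b) p) - acos (r * dotv (f a) p))%:E <=
   \int[lebesgue_measure]_(t in `[a, b]) (enorm ('D_1 f t))%:E)%E.
Proof.
move=> ab C1f sf sp /andP[r0 r1]; have [df cdf] := C1f.
have tang := sphere_velocity ab C1f sf.
pose y t := r * dotv (f t) p.
have cf : continuous f by move=> t; exact: is_derive_continuous (derivableP (df t)).
have cy : continuous y.
  by move=> t; apply: cvgM; [exact: cvg_cst|apply: cvg_dotv; [exact: cf|exact: cvg_cst]].
have hle t : a <= t <= b -> dotv (f t) p ^+ 2 <= 1.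
  move=> tab; have := cauchy_schwarz (f t) p.
  by rewrite (sf t tab : dotv (f t) (f t) = 1) (sp : dotv p p = 1) mulr1.
have y2 t : a <= t <= b -> y t ^+ 2 < 1.
  move=> /hle h; rewrite exprMn; have r2 : r ^+ 2 < 1 by rewrite expr_lt1 // ltW.
  by apply: le_lt_trans r2; rewrite ler_piMr // sqr_ge0.
have yin t : a <= t <= b -> -1 < y t < 1.
  by move=> /y2 h; rewrite -ltr_norml -(@ltr_pXn2r _ 2) ?nnegrE // expr1n real_normK ?num_real.
have dy t : is_derive t (1 : R) y (r * dotv ('D_1 f t) p).
  have d := is_derive_dotv (derivableP (df t)) (is_derive_cst p t (1 : R)).
  have : is_derive t (1 : R) (r \*: (fun s => dotv (f s) p : R^o))
      (r *: (dotv ('D_1 f t) p + dotv (f t) 0 : R^o)) by apply: is_deriveZ.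
  by rewrite dotv0 addr0.
pose A' t := - (Num.sqrt (1 - y t ^+ 2))^-1 * (r * dotv ('D_1 f t) p).
have dA t : a <= t <= b -> is_derive t (1 : R) (fun s => acos (y s)) (A' t).
  by move=> /yin yt; apply: (@is_derive1_comp R acos y); apply: is_derive1_acos.
have cA t : a <= t <= b -> {for t, continuous A'}.
  move=> /y2 yt; apply: cvgM.
    apply: cvgN; apply: cvgV; first by rewrite sqrtr_eq0 -ltNge subr_gt0.
    apply: (@cvg_comp _ _ _ (fun s => 1 - y s ^+ 2) Num.sqrt); last exact: sqrt_continuous.
    apply: cvgB; first exact: cvg_cst.
    by rewrite expr2; under eq_fun do rewrite expr2; apply: cvgM; exact: cy.
  apply: cvgM; first exact: cvg_cst.
  by apply: cvg_dotv; [exact: cdf|exact: cvg_cst].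
have cv : continuous (fun t => enorm ('D_1 f t)) by move=> t; apply: cvg_enorm; exact: cdf.
apply: (FTC_le_integral ab dA cA cv) => t tab.
have w0 : 0 < Num.sqrt (1 - y t ^+ 2) by rewrite sqrtr_gt0 subr_gt0 y2.
rewrite /A' mulNr mulrC -mulNr ler_pdivrMr //.
set v := 'D_1 f t; set h := dotv (f t) p.
have ff : dotv (f t) (f t) = 1 by exact: sf.
have pp : dotv p p = 1 by exact: sp.
(* Only the part of [p] tangent at [f t] counts. Its squared length is [1 - h ^+ 2], and [r ^+ 2 *
   (1 - h ^+ 2) <= 1 - r ^+ 2 * h ^+ 2] because [r < 1]. *)
have vp : dotv v p = dotv v (p - h *: f t).
  by rewrite dotvBr dotvZr (dotvC v (f t)) tang // mulr0 subr0.
have q2 : dotv (p - h *: f t) (p - h *: f t) = 1 - h ^+ 2.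
  by rewrite dotvBl !dotvBr !dotvZl !dotvZr ff pp (dotvC p) -/h; ring.
have CS : - dotv v p <= enorm v * enorm (p - h *: f t).
  by rewrite vp -dotvNl -[enorm v]enormN dotv_le_enorm.
have qle : r * enorm (p - h *: f t) <= Num.sqrt (1 - y t ^+ 2).
  rewrite -[r]ger0_norm ?(ltW r0) // -enormZ /enorm dotvZl dotvZr q2.
  apply: ler_wsqrtr; rewrite /y -/h exprMn.
  have : r ^+ 2 <= 1 by rewrite expr_le1 // ltW.
  by rewrite expr2 mulrA; lra.
apply: le_trans (_ : r * (enorm v * enorm (p - h *: f t)) <= _).
  by rewrite -mulrN ler_wpM2l // ltW.
by rewrite mulrCA ler_wpM2l ?enorm_ge0.
Qed.

Lemma hdist_antipode_ge (G : set 'M[R]_n.+1) (p : 'cV[R]_n.+1) : sphere p ->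
  ((pi : R)%:E <= hdist G p (- p))%E.
Proof.
move=> sp; apply: le_ereal_inf_tmp => l [k [ts [fs]]].
move=> [k0 [ts0 [tsk [tslt [fC1 [fS [fj [f0 [fk [_ ->]]]]]]]]]].
apply/lee_subgt0Pr => e e0.
(* With [r = cos eta] the shrunk angle runs from [eta] at [p] to [pi - eta] at [- p], a loss of
   [2 * eta <= e]. The bound [1 / 2] keeps [cos eta] strictly between 0 and 1. *)
pose eta := Num.min (e / 2) (1 / 2).
have eta0 : 0 < eta by rewrite lt_min !divr_gt0.
have eta1 : eta <= 1 / 2 by rewrite ge_min lexx orbT.
have etae : eta <= e / 2 by rewrite ge_min lexx.
have pi1 : 1 <= pi / 2 :> R by exact: pihalf_ge1.
have r01 : 0 < cos eta < 1.
  apply/andP; split; first by apply: cos_gt0_pihalf; apply/andP; split; lra.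
  rewrite -(@cos0 R) ltr_cos ?in_itv /=; [exact: eta0|apply/andP; split; lra..].
have acosr : acos (cos eta) = eta by rewrite cosK // in_itv /=; apply/andP; split; lra.
pose v i := if (i < k)%N then fs i (ts i) else fs k.-1 1.
pose A i := acos (cos eta * dotv (v i) p).
have vS i : (i < k)%N -> v i.+1 = fs i (ts i.+1).
  move=> ik; rewrite /v; case: ltnP => ik1; first by rewrite fj.
  have ek : i.+1 = k by apply/eqP; rewrite eqn_leq ik ik1.
  by rewrite -ek /= ek tsk.
have pp : dotv p p = 1 by exact: sp.
have A0 : A 0%N = eta by rewrite /A /v k0 ts0 f0 pp mulr1 acosr.
have Ak : A k = pi - eta.
  rewrite /A /v ltnn fk dotvNl pp mulrN1 acosN ?acosr //.
  by move: r01 => /andP[ra rb]; apply/andP; split; lra.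
apply: (@le_trans _ _ (\sum_(i < k) (A i.+1 - A i)%:E)%E); last first.
  apply: lee_sum => i _; rewrite /A vS // /v ltn_ord.
  apply: angle_le_length => //; [exact: tslt|exact: fC1|].
  by move=> t; apply: fS.
rewrite sumEFin -(big_mkord xpredT (fun i => A i.+1 - A i)) telescope_sumr // A0 Ak.
rewrite -EFinB lee_fin; lra.
Qed.

End LowerBound.

(** * Regular points *)

Lemma poly_roots_finite (K : idomainType) (P : {poly K}) :
  P != 0 -> exists rs : seq K, forall x, root P x -> x \in rs.
Proof.
have [m] := ubnP (size P); elim: m P => // m IH P Pm P0.
have [[x rx]|nr] := pselect (exists x, root P x); last first.
  by exists [::] => x rx; case: nr; exists x.
have [Q PQ] := factor_theorem _ _ rx.
have Q0 : Q != 0 by apply: contraNneq P0 => Q0; rewrite PQ Q0 mul0r.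
have Qm : (size Q < m)%N.
  by move: Pm; rewrite PQ size_Mmonic ?monicXsubC // size_XsubC addn2 /=.
have [rs rsP] := IH Q Qm Q0; exists (x :: rs) => y.
rewrite PQ rootM root_XsubC inE => /orP[/rsP->|->] //; exact: orbT.
Qed.

Lemma poly_neq0_right0 (R : realFieldType) (P : {poly R}) :
  P != 0 -> exists2 d : R, 0 < d & forall s, 0 < s < d -> P.[s] != 0.
Proof.
move=> /poly_roots_finite[rs rsP].
suff [d d0 dP] : exists2 d : R, 0 < d & forall s, 0 < s < d -> s \notin rs.
  by exists d => // s /dP; apply: contraNN => /rsP.
elim: rs {rsP} => [|x rs [d d0 dP]]; first by exists 1.
have [x0|x0] := ltP 0 x.
  exists (Num.min x d) => [|s]; first by rewrite lt_min x0.
  rewrite lt_min inE => /and3P[s0 sx sd].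
  by rewrite (lt_eqF sx) /=; apply: dP; rewrite s0.
exists d => // s sd; rewrite inE negb_or dP // andbT gt_eqF //.
by case/andP: sd => s0 _; exact: le_lt_trans s0.
Qed.

(** Induction on the list: its head is a cutting point if it lies inside the interval, and is
    dropped otherwise. *)
Lemma interval_subdivision (R : realDomainType) (Q : R -> R -> Prop) (bad : R -> Prop) (rs : seq R) :
  (forall s t, s < t -> (forall u, s < u < t -> ~ bad u) -> Q s t) ->
  (forall s u t, s < u -> u < t -> Q s u -> Q u t -> Q s t) ->
  forall s t, s < t -> (forall u, s < u < t -> bad u -> u \in rs) -> Q s t.
Proof.
move=> Qgood Qcat; elim: rs => [|x rs IH] s t st rsP.
  by apply: Qgood => // u su /(rsP u su).
have [/andP[sx xt]|nx] := boolP (s < x < t).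
  apply: (Qcat s x t) => //; apply: IH => // u /andP[u1 u2] bu.
    by have := rsP u; rewrite u1 (lt_trans u2 xt) inE (lt_eqF u2) => /(_ isT bu).
  by have := rsP u; rewrite (lt_trans sx u1) u2 inE (gt_eqF u1) => /(_ isT bu).
apply: IH => // u su bu; have := rsP u su bu; rewrite inE => /orP[/eqP ux|//].
by move: nx; rewrite -ux su.
Qed.

Section Chains.
Context {R : realType} {n : nat} (G : set 'M[R]_n.+1).

Inductive arcs : 'cV[R]_n.+1 -> 'cV[R]_n.+1 -> R -> Prop :=
| arcs1 p q l : harc G p q l -> arcs p q l
| arcsS p q q' l l' : harc G p q l -> arcs q q' l' -> arcs p q' (l + l').

Lemma arcs_cat p q q' l l' : arcs p q l -> arcs q q' l' -> arcs p q' (l + l').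
Proof.
elim=> [{}p {}q {}l h a|{}p u {}q m m' h _ IH a]; first exact: arcsS h a.
by rewrite -addrA; apply: arcsS h _; exact: IH.
Qed.

Lemma hdist_arcs p q l : arcs p q l -> (hdist G p q <= l%:E)%E.
Proof.
suff chain : arcs p q l -> exists (k : nat) (v : nat -> 'cV[R]_n.+1) (m : nat -> R),
    [/\ (0 < k)%N, v 0%N = p, v k = q, forall i, (i < k)%N -> harc G (v i) (v i.+1) (m i) &
        \sum_(i < k) m i = l].
  by move=> /chain[k [v [m [k0 <- <- vP <-]]]]; exact: hdist_chain.
elim=> [{}p {}q {}l h|{}p u {}q {}l l' h _ [k [v [m [k0 v0 vk vP ml]]]]].
  exists 1%N, (fun i => if i is 0%N then p else q), (fun=> l); split=> // [[|//]|] //.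
  by rewrite big_ord1.
exists k.+1, (fun i => if i is j.+1 then v j else p), (fun i => if i is j.+1 then m j else l).
split=> // [[_|i ik]|]; [by rewrite v0|exact: vP|].
by rewrite big_ord_recl /= ml.
Qed.

End Chains.

Section Regular.
Context {R : realType} {n : nat} (G : set 'M[R]_n.+1).
Hypothesis subG : is_subgroup G.
Hypothesis orthG : G `<=` @orthogonal_mx R n.

(** Expresses that the orbit tangent at [v] has dimension at least [r], by a nonzero Gram
    determinant, which is the quantity polynomial along chords. *)
Definition regular r (v : 'cV[R]_n.+1) := exists2 B : 'I_r -> 'M[R]_n.+1,
  forall j, lie_alg G (B j) & gram_det B v != 0.

Definition max_orbit_dim r := (exists2 v, sphere v & regular r v) /\
  forall r' v, regular r' v -> (r' <= r)%N.

Lemma regular_le r v : regular r v -> (r <= n.+1)%N.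
Proof.
move=> [B _ dB]; have U : gram B v \in unitmx by rewrite unitmxE unitfE.
rewrite -(mxrank_unit U); apply: leq_trans (mxrankM_maxr _ _) _; exact: rank_leq_row.
Qed.

Lemma gram_detZ r (B : 'I_r -> 'M[R]_n.+1) (a : R) v :
  gram_det B (a *: v) = (a ^+ 2) ^+ r * gram_det B v.
Proof.
have e : field_mx B (a *: v) = a *: field_mx B v.
  by apply/matrixP => i j; rewrite [LHS]mxE -scalemxAr [LHS]mxE [RHS]mxE [X in _ = _ * X]mxE.
by rewrite /gram_det /gram e -scalemxAr [X in X *m _]linearZ /= -scalemxAl scalerA -expr2 detZ.
Qed.

Lemma exists_sphere_scale (v : 'cV[R]_n.+1) : exists2 u, sphere u & v = enorm v *: u.
Proof.
have [->|v0] := eqVneq v 0.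
  exists (delta_mx 0 0); last by rewrite enorm0 scale0r.
  rewrite /sphere /= dotvE (bigD1 0) //= big1 ?addr0 => [|i /negbTE i0]; rewrite !mxE ?eqxx ?mulr1 //.
  by rewrite i0 /= mul0r.
have e0 : enorm v != 0 by rewrite enorm_eq0.
exists ((enorm v)^-1 *: v); last by rewrite scalerA divff // scale1r.
by rewrite /sphere /= dotvZl dotvZr -sqr_enorm; field.
Qed.

Lemma exists_max_orbit_dim : exists r, max_orbit_dim r.
Proof.
pose P r := `[< exists v, regular r v >].
have ex : exists r, P r.
  exists 0%N; apply/asboolP; exists 0, (fun=> 0) => [[]//|].
  by rewrite /gram_det det_mx00 oner_eq0.
have ub r : P r -> (r <= n.+1)%N by move=> /asboolP[v]; exact: regular_le.
case: (ex_maxnP ex ub) => r /asboolP[v [B LB Bv]] rmax; exists r; split; last first.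
  by move=> r' w rw; apply: rmax; apply/asboolP; exists w.
have [u su vu] := exists_sphere_scale v; exists u => //; exists B => //.
by apply: contraNneq Bv => u0; rewrite vu gram_detZ u0 mulr0.
Qed.

Lemma regular_grp r v h : G h -> regular r v -> regular r (h *m v).
Proof.
move=> Gh [B LB Bv]; exists (fun j => h *m B j *m h^T) => [j|]; first exact: (lie_alg_conj subG orthG).
suff e : field_mx (fun j => h *m B j *m h^T) (h *m v) = h *m field_mx B v.
  by rewrite /gram_det /gram e trmx_mul -mulmxA [h^T *m _]mulmxA (grp_trK orthG) // mul1mx.
have hK : h^T *m (h *m v) = v by rewrite mulmxA (grp_trK orthG) // mul1mx.
apply/matrixP => i j; rewrite [LHS]mxE -[_ *m (h *m v)]mulmxA hK -mulmxA [LHS]mxE [RHS]mxE.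
by apply: eq_bigr => k _; rewrite [in RHS]mxE.
Qed.

(** By maximality of [r], adding [X] to the family makes it dependent at [v]. In the relation the
    coefficient of [X] is nonzero, the fields of [B] being independent there. *)
Lemma tangent_field_mx r (B : 'I_r -> 'M[R]_n.+1) v X : max_orbit_dim r ->
  (forall j, lie_alg G (B j)) -> gram_det B v != 0 -> lie_alg G X ->
  exists a, X *m v = field_mx B v *m a.
Proof.
move=> [_ rmax] LB Bv LX.
pose B' (j : 'I_r.+1) := oapp B X (unlift ord0 j).
have LB' j : lie_alg G (B' j) by rewrite /B'; case: unlift.
have : gram_det B' v == 0.
  apply: contraT => B'v.
  have rB : regular r.+1 v by exists B'.
  by have := rmax _ _ rB; rewrite ltnn.
move=> /det0P[b b0 bB].
have C0 : field_mx B' v *m b^T = 0.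
  apply/eqP; rewrite -dotv_eq0; apply/eqP; rewrite dotv_field_mx !trmx_mul !trmxK.
  by rewrite -[b *m _ *m _]mulmxA -/(gram B' v) bB mul0mx mxE.
move: C0; rewrite field_mx_mul /field_comb big_ord_recl mulmxDl /=.
rewrite {1}/B' unlift_none /= -scalemxAl.
pose b1 : 'cV[R]_r := \col_i b 0 (lift ord0 i).
have -> : \sum_(i < r) b^T (lift ord0 i) 0 *: B' (lift ord0 i) = field_comb B b1.
  by apply: eq_bigr => i _; rewrite /B' liftK /= !mxE.
rewrite mxE -field_mx_mul => e; have [b00|b00] := eqVneq (b 0 ord0) 0; last first.
  exists (- (b 0 ord0)^-1 *: b1); rewrite -scalemxAr scaleNr.
  move/eqP: e; rewrite addr_eq0 => /eqP e.
  by rewrite -scalerN -[X *m v](scalerK b00) e.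
exfalso; move: e; rewrite b00 scale0r add0r => e.
have g0 : gram B v *m b1 = 0 by rewrite /gram -mulmxA e mulmx0.
have U : gram B v \in unitmx by rewrite unitmxE unitfE.
have b10 : b1 = 0 by rewrite -(mulKmx U b1) g0 mulmx0.
move/eqP: b0; apply; apply/rowP => i; rewrite [RHS]mxE.
case: (unliftP ord0 i) => [j ->|-> //].
by have /colP/(_ j) := b10; rewrite !mxE.
Qed.

Lemma gram_det_line_poly r (B : 'I_r -> 'M[R]_n.+1) u w :
  exists P : {poly R}, forall t, gram_det B (u + t *: w) = P.[t].
Proof.
pose M : 'M[{poly R}]_(n.+1, r) :=
  \matrix_(i, j) (((B j *m u) i 0)%:P + (B j *m w) i 0 *: 'X).
exists (\det (M^T *m M)) => t.
rewrite -/(horner_eval t _) -det_map_mx map_mxM -map_trmx.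
suff -> : map_mx (horner_eval t) M = field_mx B (u + t *: w) by [].
apply/matrixP => i j; rewrite [LHS]mxE [X in horner_eval t X]mxE [RHS]mxE.
rewrite mulmxDr -scalemxAr [RHS]mxE [X in _ = _ + X]mxE /horner_eval.
by rewrite hornerD hornerC hornerZ hornerX mulrC.
Qed.

End Regular.

(** * The upper bound *)

Lemma is_derive1_continuous (R : realType) (f : R -> R) (t f' : R) :
  is_derive t (1 : R) f f' -> {for t, continuous f}.
Proof. by case=> df _; apply: differentiable_continuous; exact/derivable1_diffP. Qed.

Section ChordProfile.
Context {R : realType} (d : R).
Hypotheses (d0 : 0 <= d) (d4 : d < 4).

(* Squared norm of the point at time [t] of a chord of squared length [d] of the unit
   sphere, and the numerator of its angular speed. *)
Definition chord_sqnorm (t : R) : R := 1 - d * (t - t ^+ 2).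
Definition chord_area : R := Num.sqrt (d * (1 - d / 4)).

Lemma chord_sqnorm_gt0 t : 0 < chord_sqnorm t.
Proof.
have -> : chord_sqnorm t = (1 - d / 4) + d * (t - 1 / 2) ^+ 2 by rewrite /chord_sqnorm; field.
have : 0 <= d * (t - 1 / 2) ^+ 2 by rewrite mulr_ge0 // sqr_ge0.
by move: (_ * _) d4 => x; lra.
Qed.

Lemma is_derive_chord_sqnorm t : is_derive t (1 : R) chord_sqnorm (d * (2 * t - 1)).
Proof.
have -> : chord_sqnorm = (cst (1 : R) - d \*: (id - id ^+ 2 : R -> R)).
  by [].
by apply: is_derive_eq; rewrite /GRing.scale /= expr1; ring.
Qed.

Definition chord_scale (t : R) : R := (Num.sqrt (chord_sqnorm t))^-1.
Definition chord_scale' (t : R) : R :=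
  - (d * (2 * t - 1) / 2) * chord_scale t / chord_sqnorm t.

Lemma is_derive_chord_scale t : is_derive t (1 : R) chord_scale (chord_scale' t).
Proof.
have N0 := chord_sqnorm_gt0 t.
have S0 : Num.sqrt (chord_sqnorm t) != 0 by rewrite gt_eqF // sqrtr_gt0.
have dS : is_derive t (1 : R) (Num.sqrt \o chord_sqnorm)
    ((2 * Num.sqrt (chord_sqnorm t))^-1 * (d * (2 * t - 1))).
  apply: is_derive1_comp; [exact: is_derive1_sqrt|exact: is_derive_chord_sqnorm].
have dV := is_deriveV (f := Num.sqrt \o chord_sqnorm) S0.
apply: is_derive_eq; rewrite /chord_scale' /chord_scale /GRing.scale /=.
rewrite -[X in _ = _ / X](sqr_sqrtr (ltW N0)); field.
by rewrite S0.
Qed.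

Lemma continuous_chord_sqnorm : continuous chord_sqnorm.
Proof. by move=> t; exact: is_derive1_continuous (is_derive_chord_sqnorm t). Qed.

Lemma continuous_chord_scale' : continuous chord_scale'.
Proof.
move=> t; apply: cvgM; last first.
  by apply: cvgV; [rewrite gt_eqF // chord_sqnorm_gt0|exact: continuous_chord_sqnorm].
apply: cvgM; last exact: is_derive1_continuous (is_derive_chord_scale t).
apply: cvgN; apply: cvgM; last exact: cvg_cst.
apply: cvgM; first exact: cvg_cst.
by apply: cvgB; last exact: cvg_cst; apply: cvgM; [exact: cvg_cst|exact: cvg_id].
Qed.

Lemma continuous_chord_speed : continuous (fun t => chord_area / chord_sqnorm t).
Proof.
move=> t; apply: cvgM; first exact: cvg_cst.
by apply: cvgV; [rewrite gt_eqF // chord_sqnorm_gt0|exact: continuous_chord_sqnorm].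
Qed.

(** The primitive is the angle measured from the foot of the perpendicular from the origin to the
    chord. For [d = 0] the chord is a point and [chord_area] cannot be divided by. *)
Lemma chord_angle : exists2 theta : R -> R,
  forall t, is_derive t (1 : R) theta (chord_area / chord_sqnorm t) &
  theta 1 - theta 0 <= pi.
Proof.
have [dz|dn] := eqVneq d 0.
  exists (cst 0) => [t|]; last by rewrite subrr pi_ge0.
  by rewrite /chord_area dz mul0r sqrtr0 mul0r; exact: is_derive_cst.
have dp : 0 < d by rewrite lt_neqAle eq_sym dn.
have A2 : 0 < d * (1 - d / 4) by rewrite mulr_gt0 //; move: d4 => ?; lra.
have A0 : 0 < chord_area by rewrite sqrtr_gt0.
exists (fun t => atan ((d * t - d / 2) / chord_area)) => [t|]; last first.
  have := atan_ltpi2 ((d * 1 - d / 2) / chord_area).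
  by have := atan_gtNpi2 ((d * 0 - d / 2) / chord_area); lra.
have dl : is_derive t (1 : R) (fun t => (d * t - d / 2) / chord_area) (d / chord_area).
  have -> : (fun t => (d * t - d / 2) / chord_area) =
      (chord_area^-1 \*: (d \*: id - cst (d / 2) : R -> R)).
    by apply/funext => x; rewrite mulrC.
  by apply: is_derive_eq; rewrite /GRing.scale /= subr0 mulr1 mulrC.
have da := @is_derive1_comp R atan (fun t => (d * t - d / 2) / chord_area) t _ _
  (is_derive1_atan _) dl.
apply: is_derive_eq; rewrite /=.
have N0 := chord_sqnorm_gt0 t.
have e : chord_area ^+ 2 + (d * t - d / 2) ^+ 2 = d * chord_sqnorm t.
  by rewrite sqr_sqrtr ?ltW // /chord_sqnorm; field.
have -> : 1 + ((d * t - d / 2) / chord_area) ^+ 2 = d * chord_sqnorm t / chord_area ^+ 2.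
  by rewrite -e; field; rewrite gt_eqF.
by field; rewrite dn !gt_eqF.
Qed.

End ChordProfile.

Section RegularUpperBound.
Context {R : realType} {n : nat} (G : set 'M[R]_n.+1).
Hypothesis subG : is_subgroup G.
Hypothesis orthG : G `<=` @orthogonal_mx R n.
Hypothesis closedG : closed G.

Lemma lie_alg_field_comb r (B : 'I_r -> 'M[R]_n.+1) a :
  (forall j, lie_alg G (B j)) -> lie_alg G (field_comb B a).
Proof.
move=> LB; rewrite /field_comb; elim/big_ind: _ => [|X Y|j _].
- exact: lie_alg0.
- exact: lie_algD.
- exact: lie_algZ.
Qed.

Lemma sphere_dotv_gtN1 (p x : 'cV[R]_n.+1) : sphere p -> sphere x -> x != - p -> -1 < dotv p x.
Proof.
move=> sp sx xp; have pp : dotv p p = 1 := sp; have xx : dotv x x = 1 := sx.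
have : 0 < dotv (x + p) (x + p) by rewrite lt_neqAle eq_sym dotv_eq0 addr_eq0 xp dotv_ge0.
by rewrite dotvDl !dotvDr pp xx (dotvC x p); lra.
Qed.

Lemma sphere_dotv_le1 (p x : 'cV[R]_n.+1) : sphere p -> sphere x -> dotv p x <= 1.
Proof.
move=> sp sx; have := dotv_ge0 (x - p).
by rewrite dotvBl !dotvBr (dotvC x p) (sp : dotv p p = 1) (sx : dotv x x = 1); lra.
Qed.

Lemma chord_sphere_dotv (p x : 'cV[R]_n.+1) t (d := 2 - 2 * dotv p x) : sphere p -> sphere x ->
  [/\ dotv (chord p x t) (chord p x t) = chord_sqnorm d t,
      dotv (chord p x t) (x - p) = d * (2 * t - 1) / 2 & dotv (x - p) (x - p) = d].
Proof.
move=> sp sx; have pp : dotv p p = 1 := sp; have xx : dotv x x = 1 := sx.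
have uu : dotv (x - p) (x - p) = d by rewrite dotvBl !dotvBr pp xx (dotvC x p) /d; ring.
split=> //; last by rewrite /chord dotvDl dotvZl uu dotvBr pp /d; field.
rewrite /chord dotvDl !dotvDr !dotvZl !dotvZr uu (dotvC (x - p) p) dotvBr pp.
by rewrite /chord_sqnorm /d; ring.
Qed.

Lemma enorm_sphere (p : 'cV[R]_n.+1) : sphere p -> enorm p = 1.
Proof. by move=> sp; rewrite /enorm (sp : dotv p p = 1) sqrtr1. Qed.

(* Since [d N - (N' / 2)^2 = d (1 - d / 4)] along a chord, the angular speed is at most
   [chord_area d / N], also after projecting the velocity [w] to the normal space. *)
Lemma chord_speed_le (d t : R) (sg w : 'cV[R]_n.+1) : 0 <= d -> d < 4 ->
  dotv sg sg = chord_sqnorm d t -> dotv sg w = d * (2 * t - 1) / 2 -> dotv w w <= d ->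
  enorm (chord_scale' d t *: sg + chord_scale d t *: w) <= chord_area d / chord_sqnorm d t.
Proof.
move=> d0 d4 ss sw wd; have N0 := chord_sqnorm_gt0 d0 d4 t.
rewrite enorm_le ?divr_ge0 ?sqrtr_ge0 ?(ltW N0) //.
have k2 : chord_scale d t ^+ 2 = (chord_sqnorm d t)^-1 by rewrite exprVn sqr_sqrtr // ltW.
rewrite dotvDl !dotvDr !dotvZl !dotvZr (dotvC w) ss sw /chord_scale'.
rewrite exprMn exprVn sqr_sqrtr; last by rewrite mulr_ge0 //; lra.
set W := dotv w w in wd *; set k := chord_scale d t in k2 *.
set N := chord_sqnorm d t in N0 k2 *; set b := d * (2 * t - 1) / 2.
have -> : - b * k / N * (- b * k / N * N) + - b * k / N * (k * b) +
   (k * (- b * k / N * b) + k * (k * W)) = k ^+ 2 * (W - b ^+ 2 / N) by field; rewrite gt_eqF.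
rewrite k2.
have NE : d * N - b ^+ 2 = d * (1 - d / 4) by rewrite /N /chord_sqnorm /b; field.
rewrite -NE; have -> : (d * N - b ^+ 2) / N ^+ 2 = N^-1 * (d - b ^+ 2 / N).
  by field; rewrite gt_eqF.
by rewrite ler_wpM2l ?invr_ge0 ?(ltW N0) // lerB.
Qed.

(** The limit curve is cut at the roots of the Gram polynomial; each piece costs at most its
    increment of [theta], so the total does not depend on the number of cuts. The condition on [q]
    keeps the chord off the origin, where radial projection is undefined. *)
Lemma arcs_regular r (p q : 'cV[R]_n.+1) : max_orbit_dim G r -> regular G r p ->
  sphere p -> sphere q -> (forall a, G a -> a *m q <> - p) ->
  exists2 l, l <= pi & arcs G p q l.
Proof.
move=> rmax [B LB Bp] sp sq npq.
have [x [c [g [[x1 [a Ga xE] c0 c1] cG clip cdiff]]]] :=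
  transport_limit subG orthG closedG LB (enorm_sphere sp) (enorm_sphere sq).
have pp : dotv p p = 1 := sp.
have xx : dotv x x = 1 by rewrite -sqr_enorm x1 expr1n.
have xp : x != - p by rewrite xE; apply/eqP; exact: npq.
set mu := dotv p x; have mu1 : -1 < mu by exact: sphere_dotv_gtN1.
have mu2 : mu <= 1 by exact: sphere_dotv_le1.
pose d := 2 - 2 * mu.
have d0 : 0 <= d by rewrite /d; lra.
have d4 : d < 4 by rewrite /d; lra.
pose u := x - p; pose sg t := chord p x t.
have sx : sphere x by exact: xx.
have uu : dotv u u = d by have [] := chord_sphere_dotv 0 sp sx.
have sgu t : dotv (sg t) u = d * (2 * t - 1) / 2 by have [] := chord_sphere_dotv t sp sx.
have ss t : dotv (sg t) (sg t) = chord_sqnorm d t by have [] := chord_sphere_dotv t sp sx.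
have [theta dth thpi] := chord_angle d0 d4.
exists (theta 1 - theta 0) => //.
have [P PE] := gram_det_line_poly B p u.
(* Its value at 0 is the Gram determinant at the regular point [p]. *)
have P0 : P != 0.
  by apply: contraNneq Bp => P0; rewrite -[p]addr0 -(scale0r u) PE P0 horner0.
have [rs rsP] := poly_roots_finite P0.
pose k := chord_scale d.
pose Q s t := 0 <= s -> t <= 1 -> arcs G (k s *: c s) (k t *: c t) (theta t - theta s).
have k0 : k 0 = 1 by rewrite /k /chord_scale /chord_sqnorm expr0n !subr0 mulr0 subr0 sqrtr1 invr1.
have k1 : k 1 = 1 by rewrite /k /chord_scale /chord_sqnorm expr1n subrr mulr0 subr0 sqrtr1 invr1.
suff : Q 0 1 by move=> /(_ (lexx _) (lexx _)); rewrite k0 k1 !scale1r c0 c1.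
apply: (@interval_subdivision _ Q (root P) rs _ _ 0 1 ltr01 (fun v _ => rsP v)); last first.
  move=> s v t sv vt Qs Qt s0 t1.
  have -> : theta t - theta s = (theta v - theta s) + (theta t - theta v) by ring.
  apply: arcs_cat; [apply: Qs => //|apply: Qt => //].
    exact: ltW (lt_le_trans vt t1).
  exact: ltW (le_lt_trans s0 sv).
move=> s t st good s0 t1; apply: arcs1.
have in01 v : s <= v <= t -> 0 <= v <= 1.
  by move=> /andP[sv vt]; rewrite (le_trans s0 sv) (le_trans vt t1).
have in01' v : s < v < t -> 0 <= v <= 1 by move=> /andP[/ltW sv /ltW vt]; apply: in01; rewrite sv.
have gd v : s < v < t -> gram_det B (sg v) != 0.
  by move=> /good; rewrite /sg /chord -/u PE => /negP.
pose w v := u - vert_comb B (sg v) u *m sg v.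
pose V v := (g v)^T *m w v.
have gT v : 0 <= v <= 1 -> G (g v)^T by move=> /cG[Gg _]; exact: grpT.
have LY v : lie_alg G (vert_comb B (sg v) u) by exact: lie_alg_field_comb.
have wY v : s < v < t -> dotv (w v) (vert_comb B (sg v) u *m sg v) = 0.
  by move=> /gd h; rewrite -field_mx_mul; exact: vert_comb_ortho.
have sw v : dotv (sg v) (w v) = d * (2 * v - 1) / 2.
  by rewrite /w dotvBr sgu (lie_alg_dotvv orthG) // subr0.
have ww v : s < v < t -> dotv (w v) (w v) <= d.
  move=> h; have := dotv_ge0 (vert_comb B (sg v) u *m sg v).
  have : dotv (w v + vert_comb B (sg v) u *m sg v) (w v + vert_comb B (sg v) u *m sg v) = d.
    by rewrite /w subrK.
  move: (wY v h); move: (w v) (_ *m _) => a1 a2 e.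
  by rewrite dotvDl !dotvDr (dotvC a2 a1) e; lra.
have cE v : 0 <= v <= 1 -> c v = (g v)^T *m sg v by move=> /cG[].
have kcV (k2 v : R) : 0 <= v <= 1 ->
    k2 *: c v + k v *: V v = (g v)^T *m (k2 *: sg v + k v *: w v).
  by move=> v01; rewrite mulmxDr -!scalemxAr cE.
apply: (@harc_reparam R n G s t 8 c V k (chord_scale' d) theta
          (fun v => chord_area d / chord_sqnorm d v)) => //.
- by move=> s' t' /in01 s'1 /in01 t'1; exact: clip.
- move=> v sv; rewrite enorm_le // (dotv_grp orthG) //; last exact: gT (in01' _ sv).
  by apply: le_trans (ww v sv) _; apply: le_trans (ltW d4) _; rewrite -natrX ler_nat.
- move=> t0 t0in z z0; have [e e0 eP] := cdiff t0 (in01' _ t0in) (gd _ t0in) z z0.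
  by exists e => // s' t' /in01 s'1 /in01 t'1; exact: eP.
- exact: is_derive_chord_scale.
- exact: continuous_chord_scale'.
- move=> v /in01 v01; rewrite enormZ cE // /enorm (dotv_grp orthG); last exact: gT.
  have N0 := chord_sqnorm_gt0 d0 d4 v.
  rewrite ss /k /chord_scale ger0_norm ?invr_ge0 ?sqrtr_ge0 // mulVf //.
  by rewrite gt_eqF // sqrtr_gt0.
(* Conjugating [X] by [g v] moves the test from [c v] to [sg v]. There the radial part drops out by
   skewness, and [w v] is normal to the whole orbit tangent, which the fields of [B] span by
   [tangent_field_mx]. *)
- move=> v X vst LX; have v01 := in01' v vst; rewrite kcV // cE //.
  have [Gg _] := cG v v01.
  have gg : g v *m (g v)^T = 1%:M by exact: (grpKtr orthG).
  rewrite dotv_mulmxl trmxK !mulmxA.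
  have LX' : lie_alg G (g v *m X *m (g v)^T) by exact: (lie_alg_conj subG orthG).
  rewrite dotvDl !dotvZl (lie_alg_dotvv orthG) // mulr0 add0r.
  have [a' ->] := tangent_field_mx rmax LB (gd v vst) LX'.
  by rewrite vert_comb_ortho ?mulr0 // gd.
- exact: continuous_chord_speed.
move=> v vst; have v01 := in01' v vst; rewrite kcV // /enorm (dotv_grp orthG); last exact: gT.
exact: (chord_speed_le d0 d4 (ss v) (sw v) (ww v vst)).
Qed.

End RegularUpperBound.

(** * Endpoints in arbitrary position *)

Section UpperBound.
Context {R : realType} {n : nat} (G : set 'M[R]_n.+1).
Hypothesis subG : is_subgroup G.
Hypothesis orthG : G `<=` @orthogonal_mx R n.
Hypothesis closedG : closed G.

(** On a sphere, maximal inner product means minimal distance, so [h *m v] is a point of the orbit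
    of [v] closest to [p]. It exists because [G] is closed and bounded. *)
Lemma orbit_farthest (p v : 'cV[R]_n.+1) :
  exists2 h, G h & forall g, G g -> dotv p (g *m v) <= dotv p (h *m v).
Proof.
pose S := [set dotv p (g *m v) | g in G].
have ubS : has_ubound S.
  exists (enorm p * enorm v) => _ [g Gg <-].
  apply: le_trans (dotv_le_enorm _ _) _.
  by rewrite {2}/enorm (dotv_grp orthG) // lexx.
have supS : has_sup S.
  by split=> //; exists (dotv p (1%:M *m v)), 1%:M => //; exact: grp1.
have /choice[h hP] : forall k : nat, exists h, G h /\ sup S - k.+1%:R^-1 < dotv p (h *m v).
  move=> k; have k0 : 0 < k.+1%:R^-1 :> R by rewrite invr_gt0.
  by have [_ [g Gg <-] gP] := sup_adherent k0 supS; exists g.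
have [U [UU Uoo]] := free_ultrafilter.
have FU : ProperFilter U by exact: ultra_proper.
have hG k : G (h k) by have [] := hP k.
have [h0 hU] : exists h0 : 'M[R]_n.+1, h @ U --> h0.
  apply: (@ultra_bounded_cvg R U _ _ h 1); apply: nearW => k i j.
  by apply: opbound_entry; apply: opbound_isometry; exact: (grp_trK orthG).
have Gh0 : G h0 by apply: (@closed_cvg _ _ U _ h G closedG _ h0) => //; exact: nearW.
exists h0 => // g Gg; apply: (@le_trans _ _ (sup S)).
  by apply: ub_le_sup => //; exists g.
have lim : dotv p (h k *m v) @[k --> U] --> dotv p (h0 *m v).
  by apply: cvg_dotv; [exact: cvg_cst|apply: cvg_mulmx => //; exact: cvg_cst].
have eU : (fun k => k.+1%:R^-1 : R) @ U --> (0 : R).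
  by apply: cvg_trans (@cvg_harmonic R); apply: cvg_fmap2.
have lim' : sup S - k.+1%:R^-1 @[k --> U] --> sup S - 0.
  by apply: cvgB => //; exact: cvg_cst.
rewrite subr0 in lim'.
by apply: (ler_cvg_to lim' lim); apply: nearW => k; apply: ltW; have [] := hP k.
Qed.

(** First variation: one-sided difference quotients at the maximum are nonpositive, for [X] and for
    [- X]. *)
Lemma farthest_normal (p w : 'cV[R]_n.+1) X :
  (forall g, G g -> dotv p (g *m w) <= dotv p w) -> lie_alg G X -> dotv p (X *m w) = 0.
Proof.
move=> wmax; suff half Y : lie_alg G Y -> dotv p (Y *m w) <= 0.
  move=> LX; apply/eqP; rewrite eq_le half //=.
  have := half _ (lie_algZ subG (-1) LX).
  by rewrite scaleN1r mulNmx dotvNr; lra.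
move=> /lie_algP[c [cG c0 cY]].
have lim : dotv p (h^-1 *: (c h - 1%:M) *m w) @[h --> 0^'+] --> dotv p (Y *m w).
  apply: cvg_dotv; first exact: cvg_cst.
  by apply: cvg_mulmx; [exact: cvg_dnbhs_at_right|exact: cvg_cst].
apply: (cvgr_to_le lim).
near=> h; have h0 : 0 < h by near: h; exact: nbhs_right_gt.
rewrite -scalemxAl dotvZr mulmxBl mul1mx dotvBr pmulr_rle0 ?invr_gt0 // subr_le0.
exact: wmax.
Unshelve. all: by end_near. Qed.

(** By skewness, normality of the segment at [w] implies normality at [p] and at every point
    between. The projected segment therefore needs no transport, and its length tends to 0 with [s]
    by continuity of [theta]. *)
Lemma segment_arc (p w : 'cV[R]_n.+1) : sphere p -> sphere w -> w != - p ->
  (forall g, G g -> dotv p (g *m w) <= dotv p w) ->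
  let d := 2 - 2 * dotv p w in
  forall e, 0 < e -> exists2 s0 : R, 0 < s0 & forall s, 0 < s < s0 ->
  exists2 l, l <= e & harc G p (chord_scale d s *: chord p w s) l.
Proof.
move=> sp sw pw wmax d e e0.
have d0 : 0 <= d by rewrite /d; have := sphere_dotv_le1 sp sw; lra.
have d4 : d < 4 by rewrite /d; have := sphere_dotv_gtN1 sp sw pw; lra.
have [theta dth _] := chord_angle d0 d4.
have cth : {for 0, continuous theta} by exact: is_derive1_continuous (dth 0).
have /cvgrPdist_le/(_ e e0)/nbhs_ballP[s0 /= s00 s0P] := cth.
exists s0 => // s /andP[sp0 ss0]; exists (theta s - theta 0).
  have /s0P : ball (0 : R) s0 s by rewrite /ball /= sub0r normrN gtr0_norm.
  by rewrite /= distrC; apply: le_trans; exact: ler_norm.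
have eq0 : chord_scale d 0 *: chord p w 0 = p.
  by rewrite /chord scale0r addr0 /chord_scale /chord_sqnorm expr0n subrr mulr0 subr0 sqrtr1 invr1 scale1r.
rewrite -{1}eq0.
have uu : dotv (w - p) (w - p) = d by have [] := chord_sphere_dotv 0 sp sw.
have u2 : enorm (w - p) <= 2.
  by rewrite enorm_le // uu; apply: le_trans (ltW d4) _; rewrite -natrX ler_nat.
have cD s1 t1 : chord p w t1 - chord p w s1 = (t1 - s1) *: (w - p).
  by rewrite /chord opprD addrACA subrr add0r scalerBl.
apply: (@harc_reparam R n G 0 s 2 (chord p w) (fun=> w - p) (chord_scale d) (chord_scale' d) theta
          (fun v => chord_area d / chord_sqnorm d v)) => //.
- by move=> s1 t1 _ _; rewrite cD enormZ mulrC ler_wpM2r.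
- move=> t0 _ z z0; exists 1 => // s1 t1 _ _ _ _.
  by rewrite cD subrr enorm0 mulr_ge0 // ltW.
- exact: is_derive_chord_scale.
- exact: continuous_chord_scale'.
- move=> v _; have N0 := chord_sqnorm_gt0 d0 d4 v.
  have [sv _ _] := chord_sphere_dotv v sp sw.
  rewrite enormZ /enorm sv /chord_scale ger0_norm ?invr_ge0 ?sqrtr_ge0 // mulVf //.
  by rewrite gt_eqF // sqrtr_gt0.
- move=> v X _ LX; rewrite dotvDl !dotvZl (lie_alg_dotvv orthG) // mulr0 add0r.
  suff -> : dotv (w - p) (X *m chord p w v) = 0 by rewrite mulr0.
  have pXw : dotv p (X *m w) = 0 by exact: farthest_normal.
  have wXp : dotv w (X *m p) = 0 by rewrite dotvC (lie_alg_dotv orthG) // pXw oppr0.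
  rewrite /chord mulmxDr -scalemxAr mulmxBr !dotvBl !dotvDr !dotvZr !dotvBr.
  by rewrite pXw wXp !(lie_alg_dotvv orthG) //; ring.
- exact: continuous_chord_speed.
- move=> v _; have [sv dv _] := chord_sphere_dotv v sp sw.
  by apply: chord_speed_le => //; rewrite uu.
Qed.

Lemma exists_ortho_unit (p : 'cV[R]_n.+1) : (1 <= n)%N -> exists2 e, sphere e & dotv e p = 0.
Proof.
move=> n1; have k0 : kermx p != 0.
  rewrite -mxrank_eq0 mxrank_ker -lt0n subn_gt0.
  by apply: leq_ltn_trans (rank_leq_col _) _.
have y0 : nz_row (kermx p) != 0 by rewrite nz_row_eq0.
have yp : nz_row (kermx p) *m p = 0 by apply/sub_kermxP; exact: nz_row_sub.
have [e se eE] := exists_sphere_scale (nz_row (kermx p))^T; exists e => //.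
have : dotv (nz_row (kermx p))^T p = 0 by rewrite /dotv trmxK yp mxE.
rewrite eE dotvZl => /eqP; rewrite mulf_eq0 enorm_eq0 => /orP[/eqP|/eqP//].
by move=> /(congr1 trmx); rewrite trmxK trmx0 => y00; rewrite y00 eqxx in y0.
Qed.

(** Otherwise the orbit of [p] contains every point of the sphere except perhaps [- p]. For [e]
    orthogonal to [p], elements taking [e] and [- e] to [p] combine into one taking [- p] to [p],
    and the action would be transitive. *)
Lemma exists_off_orbit (p : 'cV[R]_n.+1) : (1 <= n)%N ->
  ~ (forall p q, sphere p -> sphere q -> exists g, G g /\ g *m p = q) -> sphere p ->
  exists v, [/\ sphere v, v != - p & forall g, G g -> g *m v <> p].
Proof.
move=> n1 ntrans sp; apply: contrapT => nv.
have all v : sphere v -> v != - p -> exists2 g, G g & g *m v = p.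
  move=> sv vp; apply: contrapT => ng; apply: nv; exists v; split=> // g Gg gv.
  by apply: ng; exists g.
have pp : dotv p p = 1 := sp.
have [e se ep] := exists_ortho_unit p n1.
have [g Gg ge] : exists2 g, G g & g *m e = p.
  by apply: all => //; apply/eqP => e1; move: ep; rewrite e1 dotvNl pp; lra.
have [h Gh he] : exists2 h, G h & h *m (- e) = p.
  apply: all; first by rewrite /sphere /= dotvNl dotvNr opprK; exact: se.
  by apply/eqP => /oppr_inj e1; move: ep; rewrite e1 pp; lra.
have all' v : sphere v -> exists2 g, G g & g *m v = p.
  move=> sv; have [->|] := eqVneq v (- p); last exact: all.
  exists (h *m g^T); first by apply: grpM => //; exact: grpT.
  by rewrite -ge mulmxN -!mulmxA (mulmxA g^T) (grp_trK orthG) // mul1mx -mulmxN he.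
apply: ntrans => p0 q0 sp0 sq0.
have [g0 Gg0 gp0] := all' _ sp0; have [h0 Gh0 hq0] := all' _ sq0.
exists (h0^T *m g0); split; first by apply: grpM => //; exact: grpT.
by rewrite -mulmxA gp0 -hq0 mulmxA (grp_trK orthG) // mul1mx.
Qed.

(* [v] is chosen so that the polynomial [F] below is nonzero: it vanishes at [s] whenever the
   antipode of the normalised point [z] of the segment lies on the orbit of [q]. *)
Lemma hdist_le_pi (p q : 'cV[R]_n.+1) : (1 <= n)%N ->
  ~ (forall p q, sphere p -> sphere q -> exists g, G g /\ g *m p = q) ->
  sphere p -> sphere q -> (hdist G p q <= pi%:E)%E.
Proof.
move=> n1 ntrans sp sq; apply/lee_addgt0Pr => e e0; rewrite -EFinD.
have [r rmax] := exists_max_orbit_dim G.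
have regN v : regular G r (- v) -> regular G r v.
  move=> [B LB]; rewrite -scaleN1r gram_detZ sqrrN !expr1n mul1r => Bv.
  by exists B.
(* One regular point among [p] and [v] prevents the Gram determinant from vanishing identically on
   the segment. If [p] is not regular, any regular [v] is off the orbit of [p] and distinct from
   [- p]. *)
have [v [sv vp vnp reg]] : exists v, [/\ sphere v, v != - p,
    forall g, G g -> g *m v <> p & regular G r p \/ regular G r v].
  have [rp|nrp] := pselect (regular G r p).
    by have [v [sv vp vnp]] := exists_off_orbit n1 ntrans sp; exists v; split=> //; left.
  have [[v sv rv] _] := rmax; exists v; split=> // [|g Gg gv|]; last by right.
    by apply/eqP => vp; apply: nrp; apply: regN; rewrite -vp.
  by apply: nrp; rewrite -gv; exact: regular_grp.
have [h Gh hmax] := orbit_farthest p v.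
set w := h *m v in hmax.
have sw : sphere w by rewrite /sphere /= (dotv_grp orthG).
have wmax g : G g -> dotv p (g *m w) <= dotv p w.
  by move=> Gg; rewrite mulmxA; apply: hmax; exact: grpM.
have mu1 : -1 < dotv p w.
  apply: lt_le_trans (sphere_dotv_gtN1 sp sv vp) _.
  by rewrite -[in leLHS](mul1mx v); apply: hmax; exact: grp1.
have wp : w != - p.
  by apply/eqP => w1; move: mu1; rewrite w1 dotvNr (sp : dotv p p = 1) ltxx.
have mu2 : dotv p w < 1.
  rewrite lt_neqAle (sphere_dotv_le1 sp sw) andbT; apply/eqP => m1.
  apply: (vnp h Gh); apply/eqP; rewrite -subr_eq0 -dotv_eq0; apply/eqP.
  have [_ _ ->] := chord_sphere_dotv 0 sp sw; rewrite m1; ring.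
have [s0 s00 s0P] := segment_arc sp sw wp wmax e0.
set d := 2 - 2 * dotv p w in s0P.
have d0 : 0 <= d by rewrite /d; lra.
have d4 : d < 4 by rewrite /d; lra.
have [B LB [P PE P0]] : exists2 B : 'I_r -> 'M[R]_n.+1, forall j, lie_alg G (B j) &
    exists2 P : {poly R}, forall t, gram_det B (p + t *: (w - p)) = P.[t] & P != 0.
  have [x [B LB Bx] [t xt]] : exists2 x, regular G r x & exists t, x = p + t *: (w - p).
    case: reg => [rp|rv]; first by exists p => //; exists 0; rewrite scale0r addr0.
    exists w; last by exists 1; rewrite scale1r addrC subrK.
    exact: regular_grp.
  exists B => //; have [P PE] := gram_det_line_poly B p (w - p); exists P => //.
  by apply: contraNneq Bx => P0; rewrite xt PE P0 horner0.
(* [nu] is the maximal inner product of [- q] with the orbit of [v], an invariant of the orbit of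
   [- q]. If [z] lies on that orbit, then [nu = dotv z w]; squaring and clearing the norm of the
   chord point gives [F.[s] = 0]. *)
have [h' Gh' h'max] := orbit_farthest (- q) v.
pose mu := dotv p w; pose nu := dotv (- q) (h' *m v).
pose F : {poly R} := ((1 - 'X) * mu%:P + 'X) ^+ 2 - (nu ^+ 2)%:P * (1 - d%:P * ('X - 'X ^+ 2)).
have FE t : F.[t] = ((1 - t) * mu + t) ^+ 2 - nu ^+ 2 * chord_sqnorm d t.
  by rewrite /F !hornerE /chord_sqnorm; ring.
(* The values at 0 and 1 are [mu ^+ 2 - nu ^+ 2] and [1 - nu ^+ 2]; both vanish only if
   [mu ^+ 2 = 1], which [mu1] and [mu2] exclude. *)
have F0 : F != 0.
  apply/eqP => F0; have := FE 0; have := FE 1; rewrite F0 !horner0 /chord_sqnorm => f1 f2.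
  have : mu ^+ 2 = 1 by move: f1 f2; rewrite expr0n expr1n /=; lra.
  move=> /eqP; rewrite sqrf_eq1 => /orP[]/eqP m1; move: mu1 mu2; rewrite -/mu m1; lra.
have [s1 s10 s1P] := poly_neq0_right0 (mulf_neq0 P0 F0).
pose s := Num.min (Num.min s0 s1) 1 / 2.
have m0 : 0 < Num.min (Num.min s0 s1) 1 by rewrite !lt_min s00 s10 ltr01.
have s_gt0 : 0 < s by rewrite divr_gt0.
have [ss0 ss1 sl1] : [/\ s < s0, s < s1 & s < 1].
  have h2 : s < s * 2 by rewrite ltr_pMr // ltr1n.
  by move: h2; rewrite {2}/s divfK // !lt_min => /andP[/andP[]].
have [l le pz] : exists2 l, l <= e & harc G p (chord_scale d s *: chord p w s) l.
  by apply: s0P; rewrite s_gt0.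
have N0 := chord_sqnorm_gt0 d0 d4 s.
have [zz _ _] := chord_sphere_dotv s sp sw.
have k0 : 0 < chord_scale d s by rewrite invr_gt0 sqrtr_gt0.
have k2 : chord_scale d s ^+ 2 = (chord_sqnorm d s)^-1 by rewrite exprVn sqr_sqrtr // ltW.
set z := _ *: chord p w s in pz.
have sz : sphere z.
  rewrite /sphere /= /z dotvZl dotvZr mulrA -expr2 k2 zz mulVf //.
  by rewrite gt_eqF.
have := s1P s; rewrite s_gt0 ss1 => /(_ isT); rewrite hornerM mulf_eq0 negb_or => /andP[Ps Fs].
have rz : regular G r z.
  exists B => //; rewrite /z gram_detZ mulf_neq0 //; last by rewrite /chord PE.
  by rewrite !expf_neq0 // gt_eqF.
(* [z] is a combination of [p] and [w] with nonnegative coefficients, and [w] maximises the inner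
   product with each of them over its orbit. *)
have zmax g : G g -> dotv z (g *m v) <= dotv z w.
  have -> : z = chord_scale d s *: ((1 - s) *: p + s *: w).
    by rewrite /z /chord scalerBr scalerBl scale1r addrCA addrC.
  move=> Gg; rewrite !(dotvZl (chord_scale d s)) ler_wpM2l ?(ltW k0) //.
  rewrite !dotvDl !dotvZl lerD ?ler_wpM2l ?hmax ?(ltW s_gt0) //; first by lra.
  rewrite (sw : dotv w w = 1); apply: sphere_dotv_le1 => //.
  by rewrite /sphere /= (dotv_grp orthG).
have zw : dotv z w = chord_scale d s * ((1 - s) * mu + s).
  rewrite /z dotvZl /chord dotvDl dotvZl dotvBl (sw : dotv w w = 1) -/mu; ring.
have nqz a : G a -> a *m q <> - z.
  move=> Ga aq; have qE : - q = a^T *m z.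
    by rewrite -[z]opprK -aq mulmxN mulmxA (grp_trK orthG) // mul1mx.
  have e1 : nu = dotv z w.
    apply/eqP; rewrite eq_le; apply/andP; split.
      rewrite /nu qE dotv_mulmxl trmxK mulmxA; apply: zmax; exact: grpM.
    have <- : dotv (- q) (a^T *m w) = dotv z w.
      by rewrite qE (dotv_grp orthG) //; exact: grpT.
    by rewrite /w mulmxA; apply: h'max; apply: grpM => //; exact: grpT.
  move/eqP: Fs; apply; rewrite FE e1 zw exprMn k2; field.
  by rewrite gt_eqF.
have [l' l'pi zq] := arcs_regular subG orthG closedG rmax rz sz sq nqz.
apply: le_trans (hdist_arcs (arcsS pz zq)) _; rewrite lee_fin addrC lerD //.
Qed.

End UpperBound.

(** Isometry and effectiveness are built into taking [G] as a set of orthogonal matrices, and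
    compactness into closedness. For a transitive action horizontal curves are constant and the
    horizontal distance of distinct points is infinite; the same happens on the two-point sphere
    [n = 0] with trivial [G]. *)
Theorem theorem1p3 (R : realType) (n : nat) (G : set 'M[R]_(n.+1)) :
  (1 <= n)%N ->
  is_subgroup G -> G `<=` @orthogonal_mx R n -> closed G -> connected G ->
  ~ (forall p q, sphere p -> sphere q -> exists g, G g /\ g *m p = q) ->
  infinitesimally_polar G ->
  hdiam G = (pi : R)%:E.
Proof.
move=> n1 subG orthG closedG _ ntrans _; apply/le_anti/andP; split.
  by apply: ge_ereal_sup => _ [p sp [q sq <-]]; exact: hdist_le_pi.
have [p sp _] := exists_sphere_scale (0 : 'cV[R]_n.+1).
apply: le_trans (hdist_antipode_ge G sp) _; apply: ereal_sup_ubound.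
exists p => //; exists (- p) => //.
by rewrite /sphere /= dotvNl dotvNr opprK; exact: sp.
Qed.
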